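(* Let $1<p<\infty$, let $\zeta\subset\mathbb{R}^n$ be an asymmetric $L_p$-zonoid, and let $u_1,\dots,u_n$ be linearly independent vectors of $\mathbb{R}^n$. For $\varepsilon\ge0$ let $$Z_\varepsilon=[0,u_1]\oplus_p\cdots\oplus_p[0,u_n]\oplus_p\left(\varepsilon^{1/p}\zeta\right).$$ There exists $\varepsilon_0=\varepsilon_0(\zeta,u_1,\dots,u_n)>0$ such that for any $0<\varepsilon\le\varepsilon_0$, $$|Z_\varepsilon\oplus_p-Z_\varepsilon|\le2^n|Z_\varepsilon| .$$ Equality holds if and only if $\zeta$ is of the form $\zeta=[0,a_1u_1]\oplus_p\cdots\oplus_p[0,a_nu_n]$ for some $a_1,\dots,a_n\ge0$.
   Context: $|\cdot|$ is Lebesgue measure on $\mathbb{R}^n$; $h_K(x)=\sup_{k\in K}\langle x,k\rangle$ is the support function. For compact convex sets $K,L$ containing the origin and $1\le p<\infty$, $K\oplus_pL$ is the compact convex set with $h_{K\oplus_pL}=(h_K^p+h_L^p)^{1/p}$; $-Z=\{-z:z\in Z\}$ and $Z\oplus_p-Z$ means $Z\oplus_p(-Z)$. An asymmetric $L_p$-zonotope is an $L_p$-sum of finitely many segments containing the origin; an asymmetric $L_p$-zonoid is a Hausdorff limit of asymmetric $L_p$-zonotopes. Equivalently, its support function is $h(x)=\left(\int_{\mathbb{S}^{n-1}}\langle x,u\rangle_+^p\,d\mu(u)\right)^{1/p}$ for some positive (finite Borel) measure $\mu$ on the unit sphere $\mathbb{S}^{n-1}$, with $a_+=\max(a,0)$.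 *)

(* Defs.v *)
From HB Require Import structures.
From mathcomp Require Import all_boot all_order all_algebra.
From mathcomp Require Import all_classical all_reals all_analysis.

Set Implicit Arguments.
Unset Strict Implicit.
Unset Printing Implicit Defensive.

Import Order.TTheory GRing.Theory Num.Theory.
Import numFieldNormedType.Exports.

Local Open Scope classical_set_scope.
Local Open Scope ring_scope.

(* The iterated product measure: on Borel sets of R * R^n this is the library's
   [lebesgue_measure \x _], which is by definition the integral of the measures
   of the sections. R^0 is a point of mass 1. *)
Fixpoint lebesgue_rV (R : realType) (n : nat) : set 'rV[R]_n -> \bar R :=
  match n with
  | 0 => fun A => (\1_A (0 : 'rV[R]_0))%:E
  | n'.+1 => fun A =>
      (\int[@lebesgue_measure R]_t
         lebesgue_rV [set v : 'rV[R]_n' | A (row_mx (t%:M : 'rV[R]_1) v)])%E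
  end.

Section ConvexBodies.
Context {R : realType} {n : nat}.
Implicit Types (K L M : set 'rV[R]_n) (x y : 'rV[R]_n) (h : 'rV[R]_n -> R).

Definition dot x y : R := \sum_i x 0 i * y 0 i.

Definition enorm x : R := Num.sqrt (dot x x).

(* Nonemptiness is part of the definition because the library's [sup] gives the
   empty set the support function 0, which is that of [[set 0]]. *)
Definition convex_body K : Prop :=
  [/\ K !=set0, compact K & convex_set (K : set (convex_lmodType 'rV[R]_n))].

Definition support K x : R := sup [set dot x k | k in K].

(* A convex body is determined by its support function, so the chosen element is
   unique when it exists; [[set 0]] is a junk value otherwise. *)
Definition body_of_support h : set 'rV[R]_n :=
  xget [set 0] [set M | convex_body M /\ support M = h].

Definition lpsum (p : R) K L : set 'rV[R]_n :=
  body_of_support (fun x => (support K x `^ p + support L x `^ p) `^ p^-1).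

Definition segment x y : set 'rV[R]_n :=
  [set (1 - t) *: x + t *: y | t in `[0, 1]%classic].

Definition scale (c : R) K : set 'rV[R]_n := [set c *: x | x in K].

Definition reflect0 K : set 'rV[R]_n := [set - x | x in K].

(* Iterated sums start from [[set 0]], which is neutral for [lpsum p], [0 < p],
   on convex bodies containing 0. *)
Definition asym_Lp_zonotope (p : R) K : Prop :=
  exists2 s : seq ('rV[R]_n * 'rV[R]_n),
    forall ab, ab \in s -> segment ab.1 ab.2 0
    & K = \big[lpsum p / [set 0]]_(ab <- s) segment ab.1 ab.2.

Definition thicken (e : R) K : set 'rV[R]_n :=
  [set x | exists2 y, K y & enorm (x - y) <= e].

Definition hausdorff_dist K L : \bar R :=
  ereal_inf [set e%:E | e in
    [set e : R | [/\ 0 <= e, K `<=` thicken e L & L `<=` thicken e K]]].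

Definition asym_Lp_zonoid (p : R) (Z : set 'rV[R]_n) : Prop :=
  convex_body Z /\
  exists2 Y : nat -> set 'rV[R]_n,
    forall k, asym_Lp_zonotope p (Y k)
    & (hausdorff_dist (Y k) Z @[k --> \oo] --> 0%E).

(* The body Z_eps = [0, u_1] + ... + [0, u_n] + eps^(1/p) zeta (L_p-sums). *)
Definition lp_perturbation (p : R) (u : 'I_n -> 'rV[R]_n)
    (zeta : set 'rV[R]_n) (eps : R) : set 'rV[R]_n :=
  lpsum p (\big[lpsum p / [set 0]]_(i < n) segment 0 (u i))
          (scale (eps `^ p^-1) zeta).

End ConvexBodies.

(* Main.v *)
Require Import Defs.
From HB Require Import structures.
From mathcomp Require Import all_boot all_order all_algebra.
From mathcomp Require Import all_classical all_reals all_analysis.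
From mathcomp Require Import measurable_realfun ring lra.

Set Implicit Arguments.
Unset Strict Implicit.
Unset Printing Implicit Defensive.

Import Order.TTheory GRing.Theory Num.Theory.
Import numFieldNormedType.Exports.
Import Defs.

Local Open Scope classical_set_scope.
Local Open Scope ring_scope.

(** A linear change of coordinates multiplies all volumes by one constant, so
    the vectors u_i may be taken to be the canonical basis e_i.  Let q be the
    exponent conjugate to p and let B be the part of the unit ball of the
    l_q norm |.|_q in the positive orthant, that is
    B = [0,e_1] +_p ... +_p [0,e_n].  Let h be the support function of zeta,
    g = h^p and G(x) = g(x) + g(-x).  The support functions of Z_eps and of its
    symmetrization W_eps are the p-th roots of
      sum_i (x_i)_+^p + eps g(x)   and   sum_i |x_i|^p + eps G(x).
    At eps = 0 these bodies are B and the l_q ball, whose volume is 2^n |B|, so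
    that the theorem is a comparison of first variations.  The orthants cut
    W_eps into 2^n pieces; each is reflected into the positive orthant and
    compared there with Z_eps.  There are three cases.

    If zeta leaves the positive orthant, that is h(-e_i) > 0 for some i, then
    Z_eps contains, besides B, a box outside the orthant of volume of order
    eps^(1/p), whereas each piece of W_eps is contained in (1 + O(eps)) B.
    Since eps = o(eps^(1/p)), the inequality is strict for small eps
    (strict_outside_orthant).

    Otherwise g is a limit of sums of powers <x,v>_+^p with nonnegative vectors
    v (zonoidal_nonneg).  If x is nonnegative and s changes some signs, then
    |<sx,v>| <= <x,v>, hence G(sx) <= g(x) (zonoid_flip_le): in the
    nonnegative directions a piece of W_eps satisfies all the constraints of
    Z_eps.  The other directions matter only for points at distance O(eps) from
    a coordinate hyperplane, and the points outside B that remain lie in a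
    shell of width O(eps), so that a piece exceeds Z_eps by a set of volume
    O(eps^2) only (sym_cell_loss, lebesgue_loss).  The analysis of the case
    of equality in G(sx) <= g(x), for the change s of a single sign, leaves two
    possibilities (zonoid_dichotomy).

    Either G(sx) < g(x) for some such s and some nonnegative x.  Then, near the
    boundary point of B with normal x, the body Z_eps contains a conical shell
    of width of order eps that the piece of W_eps given by s does not reach.
    This gain of order eps outweighs the losses, and the inequality is strict
    for small eps (strict_inside_orthant).

    Or g(x) = sum_i (a_i x_i)_+^p for some a_i >= 0, which means that zeta is
    the L_p-sum of the segments [0,a_i e_i].  Then W_eps is symmetric with
    respect to the coordinate hyperplanes and Z_eps is its part in the positive
    orthant, so that equality holds for every eps (unconditional_volume).

    Two general facts carry these comparisons.  The iterated Lebesgue integral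
    of the statement is a measure, and a linear bijection multiplies it by a
    constant (lebesgue_linear), by the uniqueness of invariant measures.  A
    convex body is the intersection of its supporting half-spaces
    (convex_bodyE), by separation. *)

(** * Row vectors and iterated Lebesgue measure *)

Section RowVectors.
Context {R : realType}.

Definition row_cons n (t : R) (v : 'rV[R]_n) : 'rV[R]_n.+1 :=
  row_mx (t%:M : 'rV[R]_1) v.

Definition row_tail n (x : 'rV[R]_n.+1) : 'rV[R]_n := \row_j x 0 (lift ord0 j).

Lemma row_cons0 n t (v : 'rV[R]_n) : row_cons t v 0 ord0 = t.
Proof.
have et : (t%:M : 'rV[R]_1) 0 ord0 = t by rewrite mxE eqxx mulr1n.
rewrite -[RHS]et -(row_mxEl (t%:M : 'rV_1) v 0 ord0).
by congr (row_mx _ _ _ _); exact: val_inj.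
Qed.

Lemma row_consS n t (v : 'rV[R]_n) j : row_cons t v 0 (lift ord0 j) = v 0 j.
Proof.
rewrite -(row_mxEr (t%:M : 'rV_1) v 0 j).
by congr (row_mx _ _ _ _); exact: val_inj.
Qed.

Lemma row_tail_cons n t (v : 'rV[R]_n) : row_tail (row_cons t v) = v.
Proof. by apply/rowP => i; rewrite mxE row_consS. Qed.

End RowVectors.

Section MeasurableRowVectors.
Context {R : realType}.

Definition cylinders n : set (set 'rV[R]_n) :=
  [set A : set ('rV[R]_n) | exists i, exists2 B : set (measurableTypeR R),
     measurable B & A = [set x : 'rV[R]_n | B (x 0 i)]].

(** The sigma-algebra generated by the coordinates, rather than by the open
    sets: with it, concatenation of R and R^n is measurable in both
    directions without any topology. *)
Definition borel_rV n := g_sigma_algebraType (@cylinders n).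

Lemma measurable_coord n (i : 'I_n) :
  measurable_fun setT (fun x : borel_rV n => x 0 i : measurableTypeR R).
Proof.
by move=> _ B mB; rewrite setTI; apply: sub_sigma_algebra; exists i, B.
Qed.

Lemma measurable_rV_fun d (T : measurableType d) n (f : T -> borel_rV n) :
  (forall i, measurable_fun setT (fun t => f t 0 i : measurableTypeR R)) ->
  measurable_fun setT f.
Proof.
move=> mf; refine (@measurability _ _ T (borel_rV n) setT f (@cylinders n) erefl _).
move=> _ [_ [i [B mB ->]] <-].
have := mf i measurableT B mB.
by rewrite !setTI.
Qed.

Lemma measurable_coord_comp d (T : measurableType d) n (f : T -> borel_rV n) i :
  measurable_fun setT f ->
  measurable_fun setT (fun t => f t 0 i : measurableTypeR R).
Proof. by move=> mf; exact: (measurableT_comp (@measurable_coord n i) mf). Qed.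

Lemma measurable_row_cons n :
  measurable_fun setT
    (fun z : measurableTypeR R * borel_rV n => row_cons z.1 z.2 : borel_rV n.+1).
Proof.
apply: measurable_rV_fun => i; case: (unliftP ord0 i) => [j ->|->].
  under eq_fun do rewrite row_consS.
  exact: (@measurable_coord_comp _ _ n snd).
under eq_fun do rewrite row_cons0.
exact: measurable_fst.
Qed.

Lemma measurable_dot n (x : 'rV[R]_n) :
  measurable_fun setT (fun y : borel_rV n => dot x y : measurableTypeR R).
Proof.
apply: (@measurable_sum _ _ _ _ _ _ (fun i (y : borel_rV n) => x 0 i * y 0 i)) => i.
exact: (measurable_funM (measurable_cst (x 0 i)) (measurable_coord i)).
Qed.

Lemma measurable_mulmxr m n (M : 'M[R]_(m, n)) :
  measurable_fun setT (fun y : borel_rV m => y *m M : borel_rV n).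
Proof.
apply: measurable_rV_fun => i; under eq_fun do rewrite mxE.
apply: (@measurable_sum _ _ _ _ _ _ (fun j (y : borel_rV m) => y 0 j * M j i)) => j.
exact: (measurable_funM (measurable_coord j) (measurable_cst (M j i))).
Qed.

Lemma measurable_addv n :
  measurable_fun setT
    (fun z : borel_rV n * borel_rV n => (z.1 : 'rV_n) + z.2 : borel_rV n).
Proof.
apply: measurable_rV_fun => i; under eq_fun do rewrite mxE.
apply: measurable_funD.
  exact: (@measurable_coord_comp _ _ n fst).
exact: (@measurable_coord_comp _ _ n snd).
Qed.

End MeasurableRowVectors.

(** The measurable inverse g transports an exhausting sequence of sets of
    finite measure. *)
Lemma sigma_finite_image d1 d2 (T1 : measurableType d1) (T2 : measurableType d2)
    (R : realType) (mu : {measure set T1 -> \bar R})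
    (f : T1 -> T2) (g : T2 -> T1) :
  sigma_finite setT mu ->
  measurable_fun setT f -> measurable_fun setT g -> cancel f g ->
  exists nu : {sigma_finite_measure set T2 -> \bar R},
    forall A, nu A = mu (f @^-1` A).
Proof.
move=> [F FT Ffin] mf mg fK; pose m : set T2 -> \bar R := pushforward mu f.
have m0 : m set0 = 0%E by exact: measure0.
have m_ge0 A : (0 <= m A)%E by exact: measure_ge0.
have m_add : semi_sigma_additive m.
  move=> E mE tE mUE; rewrite /m /pushforward preimage_bigcup.
  apply: measure_semi_sigma_additive.
  - by move=> n; rewrite -[X in measurable X]setTI; exact: mf.
  - apply/trivIsetP => /= i j _ _ ij; rewrite -preimage_setI.
    by move/trivIsetP : tE => /(_ _ _ _ _ ij) ->//; rewrite preimage_set0.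
  - by rewrite -preimage_bigcup -[X in measurable X]setTI; exact: mf.
have m_fin : sigma_finite setT m.
  exists (fun k => g @^-1` F k).
    by rewrite -preimage_bigcup -FT preimage_setT.
  move=> k; have [mF Fk] := Ffin k; split.
    by rewrite -[X in measurable X]setTI; exact: mg.
  rewrite /m /pushforward -comp_preimage.
  rewrite (_ : g \o f = id); last by apply/funext => x /=; rewrite fK.
  by rewrite preimage_id.
pose mM := isMeasure.Build _ T2 R m m0 m_ge0 m_add.
pose mT : {measure set T2 -> \bar R} := HB.pack m mM.
pose mS := Measure_isSigmaFinite.Build _ T2 R mT m_fin.
pose mF : {sigma_finite_measure set T2 -> \bar R} := HB.pack m mM mS.
by exists mF.
Qed.

Lemma sigma_finite_prod d1 d2 (T1 : measurableType d1) (T2 : measurableType d2)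
    (R : realType) (m1 : {sigma_finite_measure set T1 -> \bar R})
    (m2 : {sigma_finite_measure set T2 -> \bar R}) :
  sigma_finite setT (m1 \x m2)%E.
Proof.
have [F FT Ffin] := sigma_finiteT m1; have [G GT Gfin] := sigma_finiteT m2.
exists (fun k => if @unpickle (nat * nat)%type k is Some ij
                 then F ij.1 `*` G ij.2 else set0).
  apply/esym; rewrite -subTset => -[x y] _.
  have [i _ Fx] : (\bigcup_i F i) x by rewrite -FT.
  have [j _ Gy] : (\bigcup_j G j) y by rewrite -GT.
  by exists (pickle (i, j)) => //; rewrite pickleK.
move=> k; case: unpickle => [[i j] /=|]; last by rewrite measure0.
have [mF Fi] := Ffin i; have [mG Gj] := Gfin j.
split; first exact: measurableX.
by rewrite product_measure1E// lte_mul_pinfty// ge0_fin_numE.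
Qed.

Section LebesgueMeasure.
Context {R : realType}.

Lemma lebesgue_rV_step n (A : set 'rV[R]_n.+1) :
  lebesgue_rV A =
  (\int[@lebesgue_measure R]_t lebesgue_rV [set v | A (row_cons t v)])%E.
Proof. by []. Qed.

(** In dimension n.+1 the iterated integral is the image under
    concatenation of the product of Lebesgue measure and the measure in
    dimension n; countable additivity and sigma-finiteness come from the
    product. *)
Lemma lebesgue_rV_measure n :
  exists mu : {sigma_finite_measure set (@borel_rV R n) -> \bar R},
    forall A, mu A = lebesgue_rV (A : set 'rV[R]_n).
Proof.
elim: n => [|n [mu muE]].
  by exists (dirac (0 : borel_rV 0)).
have [] := @sigma_finite_image _ _ (measurableTypeR R * borel_rV n)%type
  (borel_rV n.+1) R (@lebesgue_measure R \x mu)%E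
  (fun z : measurableTypeR R * borel_rV n => row_cons z.1 z.2 : borel_rV n.+1)
  (fun x : borel_rV n.+1 => (x 0 ord0 : measurableTypeR R, row_tail x : borel_rV n)).
- exact: sigma_finite_prod.
- exact: measurable_row_cons.
- apply: measurable_fun_pair; first exact: measurable_coord.
  apply: measurable_rV_fun => i.
  under eq_fun do rewrite mxE.
  exact: measurable_coord.
- by move=> [t v] /=; rewrite row_cons0 row_tail_cons.
move=> nu nuE; exists nu => A; rewrite nuE lebesgue_rV_step.
apply: eq_integral => t _ /=; rewrite muE; congr lebesgue_rV.
by apply/seteqP; split=> v /=; rewrite xsectionE.
Qed.

Definition lebesgue_mu n : {sigma_finite_measure set (@borel_rV R n) -> \bar R} :=
  sval (cid (lebesgue_rV_measure n)).

Lemma lebesgue_muE n A : lebesgue_mu n A = lebesgue_rV (A : set 'rV[R]_n).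
Proof. exact: (svalP (cid (lebesgue_rV_measure n))). Qed.

(** The translated measure agrees with Lebesgue measure on the half-open
    intervals, and these determine it. *)
Lemma lebesgue_measure_translate (A : set R) (c : R) : measurable A ->
  lebesgue_measure ((fun x => x + c) @^-1` A) = lebesgue_measure A.
Proof.
move=> mA.
have mc : measurable_fun setT (fun x : measurableTypeR R => x + c : measurableTypeR R).
  exact: (measurable_funD (@measurable_id _ (measurableTypeR R) setT) (measurable_cst c)).
have mc' : measurable_fun setT (fun x : measurableTypeR R => x - c : measurableTypeR R).
  exact: (measurable_funD (@measurable_id _ (measurableTypeR R) setT) (measurable_cst (- c))).
have [x /=|nu nuE] := @sigma_finite_image _ _ _ _ R lebesgue_measure _ _ (sigma_finiteT _) mc mc'.
  by rewrite addrK.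
rewrite -(nuE A); apply/esym/lebesgue_measure_unique => // _ [[a b]] _ <-.
transitivity (@lebesgue_measure R ((fun x => x + c) @^-1` `]a, b])); last exact/esym/nuE.
rewrite (_ : _ @^-1` _ = `]a - c, b - c]%classic); last first.
  by apply/seteqP; split=> x /=; rewrite !in_itv/= ltrBlDr lerBrDr.
rewrite !lebesgue_measure_itv /= !lte_fin ltrD2r -!EFinD.
by case: ifP => // _; congr EFin; ring.
Qed.

Definition borel n (A : set 'rV[R]_n) := measurable (A : set (@borel_rV R n)).

Lemma borel_preimage d (T : measurableType d) n (f : T -> @borel_rV R n) A :
  measurable_fun setT f -> borel A -> measurable (f @^-1` A).
Proof. by move=> mf mA; rewrite -[X in measurable X]setTI; exact: mf. Qed.

Lemma measurable_section n (A : set 'rV[R]_n.+1) : borel A ->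
  measurable [set z : measurableTypeR R * borel_rV n | A (row_cons z.1 z.2)].
Proof.
move=> mA; exact: (borel_preimage (measurable_row_cons (n:=n))).
Qed.

Lemma borel_section n (A : set 'rV[R]_n.+1) t : borel A ->
  borel [set v | A (row_cons t v)].
Proof.
move=> /measurable_section/(measurable_xsection t).
by congr measurable; apply/seteqP; split=> v /=; rewrite xsectionE.
Qed.

Lemma measurable_lebesgue_section n (A : set 'rV[R]_n.+1) : borel A ->
  measurable_fun setT
    (fun t : measurableTypeR R => lebesgue_rV [set v | A (row_cons t v)]).
Proof.
move=> /measurable_section/(measurable_fun_xsection (lebesgue_mu n)).
apply: eq_measurable_fun => t _ /=; rewrite lebesgue_muE; congr lebesgue_rV.
by apply/seteqP; split=> v /=; rewrite xsectionE.
Qed.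

Lemma lebesgue_rV_ge0 n (A : set 'rV[R]_n) : (0 <= lebesgue_rV A)%E.
Proof. by rewrite -lebesgue_muE; exact: measure_ge0. Qed.

Lemma row_consD n t (v : 'rV[R]_n) (x : 'rV[R]_n.+1) :
  row_cons t v + x = row_cons (t + x 0 ord0) (v + row_tail x).
Proof.
apply/rowP => i; rewrite mxE; case: (unliftP ord0 i) => [j ->|->].
  by rewrite !row_consS !mxE.
by rewrite !row_cons0.
Qed.

Lemma measurable_translate n (v : 'rV[R]_n) :
  measurable_fun setT (fun x : @borel_rV R n => (x : 'rV_n) + v : borel_rV n).
Proof.
apply: measurable_rV_fun => i; under eq_fun do rewrite mxE.
exact: (measurable_funD (measurable_coord i) (measurable_cst (v 0 i))).
Qed.

Lemma lebesgue_rV_translate n (A : set 'rV[R]_n) v : borel A ->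
  lebesgue_rV [set x | A (x + v)] = lebesgue_rV A.
Proof.
elim: n => [|n IHn] in A v *.
  by move=> _; congr lebesgue_rV; apply/seteqP; split=> x /=; rewrite (thinmx0 v) addr0.
move=> mA; rewrite !lebesgue_rV_step.
pose phi t := lebesgue_rV [set w | A (row_cons t w)].
transitivity (\int[@lebesgue_measure R]_t phi (t + v 0 ord0)%R)%E.
  apply: eq_integral => t _; rewrite /phi.
  rewrite -(IHn [set w | A (row_cons (t + v 0 ord0) w)] (row_tail v)); last first.
    exact: borel_section.
  by congr lebesgue_rV; apply/seteqP; split=> w /=; rewrite row_consD.
have mc : measurable_fun setT (fun x : measurableTypeR R => x + v 0 ord0 : measurableTypeR R).
  exact: (measurable_funD (@measurable_id _ (measurableTypeR R) setT) (measurable_cst _)).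
have mphi := measurable_lebesgue_section mA.
have phi0 t : (0 <= phi t)%E by exact: lebesgue_rV_ge0.
have := @ge0_integral_pushforward _ _ _ _ R _ mc lebesgue_measure setT phi measurableT mphi
  (fun t _ => phi0 t).
rewrite preimage_setT => <-.
by apply: eq_measure_integral => B mB _; exact: lebesgue_measure_translate.
Qed.

Lemma borel_coord_itv n (i : 'I_n) (J : interval R) :
  borel [set x : 'rV[R]_n | x 0 i \in J].
Proof.
rewrite /borel -[X in measurable X]setTI.
exact: (measurable_coord i measurableT (measurable_itv J)).
Qed.

Definition box n (a b : 'I_n -> R) : set 'rV[R]_n :=
  [set x | forall i, a i <= x 0 i <= b i].

Lemma borel_forall n (I : finType) (A : I -> set 'rV[R]_n) :
  (forall i, borel (A i)) -> borel [set x | forall i, A i x].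
Proof.
move=> mA; rewrite /borel (_ : [set x | _] = \bigcap_(i in [set: I]) A i).
  by apply: fin_bigcap_measurable => // i _; exact: mA.
by apply/seteqP; split=> x /= Ax; [move=> i _|move=> i]; exact: Ax.
Qed.

Lemma borel_exists n (I : finType) (A : I -> set 'rV[R]_n) :
  (forall i, borel (A i)) -> borel [set x | exists i, A i x].
Proof.
move=> mA; rewrite /borel (_ : [set x | _] = \bigcup_(i in [set: I]) A i).
  by apply: fin_bigcup_measurable => // i _; exact: mA.
by apply/seteqP; split=> x /= [i]; [|move=> _]; exists i.
Qed.

Lemma borel_box n (a b : 'I_n -> R) : borel (box a b).
Proof.
apply: borel_forall => i; exact: (borel_coord_itv i `[a i, b i]).
Qed.

Lemma lebesgue_rV_box n (a b : 'I_n -> R) : (forall i, a i <= b i) ->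
  lebesgue_rV (box a b) = (\prod_i (b i - a i))%:E.
Proof.
elim: n => [|n IHn] in a b *.
  move=> _; rewrite big_ord0 /=; congr EFin; rewrite indicE mem_set//.
  by case.
move=> ab; rewrite lebesgue_rV_step big_ord_recl.
set P := \prod_(i < n) _.
transitivity (\int[@lebesgue_measure R]_t (P%:E * (\1_(`[a ord0, b ord0]%classic : set R) t)%:E))%E.
  apply: eq_integral => t _; rewrite indicE.
  case: (boolP (t \in _)) => tab; last first.
    rewrite mule0 -lebesgue_muE (_ : [set _ | _] = set0) ?measure0//.
    apply/seteqP; split=> // v /= /(_ ord0); rewrite row_cons0 => tab'.
    by case/negP: tab; rewrite inE /= in_itv.
  rewrite mule1 -IHn; last by move=> i; exact: ab.
  congr lebesgue_rV; apply/seteqP; split=> v /= vab i.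
    by have := vab (lift ord0 i); rewrite row_consS.
  case: (unliftP ord0 i) => [j ->|->]; first by rewrite row_consS; exact: vab.
  by move: tab; rewrite row_cons0 inE /= in_itv.
have P0 : 0 <= P by apply: prodr_ge0 => i _; rewrite subr_ge0 ab.
rewrite ge0_integralZl//; last first.
  apply/measurable_EFinP.
  exact: (measurable_indic (measurable_itv `[a ord0, b ord0])).
rewrite integral_indic// ?setIT//.
transitivity (P%:E * @lebesgue_measure R `[a ord0, b ord0])%E; first by [].
rewrite lebesgue_measure_itv /= lte_fin.
case: ltP => [_|ba]; first by rewrite -EFinD -EFinM mulrC.
by rewrite (_ : b ord0 = a ord0) ?subrr ?mul0r ?mule0//; apply/le_anti; rewrite ba ab.
Qed.

End LebesgueMeasure.

(** * Uniqueness of translation-invariant measures *)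

Lemma tonelli_sections d1 d2 (T1 : measurableType d1) (T2 : measurableType d2)
    (R : realType) (m1 : {sigma_finite_measure set T1 -> \bar R})
    (m2 : {sigma_finite_measure set T2 -> \bar R}) (E : set (T1 * T2)) :
  measurable E ->
  (\int[m1]_x m2 (xsection E x) = \int[m2]_y m1 (ysection E y))%E.
Proof.
move=> mE; have := indic_fubini_tonelli m1 m2 mE.
by rewrite indic_fubini_tonelli_FE// indic_fubini_tonelli_GE.
Qed.

Section InvariantMeasures.
Context {R : realType} {n : nat}.
Variables mu nu : {sigma_finite_measure set (@borel_rV R n) -> \bar R}.

Let invariant (m : set (@borel_rV R n) -> \bar R) :=
  forall (A : set 'rV[R]_n) v, borel A -> m [set x | A (x + v)] = m A.

Hypothesis mu_inv : invariant mu.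
Hypothesis nu_inv : invariant nu.

Lemma borel_preimageN (A : set 'rV[R]_n) : borel A -> borel [set x | A (- x)].
Proof.
move=> mA; apply: (@borel_preimage R _ (@borel_rV R n) n (fun x => - (x : 'rV_n))) => //.
apply: measurable_rV_fun => i; under eq_fun do rewrite mxE.
exact: (measurableT_comp (@oppr_measurable R setT) (measurable_coord i)).
Qed.

Lemma borel_setI (A B : set 'rV[R]_n) : borel A -> borel B -> borel (A `&` B).
Proof. exact: measurableI. Qed.

Lemma borel_translate (A : set 'rV[R]_n) v : borel A -> borel [set x | A (x + v)].
Proof. by exact: (borel_preimage (measurable_translate v)). Qed.

(** The argument for the uniqueness of Haar measure: mu(A) nu(B) is the
    product measure of the pairs (x, y) with x in A and x + y in B,
    computed on the sections at fixed x. Computed on the sections at fixed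
    y, after translating each of them by y, it is the measure of the pairs
    with x in B and x - y in A, that is mu(B) nu(-A). *)
Lemma invariant_measures_exchange (A B : set 'rV[R]_n) :
  borel A -> borel B ->
  (mu A * nu B = mu B * nu [set x | A (- x)%R])%E.
Proof.
move=> mA mB.
have integral_cst_on (m : {measure set (@borel_rV R n) -> \bar R}) D c : borel D -> (0 <= c)%E ->
    (\int[m]_x (c * (\1_D x)%:E) = m D * c)%E.
  move=> mD c0; rewrite ge0_integralZl//; last exact/measurable_EFinP/measurable_indic.
  by rewrite integral_indic// setIT muleC.
pose V := @borel_rV R n.
pose E : set (V * V) := fst @^-1` A `&` (fun z : V * V => (z.1 : 'rV_n) + z.2) @^-1` B.
have mE : measurable E.
  apply: measurableI; first exact: (@borel_preimage R _ (V * V)%type n fst).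
  exact: (borel_preimage (measurable_addv (n:=n))).
pose F : set (V * V) := fst @^-1` B `&` (fun z : V * V => (z.1 : 'rV_n) - (z.2 : 'rV_n)) @^-1` A.
have mF : measurable F.
  apply: measurableI; first exact: (@borel_preimage R _ (V * V)%type n fst).
  apply: (@borel_preimage R _ (V * V)%type n) => //.
  apply: measurable_rV_fun => i; under eq_fun do rewrite !mxE.
  apply: measurable_funB; first exact: (@measurable_coord_comp _ _ _ n fst).
  exact: (@measurable_coord_comp _ _ _ n snd).
transitivity (\int[mu]_x nu (xsection E x))%E.
  rewrite -integral_cst_on//; apply: eq_integral => x _.
  rewrite indicE; case: (boolP (x \in A)) => xA; last first.
    rewrite mule0 (_ : xsection E x = set0) ?measure0//.
    apply/seteqP; split => // y; rewrite xsectionE /= => -[Ax _].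
    by move: xA; rewrite mem_set.
  rewrite mule1 -(nu_inv x mB); congr (nu _).
  apply/seteqP; split=> y; rewrite xsectionE /= addrC //.
    by move=> Bxy; split => //; exact: set_mem.
  by case.
rewrite tonelli_sections//.
transitivity (\int[nu]_y mu (ysection F y))%E.
  apply: eq_integral => y _.
  rewrite -(mu_inv y (A := ysection F y)); last exact: measurable_ysection.
  congr (mu _); apply/seteqP; split=> x /=; rewrite !ysectionE => -[/= h1 h2].
    by split=> //=; rewrite addrK.
  by split=> //=; rewrite -(addrK y x).
rewrite -tonelli_sections//.
rewrite -integral_cst_on//; apply: eq_integral => x _.
rewrite indicE; case: (boolP (x \in B)) => xB; last first.
  rewrite mule0 (_ : xsection F x = set0) ?measure0//.
  apply/seteqP; split => // y; rewrite xsectionE /= => -[Bx _].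
  by move: xB; rewrite mem_set.
rewrite mule1 -(nu_inv (- x) (borel_preimageN mA)); congr (nu _).
apply/seteqP; split=> y; rewrite xsectionE /= opprB.
  by case.
by move=> Axy; split => //; exact: set_mem.
Qed.

End InvariantMeasures.

(** * Volume and linear bijections *)

Section LinearImages.
Context {R : realType}.
Implicit Types n : nat.

Definition cube n (r : R) : set 'rV[R]_n := box (fun=> - r) (fun=> r).

Lemma lebesgue_cube n r : 0 <= r -> lebesgue_rV (@cube n r) = ((r *+ 2) ^+ n)%:E.
Proof.
move=> r0; rewrite lebesgue_rV_box; last by move=> _; lra.
by rewrite prodr_const card_ord opprK mulr2n.
Qed.

(** The image of Lebesgue measure is translation invariant, hence
    proportional to it. Comparing the two on the cube, which is symmetric,
    and on the image of the cube shows that the constant is finite and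
    positive. *)
Lemma lebesgue_linear n (M : 'M[R]_n) : M \in unitmx ->
  exists2 c : R, 0 < c & forall B, borel B ->
    lebesgue_rV [set x | B (x *m M)] = (c%:E * lebesgue_rV B)%E.
Proof.
move=> uM.
have [|nu nuE] := @sigma_finite_image _ _ (borel_rV n) (borel_rV n) R
  (lebesgue_mu n) (fun x => x *m M) (fun x => x *m invmx M) (sigma_finiteT _)
  (measurable_mulmxr M) (measurable_mulmxr _).
  by move=> x; rewrite mulmxK.
have nuL A : nu A = lebesgue_rV [set x : 'rV_n | A (x *m M)].
  by rewrite nuE; exact: lebesgue_muE.
have muI (A : set 'rV[R]_n) v : borel A -> lebesgue_mu n [set x | A (x + v)] = lebesgue_mu n A.
  by move=> mA; rewrite !lebesgue_muE lebesgue_rV_translate.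
have nuI (A : set 'rV[R]_n) v : borel A -> nu [set x | A (x + v)] = nu A.
  move=> mA; rewrite !nuL.
  rewrite -[RHS](lebesgue_rV_translate (v *m invmx M)); last first.
    exact: (borel_preimage (measurable_mulmxr M)).
  congr lebesgue_rV; apply/seteqP; split=> x /=; by rewrite mulmxDl mulmxKV.
pose C := @cube n 1.
have mC : borel C by exact: borel_box.
have C1 : lebesgue_rV C = (2 ^+ n)%:E by rewrite lebesgue_cube.
have CN : [set x | C (- x)] = C.
  by apply/seteqP; split=> x /= Cx i; have := Cx i; rewrite !mxE; lra.
have key B : borel B -> ((2 ^+ n)%:E * nu B = lebesgue_rV B * nu C)%E.
  move=> mB; rewrite -C1 -!lebesgue_muE.
  by rewrite (invariant_measures_exchange muI nuI mC mB) CN.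
have p2 : 0 < 2 ^+ n :> R by rewrite exprn_gt0.
pose D := [set y : 'rV[R]_n | C (y *m invmx M)].
have mD : borel D by exact: (borel_preimage (measurable_mulmxr (invmx M))).
have nuD : nu D = (2 ^+ n)%:E.
  by rewrite nuL -C1; congr lebesgue_rV; apply/seteqP; split=> x /=; rewrite /D/= mulmxK.
have keyD := key D mD; rewrite nuD in keyD.
have nuC0 : (0 <= nu C)%E by exact: measure_ge0.
have D0 := lebesgue_rV_ge0 D.
have [c cE] : exists c : R, nu C = c%:E.
  move: nuC0 keyD; case: (nu C) => [c _ _||]//; first by exists c.
  move=> _; move: D0; rewrite le_eqVlt => /predU1P[<-|D0].
    by rewrite mul0e -EFinM => -[] /eqP; rewrite gt_eqF// mulr_gt0.
  by rewrite gt0_muley // -EFinM.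
exists (c / 2 ^+ n); last first.
  move=> B mB; rewrite -(nuL B).
  have := key B mB; rewrite cE => /(congr1 (fun z => (2 ^+ n)^-1%:E * z)%E).
  rewrite muleA -EFinM mulVf ?gt_eqF// mul1e => ->.
  by rewrite (muleC (lebesgue_rV B)) muleA -EFinM mulrC.
rewrite divr_gt0// lt_neqAle; move: nuC0; rewrite cE lee_fin => ->.
rewrite andbT; apply/eqP => c0; move: keyD; rewrite cE -c0 mule0 -EFinM => -[] /eqP.
by rewrite gt_eqF// mulr_gt0.
Qed.

(** Testing on one set of positive finite volume identifies the constant,
    so that no determinant has to be brought in. *)
Lemma lebesgue_linear_test n (M : 'M[R]_n) (A : set 'rV[R]_n) (a c : R) :
  M \in unitmx -> borel A -> 0 < a -> lebesgue_rV A = a%:E ->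
  lebesgue_rV [set x | A (x *m M)] = (c * a)%:E ->
  forall B, borel B ->
    lebesgue_rV [set x | B (x *m M)] = (c%:E * lebesgue_rV B)%E.
Proof.
move=> uM mA a0 Aa Ac B mB; have [d d0 dE] := lebesgue_linear uM.
rewrite dE//; move: Ac; rewrite dE// Aa -EFinM => -[] /mulIf-> //.
by rewrite gt_eqF.
Qed.

Lemma lebesgue_dilate n r (B : set 'rV[R]_n) : 0 < r -> borel B ->
  lebesgue_rV [set x | B (r *: x)] = ((r ^- n)%:E * lebesgue_rV B)%E.
Proof.
move=> r0 mB.
have rE (A : set 'rV[R]_n) : [set x | A (r *: x)] = [set x | A (x *m r%:M)].
  by apply/seteqP; split=> x /=; rewrite mul_mx_scalar.
rewrite rE; apply: (@lebesgue_linear_test n _ (@cube n 1) (2 ^+ n)) => //.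
- by rewrite unitmxE det_scalar unitfE expf_neq0 ?gt_eqF.
- exact: borel_box.
- by rewrite lebesgue_cube.
rewrite -rE (_ : [set x | _] = @cube n r^-1).
  by rewrite lebesgue_cube ?invr_ge0 ?ltW// -[r^-1 *+ 2]mulr_natr exprMn exprVn.
have rV : r^-1 = 1 / r by rewrite div1r.
apply/seteqP; split=> x /= Cx i; have := Cx i; rewrite !mxE => /andP[h1 h2].
  by rewrite rV -mulNr ler_pdivlMr// ler_pdivrMr// ![x 0 i * r]mulrC h1 h2.
by move: h1 h2; rewrite rV -mulNr ler_pdivlMr// ler_pdivrMr// ![x 0 i * r]mulrC => -> ->.
Qed.

Definition flip n (s : 'I_n -> bool) (x : 'rV[R]_n) : 'rV[R]_n :=
  \row_i ((-1) ^+ s i * x 0 i).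

Lemma flipE n (s : 'I_n -> bool) (x : 'rV[R]_n) i : flip s x 0 i = (-1) ^+ s i * x 0 i.
Proof. by rewrite mxE. Qed.

Lemma flipK n (s : 'I_n -> bool) : involutive (@flip n s).
Proof. by move=> x; apply/rowP => i; rewrite !mxE mulrA -signr_addb addbb mul1r. Qed.

Lemma flip_mulmx n (s : 'I_n -> bool) (x : 'rV[R]_n) :
  flip s x = x *m diag_mx (\row_i ((-1) ^+ s i)).
Proof. by apply/rowP => i; rewrite mul_mx_diag !mxE mulrC. Qed.

Lemma measurable_flip n (s : 'I_n -> bool) :
  measurable_fun setT (@flip n s : @borel_rV R n -> @borel_rV R n).
Proof.
rewrite (_ : flip s = fun x => x *m diag_mx (\row_i ((-1) ^+ s i))).
  exact: measurable_mulmxr.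
by apply/funext => x; exact: flip_mulmx.
Qed.

Lemma lebesgue_flip n (s : 'I_n -> bool) (B : set 'rV[R]_n) : borel B ->
  lebesgue_rV [set x | B (flip s x)] = lebesgue_rV B.
Proof.
move=> mB; pose M := diag_mx (\row_i ((-1) ^+ s i)) : 'M[R]_n.
have fE (A : set 'rV[R]_n) : [set x | A (flip s x)] = [set x | A (x *m M)].
  by apply/seteqP; split=> x /=; rewrite flip_mulmx.
rewrite fE -[RHS]mul1e; apply: (@lebesgue_linear_test n _ (@cube n 1) (2 ^+ n)) => //.
- rewrite unitmxE det_diag unitfE; apply/prodf_neq0 => i _.
  by rewrite mxE signr_eq0.
- exact: borel_box.
- by rewrite lebesgue_cube.
rewrite -fE mul1r (_ : [set x | _] = @cube n 1) ?lebesgue_cube//.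
apply/seteqP; split=> x /= Cx i; have := Cx i; rewrite flipE;
  by case: (s i); rewrite ?expr1 ?expr0; lra.
Qed.

End LinearImages.

(** * Volume and orthants *)

Section Orthants.
Context {R : realType}.
Implicit Types n : nat.

Lemma le_lebesgue_rV n (A B : set 'rV[R]_n) : borel A -> borel B -> A `<=` B ->
  (lebesgue_rV A <= lebesgue_rV B)%E.
Proof.
by move=> mA mB AB; rewrite -!lebesgue_muE; apply: le_measure => //; rewrite inE.
Qed.

Lemma lebesgue_rV_disjoint n (A B : set 'rV[R]_n) : borel A -> borel B ->
  A `&` B = set0 -> (lebesgue_rV (A `|` B) = lebesgue_rV A + lebesgue_rV B)%E.
Proof.
by move=> mA mB AB; rewrite -!lebesgue_muE; apply: measureU.
Qed.

Lemma borel_setU n (A B : set 'rV[R]_n) : borel A -> borel B -> borel (A `|` B).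
Proof. exact: measurableU. Qed.

Lemma borel_setD n (A B : set 'rV[R]_n) : borel A -> borel B -> borel (A `\` B).
Proof. exact: measurableD. Qed.

Lemma lebesgue_rV_setU n (A B : set 'rV[R]_n) : borel A -> borel B ->
  (lebesgue_rV (A `|` B) <= lebesgue_rV A + lebesgue_rV B)%E.
Proof.
move=> mA mB; rewrite -[X in lebesgue_rV X](setDUK (@subsetUl _ A B)).
have mD := borel_setD (borel_setU mA mB) mA.
rewrite lebesgue_rV_disjoint ?setDIK//.
by rewrite leeD2l// le_lebesgue_rV// => x [[]].
Qed.

Lemma lebesgue_rV_exists n m (A : 'I_m -> set 'rV[R]_n) (c : R) :
  (forall i, borel (A i)) -> (forall i, lebesgue_rV (A i) <= c%:E)%E ->
  (lebesgue_rV [set x | exists i, A i x] <= (c *+ m)%:E)%E.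
Proof.
elim: m => [|m IHm] in A *.
  move=> _ _; rewrite mulr0n (_ : [set x | _] = set0).
    by rewrite -lebesgue_muE measure0.
  by apply/seteqP; split=> // x [[]].
move=> mA Ac.
rewrite (_ : [set x | _] = A ord0 `|` [set x | exists i, A (lift ord0 i) x]).
  apply: (le_trans (lebesgue_rV_setU _ _)) => //; first exact: borel_exists.
  by rewrite mulrS EFinD leeD// IHm.
apply/seteqP; split=> x /=.
  by move=> [i]; case: (unliftP ord0 i) => [j ->|->] ?; [right; exists j|left].
by move=> [?|[j]]; [exists ord0|exists (lift ord0 j)].
Qed.

Definition nonneg n : set 'rV[R]_n := [set x | forall i, 0 <= x 0 i].

Lemma borel_nonneg n : borel (@nonneg n).
Proof.
rewrite (_ : @nonneg n = [set x | forall i, x 0 i \in `[0, +oo[]).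
  by apply: borel_forall => i; exact: borel_coord_itv.
by apply/seteqP; split=> x /= x0 i; have := x0 i; rewrite in_itv /= andbT.
Qed.

Definition sign_cell n (s : 'I_n -> bool) : set 'rV[R]_n :=
  [set x | forall i, (x 0 i < 0) = s i].

Lemma borel_sign_cell n (s : 'I_n -> bool) : borel (sign_cell s).
Proof.
pose J i : interval R := if s i then `]-oo, 0[ else `[0, +oo[.
rewrite (_ : sign_cell s = [set x | forall i, x 0 i \in J i]).
  by apply: borel_forall => i; exact: borel_coord_itv.
apply/seteqP; split=> x /= xs i; have := xs i; rewrite /J;
  case: (s i); rewrite in_itv /= ?andbT //.
  by move=> /negbT; rewrite -leNgt.
by move=> x0; apply/negbTE; rewrite -leNgt.
Qed.

Lemma lebesgue_rV_cells n (A : set 'rV[R]_n) : borel A ->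
  lebesgue_rV A =
  (\sum_(s : {ffun 'I_n -> bool}) lebesgue_rV (A `&` sign_cell s))%E.
Proof.
move=> mA.
have mAs (s : {ffun 'I_n -> bool}) : borel (A `&` sign_cell s).
  by apply: borel_setI => //; exact: borel_sign_cell.
have AU : A = \bigcup_(s in [set: {ffun 'I_n -> bool}]) (A `&` sign_cell s).
  apply/seteqP; split=> x; last by case=> s _ [].
  by move=> Ax; exists [ffun i => x 0 i < 0] => //; split=> // i; rewrite ffunE.
have tA : trivIset [set: {ffun 'I_n -> bool}]
    (fun s : {ffun 'I_n -> bool} => A `&` sign_cell s : set (@borel_rV R n)).
  move=> s t _ _ [x [[_ xs] [_ xt]]].
  by apply/ffunP => i; rewrite -xs xt.
have finS : finite_set [set: {ffun 'I_n -> bool}] by exact: finite_finset.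
rewrite {1}AU -lebesgue_muE (measure_fin_bigcup _ finS tA); last by move=> s _; exact: mAs.
rewrite (fsbigE (index_enum {ffun 'I_n -> bool}))/=.
- by apply: eq_big => s; [rewrite in_setT|rewrite lebesgue_muE].
- exact: index_enum_uniq.
- by [].
- by move=> s _; rewrite mem_index_enum.
Qed.

Lemma sign_cell_nonneg n (s : 'I_n -> bool) x :
  sign_cell s (flip s x) -> nonneg x.
Proof.
move=> sx i; have := sx i; rewrite flipE; case: (s i).
  by rewrite expr1 mulN1r oppr_lt0 => /ltW.
by rewrite expr0 mul1r ltNge => /negbFE.
Qed.

(** Only an inequality is claimed: a point of A with a zero coordinate is
    counted in several of the reflected pieces. *)
Lemma lebesgue_rV_orthants_le n (A : set 'rV[R]_n) : borel A ->
  (lebesgue_rV A <= \sum_(s : {ffun 'I_n -> bool})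
      lebesgue_rV [set x | nonneg x /\ A (flip s x)])%E.
Proof.
move=> mA; rewrite (lebesgue_rV_cells mA); apply: lee_sum => s _.
have mC := borel_sign_cell s.
have mAf : borel [set x | A (flip s x)].
  exact: (borel_preimage (measurable_flip s)).
rewrite -(lebesgue_flip s) ; last exact: borel_setI.
apply: le_lebesgue_rV.
- apply: borel_setI => //; exact: (borel_preimage (measurable_flip s)).
- by apply: borel_setI => //; exact: borel_nonneg.
by move=> x [Ax /sign_cell_nonneg].
Qed.

(** Boundedness makes the intersections of A with the coordinate
    hyperplanes negligible: each is contained in a box with an edge of
    length 0. *)
Lemma lebesgue_rV_symmetric n (A : set 'rV[R]_n) (r : R) :
  borel A -> A `<=` cube r ->
  (forall (s : 'I_n -> bool) x, A x -> A (flip s x)) ->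
  lebesgue_rV A = ((2 ^+ n)%:E * lebesgue_rV (A `&` @nonneg n))%E.
Proof.
move=> mA Ar sA.
have mAn : borel (A `&` @nonneg n) by apply: borel_setI => //; exact: borel_nonneg.
have mH (i : 'I_n) : borel ([set x : 'rV[R]_n | x 0 i \in `[0, 0]] `&` A).
  by apply: borel_setI => //; exact: borel_coord_itv.
have H0 (i : 'I_n) : lebesgue_rV ([set x : 'rV[R]_n | x 0 i \in `[0, 0]] `&` A) = 0%E.
  have [r0|r0] := leP 0 r; last first.
    rewrite (_ : _ `&` _ = set0) -?lebesgue_muE ?measure0//.
    apply/seteqP; split=> // x /= [_ /Ar /(_ i)]; lra.
  apply/le_anti; rewrite lebesgue_rV_ge0 andbT.
  pose a j : R := if j == i then 0 else r.
  have a0 j : - a j <= a j by rewrite /a; case: ifP; lra.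
  have ai : a i = 0 by rewrite /a eqxx.
  have boxE : lebesgue_rV (box (fun j => - a j) a) = 0%E.
    by rewrite lebesgue_rV_box// (bigD1 i)//= ai oppr0 subrr mul0r.
  rewrite -[leRHS]boxE.
  apply: le_lebesgue_rV => //; first exact: borel_box.
  move=> x /= [xi /Ar xr] j; rewrite /a; case: eqP => [->|_]; last exact: xr.
  by move: xi; rewrite in_itv /= oppr0.
rewrite lebesgue_rV_cells//.
transitivity (\sum_(s : {ffun 'I_n -> bool}) lebesgue_rV (A `&` @nonneg n))%E; last first.
  rewrite sumr_const -[X in _ = (X%:E * _)%E]natrX mule_natl.
  by congr (_ *+ _)%E; rewrite card_ffun card_bool card_ord.
apply: eq_bigr => s _.
have mC := borel_sign_cell s.
have mF : borel [set x | A (flip s x) /\ sign_cell s (flip s x)].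
  exact: (borel_preimage (measurable_flip s) (borel_setI mA mC)).
rewrite -(lebesgue_flip s); last exact: borel_setI.
apply/le_anti/andP; split.
  apply: le_lebesgue_rV => // x [Ax /sign_cell_nonneg x0].
  by split => //; rewrite -(flipK s x); exact: sA.
apply: (@le_trans _ _ (lebesgue_rV ([set x | A (flip s x) /\ sign_cell s (flip s x)] `|`
    [set x | exists i, ([set x : 'rV[R]_n | x 0 i \in `[0, 0]] `&` A) x]))).
  apply: le_lebesgue_rV => //; first by apply: borel_setU => //; exact: borel_exists.
  move=> x [Ax x0].
  have [[i xi]|xN0] := pselect (exists i, x 0 i = 0).
    by right; exists i; split=> //=; rewrite xi in_itv /= lexx.
  left; split; first exact: sA.
  move=> i; have xi : 0 < x 0 i.
    by rewrite lt_neqAle x0 andbT; apply/eqP => xi; apply: xN0; exists i.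
  rewrite flipE; case: (s i); first by rewrite expr1 mulN1r oppr_lt0.
  by rewrite expr0 mul1r; apply/negbTE; rewrite -leNgt.
apply: (le_trans (lebesgue_rV_setU _ _)) => //; first exact: borel_exists.
rewrite -[leRHS]adde0 leeD2l//.
have := @lebesgue_rV_exists n n _ 0 mH; rewrite mul0rn; apply => i.
by rewrite H0.
Qed.

End Orthants.

(** * Convex bodies and support functions *)

Section InnerProduct.
Context {R : realType} {n : nat}.
Implicit Types x y z : 'rV[R]_n.

Lemma dotC x y : dot x y = dot y x.
Proof. by apply: eq_bigr => i _; rewrite mulrC. Qed.

Lemma dotDr x y z : dot x (y + z) = dot x y + dot x z.
Proof. by rewrite /dot -big_split; apply: eq_bigr => i _; rewrite mxE mulrDr. Qed.

Lemma dotZr c x y : dot x (c *: y) = c * dot x y.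
Proof. by rewrite /dot mulr_sumr; apply: eq_bigr => i _; rewrite mxE mulrCA. Qed.

Lemma dotDl x y z : dot (x + y) z = dot x z + dot y z.
Proof. by rewrite !(dotC _ z) dotDr. Qed.

Lemma dotZl c x y : dot (c *: x) y = c * dot x y.
Proof. by rewrite !(dotC _ y) dotZr. Qed.

Lemma dotNr x y : dot x (- y) = - dot x y.
Proof. by rewrite -scaleN1r dotZr mulN1r. Qed.

Lemma dotNl x y : dot (- x) y = - dot x y.
Proof. by rewrite !(dotC _ y) dotNr. Qed.

Lemma dotBr x y z : dot x (y - z) = dot x y - dot x z.
Proof. by rewrite dotDr dotNr. Qed.

Lemma dot0r x : dot x 0 = 0.
Proof. by rewrite -(scale0r 0) dotZr mul0r. Qed.

Lemma dot0l x : dot 0 x = 0.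
Proof. by rewrite dotC dot0r. Qed.

Lemma dot_ge0 x : 0 <= dot x x.
Proof. by apply: sumr_ge0 => i _; rewrite -expr2 sqr_ge0. Qed.

Lemma dot_eq0 x : dot x x = 0 -> x = 0.
Proof.
move=> /eqP; rewrite psumr_eq0 => [/allP x0|i _]; last by rewrite -expr2 sqr_ge0.
apply/rowP => i; have := x0 i (mem_index_enum i).
by rewrite -expr2 sqrf_eq0 mxE => /eqP.
Qed.

Lemma dot_delta i y : dot (delta_mx 0 i) y = y 0 i.
Proof.
rewrite /dot (bigD1 i)//= mxE !eqxx mul1r big1 ?addr0// => j ji.
by rewrite mxE eqxx (negbTE ji) mul0r.
Qed.

Lemma dot_mulmx m (w : 'rV[R]_m) (x : 'rV[R]_n) (M : 'M[R]_(n, m)) :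
  dot w (x *m M) = dot (w *m M^T) x.
Proof.
have dotE k (a b : 'rV[R]_k) : dot a b = (a *m b^T) 0 0.
  by rewrite mxE; apply: eq_bigr => i _; rewrite mxE.
by rewrite !dotE trmx_mul mulmxA.
Qed.

Lemma continuous_dot x : continuous (dot x).
Proof.
rewrite /dot; apply: continuous_big => [|i _ y]; first exact: add_continuous.
have cy : (fun z : 'rV[R]_n => z 0 i) @ y --> y 0 i by exact: coord_continuous.
exact: (cvgM (cvg_cst (x 0 i)) cy).
Qed.

End InnerProduct.

Section ConvexBodies.
Context {R : realType} {n : nat}.
Implicit Types (x y z : 'rV[R]_n) (K L : set 'rV[R]_n) (h : 'rV[R]_n -> R).

Definition wulff h : set 'rV[R]_n := [set y | forall x, dot x y <= h x].

(** This property characterizes the support functions of convex bodies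
    (attained_support, support_wulff). Unlike sublinearity, it can be
    checked for an L_p-sum by exhibiting the points where the supremum is
    reached. *)
Definition attained h :=
  forall x0, exists2 l, wulff h l & dot x0 l = h x0.

Lemma convex_setP K :
  convex_set (K : set (convex_lmodType 'rV[R]_n)) <->
  (forall x y t, 0 <= t <= 1 -> K x -> K y -> K (t *: x + (1 - t) *: y)).
Proof.
split=> [cK x y t /andP[t0 t1] Kx Ky|cK x y l /set_mem Kx /set_mem Ky].
  by have /set_mem := cK x y (Itv01 t0 t1) (mem_set Kx) (mem_set Ky).
by apply/mem_set/(cK x y l%:inum) => //; apply/andP; split.
Qed.

Lemma support_eq K x s : (forall k, K k -> dot x k <= s) ->
  (exists2 k, K k & dot x k = s) -> support K x = s.
Proof.
move=> Ks [k Kk ks]; apply/le_anti/andP; split.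
  apply: ge_sup; first by exists (dot x k), k.
  by move=> _ [z Kz <-]; exact: Ks.
rewrite -ks; apply: ub_le_sup; last by exists k.
by exists s => _ [z Kz <-]; exact: Ks.
Qed.

Lemma support_max K x : convex_body K ->
  exists k, [/\ K k, dot x k = support K x & forall z, K z -> dot x z <= support K x].
Proof.
move=> [K0 cK _].
have cd : {within K, continuous (dot x)}.
  by apply: continuous_subspaceT; exact: continuous_dot.
have [k /set_mem Kk kmax] := compact_EVT_max K0 cK cd.
have {}kmax z : K z -> dot x z <= dot x k by move=> /mem_set; exact: kmax.
have kE : support K x = dot x k by apply: support_eq => //; exists k.
by exists k; split=> // z Kz; rewrite kE; exact: kmax.
Qed.

Lemma le_support K x k : convex_body K -> K k -> dot x k <= support K x.
Proof. by move=> /(support_max x)[_ [_ _]]; exact. Qed.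

Lemma attained_support K : convex_body K -> attained (support K).
Proof.
move=> bK x0; have [k [Kk kE _]] := support_max x0 bK.
by exists k => // x; exact: le_support.
Qed.

(** The direction from the point of K nearest to y towards y separates
    them. *)
Lemma convex_body_separation K y : convex_body K -> ~ K y ->
  exists x, support K x < dot x y.
Proof.
move=> bK yK; have [K0 cK /convex_setP vK] := bK.
(* The squared distance from y to z, up to a constant. *)
pose f z := dot z z + dot (- (2 *: y)) z.
have cf : {within K, continuous f}.
  have cs : continuous (fun z : 'rV[R]_n => \sum_i z 0 i * z 0 i).
    apply: continuous_big => [|i _ z]; first exact: add_continuous.
    have cz : (fun z : 'rV[R]_n => z 0 i) @ z --> z 0 i by exact: coord_continuous.
    exact: (cvgM cz cz).
  apply: continuous_subspaceT => z.
  exact: (cvgD (cs z) (@continuous_dot _ _ (- (2 *: y)) z)).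
have [k /set_mem Kk kmin] := compact_EVT_min K0 cK cf.
pose x := y - k.
have x0 : 0 < dot x x.
  rewrite lt_neqAle dot_ge0 andbT; apply/eqP => /esym/dot_eq0/eqP.
  by rewrite subr_eq0 => /eqP yk; apply: yK; rewrite yk.
have kx z : K z -> dot x z <= dot x k.
  move=> Kz; rewrite leNgt; apply/negP => xkz.
  pose a := dot x z - dot x k; pose b := dot (z - k) (z - k).
  have a0 : 0 < a by rewrite subr_gt0.
  have b0 : 0 <= b by exact: dot_ge0.
  (* On the segment from k to z the squared distance is f k - 2 t a + t^2
     b; this t is small enough for it to decrease, and at most 1. *)
  pose t := a / (a + b).
  have t0 : 0 < t by rewrite divr_gt0// ltr_wpDr.
  have t1 : t <= 1 by rewrite ler_pdivrMr ?mul1r ?lerDl// ltr_wpDr.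
  have := kmin (t *: z + (1 - t) *: k) (mem_set (vK _ _ _ _ Kz Kk)).
  rewrite (ltW t0) t1 => /(_ isT).
  have -> : f (t *: z + (1 - t) *: k) = f k - 2 * t * a + t ^+ 2 * b.
    rewrite /f /a /b /x !(dotDl, dotDr, dotNl, dotNr, dotZl, dotZr).
    by rewrite (dotC z k); ring.
  have tb : t * b <= a.
    have ab0 : 0 < a + b by rewrite ltr_wpDr.
    by rewrite /t mulrAC ler_pdivrMr // mulrDr lerDr mulr_ge0// ltW.
  have tab : t * (t * b) <= t * a by rewrite ler_wpM2l// ltW.
  by have := mulr_gt0 t0 a0; move: tab; nra.
exists x.
have [k' [Kk' <- _]] := support_max x bK.
apply: (le_lt_trans (kx _ Kk')).
by rewrite -subr_gt0 -dotBr.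
Qed.

Lemma convex_bodyE K : convex_body K -> K = wulff (support K).
Proof.
move=> bK; apply/seteqP; split=> [k Kk x|y yK]; first exact: le_support.
apply: contrapT => /(convex_body_separation bK)[x].
by rewrite ltNge yK.
Qed.

Lemma convex_body_inj K L : convex_body K -> convex_body L ->
  support K = support L -> K = L.
Proof. by move=> bK bL KL; rewrite (convex_bodyE bK) (convex_bodyE bL) KL. Qed.

Lemma support_wulff h : attained h -> support (wulff h) = h.
Proof. by move=> ah; apply/funext => x; apply: support_eq => // k; apply. Qed.

Lemma convex_body_wulff h : attained h -> convex_body (wulff h).
Proof.
move=> ah; split.
- by have [l hl _] := ah 0; exists l.
- pose m i := h (delta_mx 0 i) : R; pose m' i := h (- delta_mx 0 i) : R.
  apply: (@subclosed_compact _ _ [set v : 'rV[R]_n | forall i, `[- m' i, m i]%classic (v 0 i)]).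
  + rewrite (_ : wulff h = \bigcap_(x in [set: 'rV[R]_n]) (dot x @^-1` [set t | t <= h x])).
      apply: closed_bigI => x _; apply: closed_comp; last exact: closed_le.
      by move=> y _; exact: continuous_dot.
    by apply/seteqP; split=> y /= hy x; [move=> _|]; exact: hy.
  + apply: (@rV_compact _ _ (fun i => `[- m' i, m i]%classic)) => i.
    exact: segment_compact.
  + move=> y hy i /=; rewrite in_itv /= -(dot_delta i) hy andbT.
    by rewrite lerNl -dotNl hy.
- apply/convex_setP => y z t /andP[t0 t1] hy hz x.
  rewrite dotDr !dotZr (_ : h x = t * h x + (1 - t) * h x); last by ring.
  by rewrite lerD// ler_wpM2l ?subr_ge0.
Qed.

Lemma body_of_supportP h : attained h ->
  convex_body (body_of_support h) /\ support (body_of_support h) = h.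
Proof.
move=> ah; apply: (@xgetPex _ _ [set M | convex_body M /\ support M = h]).
by exists (wulff h); split; [exact: convex_body_wulff|exact: support_wulff].
Qed.

End ConvexBodies.

(** * L_p-sums *)

Section PowerFunctions.
Context {R : realType}.
Implicit Types (p x y : R).

Lemma powRK p x : p != 0 -> 0 <= x -> (x `^ p) `^ p^-1 = x.
Proof. by move=> p0 x0; rewrite -powRrM mulfV// powRr1. Qed.

Lemma powRVK p x : p != 0 -> 0 <= x -> (x `^ p^-1) `^ p = x.
Proof. by move=> p0 x0; rewrite -powRrM mulVf// powRr1. Qed.

Lemma powRV p x : 0 < x -> x^-1 `^ p = (x `^ p)^-1.
Proof.
move=> x0; apply: (mulIf (x := x `^ p)); first by rewrite powR_eq0 gt_eqF.
rewrite -powRM ?invr_ge0 ?ltW// mulVf ?gt_eqF// powR1 mulVf//.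
by rewrite powR_eq0 gt_eqF.
Qed.

Lemma powR_inj p x y : 0 < p -> 0 <= x -> 0 <= y -> x `^ p = y `^ p -> x = y.
Proof. by move=> p0 x0 y0 /(powR_injective p0)->. Qed.

End PowerFunctions.

Section LpSums.
Context {R : realType} {n : nat}.
Variable p : R.
Hypothesis p1 : 1 < p.
Implicit Types (x y a b : 'rV[R]_n) (K L : set 'rV[R]_n) (h : 'rV[R]_n -> R).

Let p0 : 0 < p. Proof. exact: lt_trans p1. Qed.
Let pneq0 : p != 0. Proof. by rewrite gt_eqF. Qed.

(** If k1 and k2 are support points of the two bodies in the direction x0,
    then w1 k1 + w2 k2 is one of their L_p-sum, where the weights make
    Hoelder's inequality an equality at x0; in the other directions
    Hoelder's inequality gives the upper bound. *)
Lemma attained_lpsum h1 h2 : attained h1 -> attained h2 ->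
  (forall x, 0 <= h1 x) -> (forall x, 0 <= h2 x) ->
  attained (fun x => (h1 x `^ p + h2 x `^ p) `^ p^-1).
Proof.
move=> ah1 ah2 h1_ge0 h2_ge0 x0.
pose h x := (h1 x `^ p + h2 x `^ p) `^ p^-1.
have S_ge0 x : 0 <= h1 x `^ p + h2 x `^ p by rewrite addr_ge0 ?powR_ge0.
have hp x : h x `^ p = h1 x `^ p + h2 x `^ p by rewrite powRVK.
have [H0|H0] := eqVneq (h x0) 0.
  by exists 0; [move=> x; rewrite dot0r powR_ge0|rewrite dot0r].
have Hgt : 0 < h x0 by rewrite lt_neqAle eq_sym H0 powR_ge0.
have Hge : 0 <= h x0 by exact: ltW.
have [k1 hk1 k1E] := ah1 x0; have [k2 hk2 k2E] := ah2 x0.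
pose q := p / (p - 1).
have pm1 : 0 < p - 1 by rewrite subr_gt0.
have q0 : 0 < q by rewrite divr_gt0.
have pq : q^-1 + p^-1 = 1.
  by rewrite /q invf_div mulrBl mulfV// div1r subrK.
(* The weights of the equality case of Hoelder's inequality. *)
pose w (hi : 'rV[R]_n -> R) := (hi x0 / h x0) `^ (p - 1).
have wq (hi : 'rV[R]_n -> R) : 0 <= hi x0 -> w hi `^ q = hi x0 `^ p / h x0 `^ p.
  move=> hi0; rewrite -powRrM (_ : (p - 1) * q = p); last first.
    by rewrite /q mulrCA mulfV ?mulr1// gt_eqF.
  by rewrite powRM ?invr_ge0// powRV.
have wM (hi : 'rV[R]_n -> R) : 0 <= hi x0 -> w hi * hi x0 = h x0 * (hi x0 `^ p / h x0 `^ p).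
  move=> hi0; rewrite -wq// {1}(_ : hi x0 = h x0 * (hi x0 / h x0)); last first.
    by rewrite mulrCA mulfV ?mulr1.
  rewrite mulrCA; congr (_ * _).
  rewrite mulrC mulr_powRB1 ?divr_ge0// -powRrM.
  by congr (_ `^ _); rewrite /q mulrCA mulfV ?mulr1// gt_eqF.
have w1 : h1 x0 `^ p / h x0 `^ p + h2 x0 `^ p / h x0 `^ p = 1.
  by rewrite -mulrDl -hp mulfV// powR_eq0 (negbTE H0).
exists (w h1 *: k1 + w h2 *: k2); last first.
  by rewrite dotDr !dotZr k1E k2E (wM h1 (h1_ge0 x0)) (wM h2 (h2_ge0 x0)) -mulrDr w1 mulr1.
move=> x; rewrite dotDr !dotZr.
have wx (hi : 'rV[R]_n -> R) k : wulff hi k -> w hi * dot x k <= w hi * hi x.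
  by move=> hk; rewrite ler_wpM2l ?powR_ge0.
apply: (le_trans (lerD (wx _ _ hk1) (wx _ _ hk2))).
have w_ge0 hi : 0 <= w hi by exact: powR_ge0.
have := hoelder2 (w_ge0 h1) (w_ge0 h2) (h1_ge0 x) (h2_ge0 x) q0 p0 pq.
by rewrite (wq h1 (h1_ge0 x0)) (wq h2 (h2_ge0 x0)) w1 powR1 mul1r.
Qed.

(** Nonnegativity of the support function is the form in which containing
    the origin enters the formula for L_p-sums. *)
Definition lp_body K := convex_body K /\ forall x, 0 <= support K x.

Lemma lp_bodyI K : convex_body K -> K 0 -> lp_body K.
Proof. by move=> bK K0; split=> // x; rewrite -(dot0r x); exact: le_support. Qed.

Lemma lpsumP K L : lp_body K -> lp_body L ->
  lp_body (lpsum p K L) /\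
  forall x, support (lpsum p K L) x `^ p = support K x `^ p + support L x `^ p.
Proof.
move=> [bK K0] [bL L0].
have [bS sS] := body_of_supportP
  (attained_lpsum (attained_support bK) (attained_support bL) K0 L0).
rewrite -/(lpsum p K L) in bS sS.
split; first by split=> // x; rewrite sS powR_ge0.
by move=> x; rewrite sS powRVK// addr_ge0 ?powR_ge0.
Qed.

Lemma convex_body_set1 : convex_body ([set 0] : set 'rV[R]_n).
Proof.
split; [by exists 0|exact: compact_set1|].
by apply/convex_setP => x y t _ -> ->; rewrite !scaler0 addr0.
Qed.

Lemma support_set1 x : support [set 0] x = 0.
Proof.
apply: support_eq => [_ ->|]; first by rewrite dot0r.
by exists 0; rewrite ?dot0r.
Qed.

Lemma big_lpsumP (I : Type) (r : seq I) (P : pred I) (F : I -> set 'rV[R]_n) :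
  (forall i, P i -> lp_body (F i)) ->
  lp_body (\big[lpsum p / [set 0]]_(i <- r | P i) F i) /\
  forall x, support (\big[lpsum p / [set 0]]_(i <- r | P i) F i) x `^ p =
            \sum_(i <- r | P i) support (F i) x `^ p.
Proof.
move=> bF; elim: r => [|i r [bIH sIH]].
  rewrite !big_nil; split; first exact: (lp_bodyI convex_body_set1).
  by move=> x; rewrite support_set1 big_nil powR0.
rewrite big_cons; case: (boolP (P i)) => Pi; last first.
  by split=> // x; rewrite sIH big_cons (negbTE Pi).
have [bS sS] := lpsumP (bF i Pi) bIH.
by split=> // x; rewrite sS sIH big_cons Pi.
Qed.

Lemma convex_body_scale c K : convex_body K -> convex_body (scale c K).
Proof.
move=> [[k Kk] cK /convex_setP vK]; split.
- by exists (c *: k), k.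
- apply: continuous_compact => //; apply: continuous_subspaceT.
  exact: scaler_continuous.
- apply/convex_setP => _ _ t t01 [x Kx <-] [y Ky <-].
  by exists (t *: x + (1 - t) *: y); [exact: vK|rewrite scalerDr !scalerA ![c * _]mulrC].
Qed.

Lemma support_scale c K x : convex_body K -> 0 <= c ->
  support (scale c K) x = c * support K x.
Proof.
move=> bK c0; apply: support_eq => [_ [k Kk <-]|].
  by rewrite dotZr ler_wpM2l// le_support.
have [k [Kk kE _]] := support_max x bK.
by exists (c *: k); [exists k|rewrite dotZr kE].
Qed.

Lemma reflect0E K : reflect0 K = scale (-1) K.
Proof. by apply/seteqP; split=> _ [x Kx <-]; exists x; rewrite // scaleN1r. Qed.

Lemma support_reflect0 K x : convex_body K -> support (reflect0 K) x = support K (- x).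
Proof.
move=> bK; apply: support_eq => [_ [k Kk <-]|].
  by rewrite dotNr -dotNl le_support.
have [k [Kk kE _]] := support_max (- x) bK.
by exists (- k); [exists k|rewrite dotNr -dotNl].
Qed.

Lemma lp_body_scale c K : lp_body K -> 0 <= c -> lp_body (scale c K).
Proof.
move=> [bK K0] c0; split; first exact: convex_body_scale.
by move=> x; rewrite support_scale// mulr_ge0.
Qed.

Lemma lp_body_reflect0 K : lp_body K -> lp_body (reflect0 K).
Proof.
move=> [bK K0]; split; first by rewrite reflect0E; exact: convex_body_scale.
by move=> x; rewrite support_reflect0.
Qed.

Lemma convex_body_segment a b : convex_body (segment a b).
Proof.
split.
- by exists a, 0; rewrite ?scale0r ?subr0 ?scale1r ?addr0//= in_itv /= lexx ler01.
- apply: continuous_compact; last exact: segment_compact.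
  apply: continuous_subspaceT => t; apply: cvgD.
    by apply: cvgZr_tmp; apply: cvgB; [exact: cvg_cst|exact: cvg_id].
  by apply: cvgZr_tmp; exact: cvg_id.
- apply/convex_setP => _ _ t /andP[t0 t1] [s s01 <-] [s' s'01 <-].
  exists (t * s + (1 - t) * s').
    move: s01 s'01; rewrite /= !in_itv /= => /andP[? ?] /andP[? ?].
    by apply/andP; split; nra.
  by apply/rowP => i; rewrite !mxE; ring.
Qed.

Lemma lp_body_segment a b : segment a b 0 -> lp_body (segment a b).
Proof. by apply: lp_bodyI; exact: convex_body_segment. Qed.

Lemma support_segment a b x : support (segment a b) x = Num.max (dot x a) (dot x b).
Proof.
apply: support_eq => [_ [t + <-]|].
  rewrite /= in_itv /= dotDr !dotZr => /andP[t0 t1].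
  have h1 : dot x a <= Num.max (dot x a) (dot x b) by rewrite le_max lexx.
  have h2 : dot x b <= Num.max (dot x a) (dot x b) by rewrite le_max lexx orbT.
  nra.
have [ab|ba] := leP (dot x a) (dot x b).
  by exists b => //; exists 1; rewrite ?subrr ?scale0r ?scale1r ?add0r//= in_itv /= lexx ler01.
by exists a => //; exists 0; rewrite ?subr0 ?scale0r ?scale1r ?addr0//= in_itv /= lexx ler01.
Qed.

(** A segment through 0 is the L_p-sum of its two halves: as 0 lies between a
    and b, the products with a and b have opposite signs, and at most one of the
    two terms is nonzero. *)
Lemma support_segment_powR a b x : segment a b 0 ->
  support (segment a b) x `^ p =
  Num.max (dot x a) 0 `^ p + Num.max (dot x b) 0 `^ p.
Proof.
move=> [t + tab]; rewrite /= in_itv /= => /andP[t0 t1].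
have := congr1 (dot x) tab; rewrite dotDr !dotZr dot0r support_segment => {}tab.
set A := dot x a in tab *; set B := dot x b in tab *.
have [A0|A0] := leP A 0; have [B0|B0] := leP B 0.
- suff : A = 0 \/ B = 0.
    by case=> AB; rewrite AB ?[Num.max 0 _]max_l// ?[Num.max _ 0]max_r// powR0// addr0.
  have [t0'|t0'] := eqVneq t 0; first by left; move: tab; rewrite t0'; lra.
  right; apply/eqP; rewrite eq_le B0; have : 0 < t by rewrite lt_neqAle eq_sym t0'.
  by move=> t_gt0; nra.
- by rewrite powR0// add0r max_r// (le_trans A0)// ltW.
- by rewrite [X in _ + X]powR0// addr0 max_l// (le_trans B0)// ltW.
- by exfalso; nra.
Qed.

End LpSums.

(** * Inequalities between powers *)

Section PowerInequalities.
Context {R : realType}.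
Implicit Types (p x y a b : R).

Lemma conjugate_exp p : 1 < p ->
  [/\ 0 < p, p != 0, 0 < p / (p - 1) & p^-1 + (p / (p - 1))^-1 = 1].
Proof.
move=> p1; have p0 : 0 < p by exact: lt_trans p1.
have pm1 : 0 < p - 1 by rewrite subr_gt0.
split=> //; first by rewrite gt_eqF.
  by rewrite divr_gt0.
by rewrite invf_div mulrBl mulfV ?gt_eqF// div1r addrC subrK.
Qed.

(** Young's inequality, read as the convexity of the power function: the graph
    lies above its tangents. *)
Lemma powR_tangent p a b : 1 < p -> 0 <= a -> 0 <= b ->
  b `^ p + p * b `^ (p - 1) * (a - b) <= a `^ p.
Proof.
move=> p1 a0 b0; have [p0 pn0 q0 pq] := conjugate_exp p1.
have := conjugate_powR a0 (powR_ge0 b (p - 1)) p0 q0 pq.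
rewrite -powRrM (_ : (p - 1) * _ = p); last first.
  by rewrite mulrCA mulfV ?mulr1// subr_eq0 gt_eqF.
rewrite (_ : (p / (p - 1))^-1 = 1 - p^-1); last first.
  by rewrite -[X in _ = X - _]pq addrAC subrr add0r.
have bE : b * b `^ (p - 1) = b `^ p by rewrite mulr_powRB1.
move=> /(ler_wpM2l (ltW p0)).
have pV : p * p^-1 = 1 by rewrite mulfV.
rewrite mulrDr (_ : p * (a `^ p / p) = a `^ p); last by rewrite mulrCA pV mulr1.
rewrite (_ : p * (b `^ p * (1 - p^-1)) = p * b `^ p - b `^ p * (p * p^-1)); last by ring.
rewrite pV mulr1 => h.
rewrite mulrBr -[p * _ * b]mulrA [_ * b]mulrC bE -[p * _ * a]mulrA [_ * a]mulrC.
lra.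
Qed.

Lemma le_powR_sub p a b : 1 < p -> 0 <= a -> 0 <= b ->
  b `^ p - a `^ p <= p * b `^ (p - 1) * (b - a).
Proof. by move=> p1 a0 b0; have := powR_tangent p1 a0 b0; lra. Qed.

Lemma le_powR p a b : 0 <= p -> 0 <= a -> a <= b -> a `^ p <= b `^ p.
Proof.
by move=> p0 a0 ab; apply: ge0_ler_powR => //; rewrite nnegrE// (le_trans a0).
Qed.

Lemma powR_superadd p a b : 1 <= p -> 0 <= a -> 0 <= b ->
  a `^ p + b `^ p <= (a + b) `^ p.
Proof.
move=> p1 a0 b0; have p0 : 0 < p by exact: lt_le_trans p1.
have pm1 : 0 <= p - 1 by rewrite subr_ge0.
rewrite -(mulr_powRB1 a0 p0) -(mulr_powRB1 b0 p0) -(mulr_powRB1 (addr_ge0 a0 b0) p0).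
rewrite mulrDl lerD//.
  by rewrite ler_wpM2l// le_powR// lerDl.
by rewrite ler_wpM2l// le_powR// lerDr.
Qed.

(** If b is at most t a, the first term alone is enough for a small t;
    otherwise a is at most b / t and the second term is. *)
Lemma powR_peter_paul p c : 0 < p -> 1 < c -> exists2 C : R, 0 <= C &
  forall a b, 0 <= a -> 0 <= b -> (a + b) `^ p <= c * a `^ p + C * b `^ p.
Proof.
move=> p0 c1; have c0 : 0 < c by exact: lt_trans c1.
pose t := c `^ p^-1 - 1.
have t0 : 0 < t.
  have : 1 `^ p^-1 < c `^ p^-1 by rewrite gt0_ltr_powR// ?invr_gt0// nnegrE ltW.
  by rewrite powR1 subr_gt0.
have tc : (1 + t) `^ p = c by rewrite /t addrCA subrr addr0 powRVK ?gt_eqF// ltW.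
exists ((1 + t^-1) `^ p); first exact: powR_ge0.
have t_ge0 := ltW t0; have p_ge0 := ltW p0.
have t1 : 0 <= 1 + t by rewrite addr_ge0.
have t1' : 0 <= 1 + t^-1 by rewrite addr_ge0// invr_ge0.
move=> a b a0 b0; have ab0 : 0 <= a + b by rewrite addr_ge0.
have [ba|ab] := leP b (t * a).
  apply: (@le_trans _ _ (c * a `^ p)).
    rewrite -tc -powRM//; apply: le_powR => //.
    by rewrite mulrDl mul1r lerD2l.
  by rewrite lerDl mulr_ge0 ?powR_ge0.
apply: (@le_trans _ _ ((1 + t^-1) `^ p * b `^ p)).
  rewrite -powRM//; apply: le_powR => //.
  by rewrite mulrDl mul1r addrC lerD2l ler_pdivlMl// ltW.
by rewrite lerDr mulr_ge0 ?powR_ge0// ltW.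
Qed.

(** By the tangent inequality the power function is Lipschitz near l. *)
Lemma powR_cvg (T : Type) (F : set_system T) (FF : Filter F) p (f : T -> R) (l : R) :
  1 < p -> (forall t, 0 <= f t) -> 0 <= l -> f @ F --> l ->
  (fun t => f t `^ p) @ F --> l `^ p.
Proof.
move=> p1 f0 l0 fl; have p0 : 0 < p by exact: lt_trans p1.
have pm1 : 0 <= p - 1 by rewrite subr_ge0 ltW.
pose C := p * (l + 1) `^ (p - 1).
have C0 : 0 <= C by rewrite mulr_ge0 ?powR_ge0 ?ltW.
have bound t : `|l - f t| < 1 -> `|l `^ p - f t `^ p| <= C * `|l - f t|.
  move=> ft; have fl1 : f t <= l + 1 by move: ft; rewrite ltr_norml; lra.
  have le_C a : 0 <= a -> a <= l + 1 -> p * a `^ (p - 1) <= C.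
    by move=> a0 al; rewrite ler_wpM2l ?le_powR// ltW.
  have [lf|fl'] := leP l (f t).
    have lfp := le_powR (ltW p0) l0 lf.
    rewrite [X in X <= _]ler0_norm ?subr_le0// [X in _ * X]ler0_norm ?subr_le0// !opprB.
    apply: (le_trans (le_powR_sub p1 l0 (f0 t))).
    by rewrite ler_wpM2r ?subr_ge0// le_C.
  have flp := le_powR (ltW p0) (f0 t) (ltW fl').
  rewrite [X in X <= _]ger0_norm ?subr_ge0// [X in _ * X]ger0_norm; last by rewrite subr_ge0 ltW.
  apply: (le_trans (le_powR_sub p1 (f0 t) l0)).
  by apply: ler_wpM2r; [rewrite subr_ge0 ltW|rewrite le_C// lerDl].
apply/cvgrPdist_lt => e e0.
have d0 : 0 < Num.min 1 (e / (C + 1)) by rewrite lt_min ltr01 divr_gt0// ltr_wpDl.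
move/cvgrPdist_lt: fl => /(_ _ d0); apply: filterS => t.
rewrite lt_min => /andP[/bound h1 h2]; apply: (le_lt_trans h1).
apply: (@le_lt_trans _ _ ((C + 1) * `|l - f t|)); first by rewrite ler_wpM2r// lerDl.
by rewrite mulrC -ltr_pdivlMr// ltr_wpDl.
Qed.

(** The sum is at most m times its largest term. *)
Lemma sum_powR_le p m (a : 'I_m -> R) : 0 < p -> (forall i, 0 <= a i) ->
  (\sum_i a i) `^ p <= \sum_i (m%:R * a i) `^ p.
Proof.
move=> p0 a0; case: m => [|m] in a a0 *.
  by rewrite !big_ord0 powR0 ?gt_eqF.
have [i _ imax] := @arg_maxP _ _ 'I_m.+1 ord0 xpredT a isT.
apply: (@le_trans _ _ ((m.+1%:R * a i) `^ p)).
  apply: le_powR; [exact: ltW|exact: sumr_ge0|].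
  rewrite mulr_natl -[X in _ *+ X]card_ord -sumr_const.
  by apply: ler_sum => j _; exact: imax.
by rewrite (bigD1 i)//= lerDl sumr_ge0// => j _; exact: powR_ge0.
Qed.

End PowerInequalities.

(** * Support functions of zonoids *)

Section Zonoids.
Context {R : realType} {n : nat}.
Variable p : R.
Hypothesis p1 : 1 < p.
Implicit Types (x y v : 'rV[R]_n) (K L : set 'rV[R]_n) (h : 'rV[R]_n -> R).

Definition pos (t : R) : R := Num.max t 0.

Lemma pos_ge0 t : 0 <= pos t.
Proof. by rewrite le_max lexx orbT. Qed.

Lemma le_pos t : t <= pos t.
Proof. by rewrite le_max lexx. Qed.

Lemma pos_id t : 0 <= t -> pos t = t.
Proof. by move=> t0; rewrite /pos max_l. Qed.

Lemma pos_eq0 t : t <= 0 -> pos t = 0.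
Proof. by move=> t0; rewrite /pos max_r. Qed.

Definition zonotope_sum (vs : seq 'rV[R]_n) x : R :=
  \sum_(v <- vs) pos (dot x v) `^ p.

(** The integral of <x,u>_+^p against a measure is replaced by a limit of
    integrals against finite discrete measures, namely those of the
    zonotopes that approximate the zonoid. *)
Definition zonoidal h :=
  exists vs : nat -> seq 'rV[R]_n,
    forall x, zonotope_sum (vs k) x @[k --> \oo] --> h x `^ p.

Lemma zonotope_vectors K : asym_Lp_zonotope p K ->
  lp_body K /\ exists vs, forall x, support K x `^ p = zonotope_sum vs x.
Proof.
move=> [s s0 ->]; rewrite big_seq.
have [bS sS] := big_lpsumP p1 s (P := fun ab => ab \in s)
  (F := fun ab => segment ab.1 ab.2) (fun ab abs => lp_body_segment (s0 ab abs)).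
split=> //; exists (flatten [seq [:: ab.1; ab.2] | ab <- s]) => x.
rewrite sS /zonotope_sum big_flatten /= big_map big_seq; apply: eq_bigr => ab abs.
by rewrite !big_cons big_nil addr0 (support_segment_powR p1 _ (s0 ab abs)).
Qed.

Definition norm1 x : R := \sum_i `|x 0 i|.

Lemma norm1_ge0 x : 0 <= norm1 x.
Proof. exact: sumr_ge0. Qed.

Lemma dot_le_norm1 x y c : (forall i, `|y 0 i| <= c) -> dot x y <= c * norm1 x.
Proof.
move=> yc; rewrite /dot mulr_sumr; apply: ler_sum => i _.
apply: (le_trans (ler_norm _)); rewrite normrM mulrC.
by rewrite ler_wpM2r.
Qed.

Lemma coord_le_enorm y i : `|y 0 i| <= enorm y.
Proof.
rewrite -sqrtr_sqr ler_sqrt ?dot_ge0// /dot (bigD1 i)//= -expr2 lerDl sumr_ge0// => j _.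
by rewrite -expr2 sqr_ge0.
Qed.

Lemma support_thicken K L e x : convex_body K -> convex_body L ->
  K `<=` thicken e L -> support K x <= support L x + e * norm1 x.
Proof.
move=> bK bL KL; have [k [Kk <- _]] := support_max x bK.
have [l Ll kl] := KL _ Kk.
rewrite -[k](subrK l) addrC dotDr lerD ?le_support//.
by apply: dot_le_norm1 => i; apply: le_trans kl; exact: coord_le_enorm.
Qed.

(** Hausdorff convergence gives pointwise convergence of the support
    functions, hence of their powers. *)
Lemma zonoidP Z : asym_Lp_zonoid p Z -> lp_body Z /\ zonoidal (support Z).
Proof.
move=> [bZ [Y zY YZ]].
have hY x : support (Y k) x @[k --> \oo] --> support Z x.
  apply/cvgrPdist_lt => e e0.
  pose d := e / (norm1 x + 1).
  have N0 : 0 < norm1 x + 1 by rewrite ltr_wpDl// norm1_ge0.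
  have d0 : (0 < d%:E)%E by rewrite lte_fin divr_gt0.
  have Yd : \forall k \near \oo, (hausdorff_dist (Y k) Z < d%:E)%E.
    exact: (YZ _ (open_ereal_lt' d0)).
  apply: filterS Yd => k /ereal_inf_lt[_ [c [c0 YZk ZYk] <-]]; rewrite lte_fin => cd.
  have [[bYk _] _] := zonotope_vectors (zY k).
  have h1 := support_thicken x bYk bZ YZk; have h2 := support_thicken x bZ bYk ZYk.
  apply: (@le_lt_trans _ _ (c * norm1 x)).
    by rewrite ler_norml; apply/andP; split; lra.
  apply: (@le_lt_trans _ _ (c * (norm1 x + 1))); first by rewrite ler_wpM2l// lerDl.
  by rewrite -ltr_pdivlMr.
have Z0 x : 0 <= support Z x.
  apply: (cvgr_to_ge (hY x)); apply: nearW => k.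
  by have [[_ Y0] _] := zonotope_vectors (zY k); exact: Y0.
split=> //.
pose vs k := sval (cid (proj2 (zonotope_vectors (zY k)))).
have vsE k x : support (Y k) x `^ p = zonotope_sum (vs k) x.
  exact: (svalP (cid (proj2 (zonotope_vectors (zY k))))).
exists vs => x; under eq_fun do rewrite -vsE.
apply: powR_cvg => // k.
by have [[_ Y0] _] := zonotope_vectors (zY k); exact: Y0.
Qed.

Lemma zonoidal_linear h (M : 'M[R]_n) : zonoidal h -> zonoidal (fun x => h (x *m M)).
Proof.
move=> [vs vsh]; exists (fun k => [seq v *m M^T | v <- vs k]) => x.
rewrite (_ : (fun k => _) = fun k => zonotope_sum (vs k) (x *m M)) //.
apply/funext => k; rewrite /zonotope_sum big_map; apply: eq_bigr => v _.
by rewrite dotC -dot_mulmx dotC.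
Qed.

End Zonoids.

(** * Zonoids in the positive orthant *)

Section AttainedFunctions.
Context {R : realType} {n : nat}.
Variable h : 'rV[R]_n -> R.
Hypothesis ah : attained h.
Implicit Types x y l : 'rV[R]_n.

Lemma attainedD x y : h (x + y) <= h x + h y.
Proof. by have [l hl <-] := ah (x + y); rewrite dotDl lerD// hl. Qed.

Lemma attained0 : h 0 = 0.
Proof. by have [l _ <-] := ah 0; rewrite dot0l. Qed.

Lemma attainedZ c x : 0 <= c -> h (c *: x) = c * h x.
Proof.
have leZ d y : 0 <= d -> d * h y <= h (d *: y).
  by move=> d0; have [l hl <-] := ah y; rewrite -dotZl hl.
move=> c0; apply/le_anti; rewrite leZ// andbT.
have [->|c_neq0] := eqVneq c 0; first by rewrite scale0r attained0 mul0r.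
have c_gt0 : 0 < c by rewrite lt_neqAle eq_sym c_neq0.
have := leZ c^-1 (c *: x); rewrite invr_ge0 => /(_ c0).
by rewrite scalerA mulVf// scale1r ler_pdivrMl.
Qed.

(** A Lipschitz constant of h for the l_1 norm. *)
Definition slope : R := \sum_i (`|h (delta_mx 0 i)| + `|h (- delta_mx 0 i)|).

Lemma slope_ge0 : 0 <= slope.
Proof. by apply: sumr_ge0 => i _; rewrite addr_ge0. Qed.

Lemma wulff_coord l i : wulff h l -> `|l 0 i| <= slope.
Proof.
move=> hl; apply: (@le_trans _ _ (`|h (delta_mx 0 i)| + `|h (- delta_mx 0 i)|)).
  have := hl (delta_mx 0 i); have := hl (- delta_mx 0 i).
  rewrite dotNl dot_delta ler_norml.
  have := ler_norm (h (delta_mx 0 i)); have := ler_norm (h (- delta_mx 0 i)).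
  have := normr_ge0 (h (delta_mx 0 i)); have := normr_ge0 (h (- delta_mx 0 i)).
  by move=> ? ? ? ? ? ?; apply/andP; split; lra.
by rewrite /slope (bigD1 i)//= lerDl sumr_ge0// => j _; rewrite addr_ge0.
Qed.

Lemma le_slope x : h x <= slope * norm1 x.
Proof.
have [l hl <-] := ah x.
by apply: dot_le_norm1 => i; exact: wulff_coord.
Qed.

Lemma slope_lipschitz x y : h x <= h y + slope * norm1 (x - y).
Proof.
rewrite -[X in h X <= _](subrK y) addrC.
by apply: (le_trans (attainedD _ _)); rewrite lerD2l le_slope.
Qed.

End AttainedFunctions.

Section PositiveZonoids.
Context {R : realType} {n : nat}.
Variable p : R.
Hypothesis p1 : 1 < p.
Implicit Types (x y v l : 'rV[R]_n) (h : 'rV[R]_n -> R).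

Let p0 : 0 < p. Proof. exact: lt_trans p1. Qed.
Let p_ge0 : 0 <= p. Proof. exact: ltW. Qed.
Let pneq0 : p != 0. Proof. by rewrite gt_eqF. Qed.

Definition pos_part x : 'rV[R]_n := \row_i pos (x 0 i).

Lemma pos_part_nonneg x : nonneg (pos_part x).
Proof. by move=> i; rewrite mxE pos_ge0. Qed.

Lemma pos_subN (t : R) : pos t - pos (- t) = t.
Proof.
have [t0|t0] := leP 0 t.
  by rewrite pos_id// pos_eq0 ?oppr_le0// subr0.
by rewrite pos_eq0 ?ltW// pos_id ?oppr_ge0 ?ltW// sub0r opprK.
Qed.

Lemma pos_part_sub x : x = pos_part x - pos_part (- x).
Proof. by apply/rowP => i; rewrite !mxE pos_subN. Qed.

Lemma dot_nonneg x v : nonneg x -> nonneg v -> 0 <= dot x v.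
Proof. by move=> x0 v0; apply: sumr_ge0 => i _; rewrite mulr_ge0. Qed.

(** The sum over v of the powers of the negative coordinates of v tends to
    the sum of the h(-e_i)^p, which is 0. Replacing each v by its positive
    part therefore does not change the limit, by powR_peter_paul with a
    constant close to 1. *)
Lemma zonoidal_nonneg h : zonoidal p h -> (forall i, h (- delta_mx 0 i) = 0) ->
  exists2 vs : nat -> seq 'rV[R]_n, (forall k v, v \in vs k -> nonneg v) &
    forall x, zonotope_sum p (vs k) x @[k --> \oo] --> h x `^ p.
Proof.
move=> [vs vsh] h0; exists (fun k => [seq pos_part v | v <- vs k]).
  by move=> k _ /mapP[v _ ->]; exact: pos_part_nonneg.
move=> x; pose D v := \sum_i `|x 0 i| * pos (- v 0 i).
have D0 v : 0 <= D v by apply: sumr_ge0 => i _; rewrite mulr_ge0// pos_ge0.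
have dE v : `|dot x (pos_part v) - dot x v| <= D v.
  rewrite -dotBr {2}[v]pos_part_sub opprB addrC subrK /dot.
  apply: (le_trans (ler_norm_sum _ _ _)); apply: ler_sum => i _.
  by rewrite !mxE normrM (ger0_norm (pos_ge0 _)).
have d1 v : pos (dot x (pos_part v)) <= pos (dot x v) + D v.
  rewrite ge_max addr_ge0 ?pos_ge0// andbT.
  by have := dE v; have := le_pos (dot x v); rewrite ler_norml; lra.
have d2 v : pos (dot x v) <= pos (dot x (pos_part v)) + D v.
  rewrite ge_max addr_ge0 ?pos_ge0// andbT.
  by have := dE v; have := le_pos (dot x (pos_part v)); rewrite ler_norml; lra.
pose E k := \sum_(v <- vs k) D v `^ p.
have E_cvg : E k @[k --> \oo] --> 0.
  pose S k := \sum_i (n%:R * `|x 0 i|) `^ p * zonotope_sum p (vs k) (- delta_mx 0 i).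
  apply: (@squeeze_cvgr _ _ _ _ (fun=> 0) S).
  - apply: nearW => k; apply/andP; split.
      by apply: sumr_ge0 => v _; exact: powR_ge0.
    rewrite /E /S /zonotope_sum.
    under [leRHS]eq_bigr do rewrite mulr_sumr.
    rewrite exchange_big /=; apply: ler_sum => v _.
    apply: (le_trans (sum_powR_le p0 _)).
      by move=> i; rewrite mulr_ge0// pos_ge0.
    apply: ler_sum => i _.
    by rewrite mulrA powRM ?mulr_ge0 ?pos_ge0// dotNl dot_delta.
  - exact: cvg_cst.
  rewrite (_ : 0 = \sum_i (n%:R * `|x 0 i|) `^ p * h (- delta_mx 0 i) `^ p); last first.
    by rewrite big1// => i _; rewrite h0 powR0// mulr0.
  apply: cvg_big => [|i _]; first exact: add_continuous.
  by apply: cvgM; [exact: cvg_cst|exact: vsh].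
pose G k := zonotope_sum p (vs k) x; pose G' k := \sum_(v <- vs k) pos (dot x (pos_part v)) `^ p.
rewrite (_ : (fun k => _) = G'); last first.
  by apply/funext => k; rewrite /zonotope_sum big_map.
have G_cvg : G k @[k --> \oo] --> h x `^ p by exact: vsh.
set g := h x `^ p in G_cvg *; have g0 : 0 <= g by exact: powR_ge0.
apply/cvgrPdist_le => e e0.
pose c := 1 + e / (2 * (g + 1)).
have eg0 : 0 < e / (2 * (g + 1)) by rewrite divr_gt0// mulr_gt0// ltr_wpDl.
have c1 : 1 < c by rewrite ltrDl.
have c0 : 0 < c by exact: lt_trans c1.
have cg : c * g <= g + e / 2.
  have g1 : g + 1 != 0 by rewrite gt_eqF// ltr_wpDl.
  rewrite /c mulrDl mul1r lerD2l (_ : e / 2 = e / (2 * (g + 1)) * (g + 1)); last by field.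
  by rewrite ler_wpM2l ?lerDl// ltW.
have [C C0 pp] := powR_peter_paul p0 c1.
have up k : G' k <= c * G k + C * E k.
  rewrite /G /G' /E /zonotope_sum !mulr_sumr -big_split /=; apply: ler_sum => v _.
  by apply: le_trans (pp _ _ (pos_ge0 _) (D0 v)); rewrite le_powR ?pos_ge0.
have down k : G k <= c * G' k + C * E k.
  rewrite /G /G' /E /zonotope_sum !mulr_sumr -big_split /=; apply: ler_sum => v _.
  by apply: le_trans (pp _ _ (pos_ge0 _) (D0 v)); rewrite le_powR ?pos_ge0.
have cvg_up : c * G k + C * E k @[k --> \oo] --> c * g.
  rewrite -[c * g]addr0 -(mulr0 C).
  by apply: cvgD; apply: cvgM => //; exact: cvg_cst.
have cvg_down : G k - C * E k @[k --> \oo] --> g.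
  rewrite -[X in _ --> X]subr0 -(mulr0 C).
  by apply: cvgB => //; apply: cvgM => //; exact: cvg_cst.
have e2 : 0 < e / 2 by rewrite divr_gt0.
have nup := cvgr_le _ cvg_up (c * g + e / 2) ltac:(by rewrite ltrDl).
have ndown := cvgr_ge _ cvg_down (g - e / 2) ltac:(by rewrite ltrBlDr ltrDl).
near=> k.
have h1 : c * G k + C * E k <= c * g + e / 2 by near: k; exact: nup.
have h2 : g - e / 2 <= G k - C * E k by near: k; exact: ndown.
have := up k; have := down k => hd hu.
rewrite ler_norml; apply/andP; split; first by lra.
have [gG|Gg] := leP g (G' k); first by lra.
have : (c - 1) * G' k <= (c - 1) * g by rewrite ler_wpM2l ?subr_ge0 ?ltW.
by rewrite !mulrBl !mul1r; lra.
Unshelve. all: by end_near.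
Qed.

(** Inequalities between powers of h reduce to inequalities for one vector
    v at a time. *)
Lemma limit_le4 h vs y1 y2 z1 z2 :
  (forall k v, v \in vs k -> nonneg v) ->
  (forall x, zonotope_sum p (vs k) x @[k --> \oo] --> h x `^ p) ->
  (forall v, nonneg v -> pos (dot y1 v) `^ p + pos (dot y2 v) `^ p <=
                         pos (dot z1 v) `^ p + pos (dot z2 v) `^ p) ->
  h y1 `^ p + h y2 `^ p <= h z1 `^ p + h z2 `^ p.
Proof.
move=> vs0 vsh yz; apply: (ler_cvg_to (cvgD (vsh y1) (vsh y2)) (cvgD (vsh z1) (vsh z2))).
apply: nearW => k.
change (zonotope_sum p (vs k) y1 + zonotope_sum p (vs k) y2 <=
        zonotope_sum p (vs k) z1 + zonotope_sum p (vs k) z2).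
rewrite /zonotope_sum -!big_split big_seq [leRHS]big_seq.
by apply: ler_sum => v vk; exact: yz (vs0 _ _ vk).
Qed.

Lemma pos_pow_sym (a T : R) : `|a| <= T -> pos a `^ p + pos (- a) `^ p <= T `^ p.
Proof.
have [a0|/ltW a0] := leP 0 a => aT.
  rewrite (pos_eq0 (t := - a)) ?oppr_le0// powR0// addr0 pos_id//.
  by apply: le_powR => //; rewrite -(ger0_norm a0).
rewrite pos_eq0// powR0// add0r pos_id ?oppr_ge0//.
by apply: le_powR; rewrite ?oppr_ge0// -(ler0_norm a0).
Qed.

Definition flip1 (i : 'I_n) : 'rV[R]_n -> 'rV[R]_n := flip (pred1 i).

(** The splitting of x into its i-th coordinate and the others isolates the
    effect of changing one sign. *)
Definition axis_part (i : 'I_n) x : 'rV[R]_n := x 0 i *: delta_mx 0 i.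

Lemma dot_axis_part i x v : dot (axis_part i x) v = x 0 i * v 0 i.
Proof. by rewrite dotZl dot_delta. Qed.

Lemma dot_off_axis i x v : dot (x - axis_part i x) v = \sum_(j | j != i) x 0 j * v 0 j.
Proof.
rewrite dotDl dotNl dot_axis_part /dot (bigD1 i)//=.
by rewrite addrAC subrr add0r.
Qed.

Lemma dot_flip1 i x v :
  dot (flip1 i x) v = dot (x - axis_part i x) v - dot (axis_part i x) v.
Proof.
rewrite dot_off_axis dot_axis_part /dot (bigD1 i)//= addrC flipE /= eqxx expr1 mulN1r mulNr.
congr (_ - _); apply: eq_bigr => j /negbTE ji.
by rewrite flipE /= ji expr0 mul1r.
Qed.

Section ZonoidInOrthant.
Variable h : 'rV[R]_n -> R.
Hypothesis ah : attained h.
Hypothesis h_ge0 : forall x, 0 <= h x.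
Hypothesis zh : zonoidal p h.
Hypothesis h_axis : forall i, h (- delta_mx 0 i) = 0.

Lemma wulff_nonneg l : wulff h l -> nonneg l.
Proof.
move=> hl i; have := hl (- delta_mx 0 i).
by rewrite h_axis dotNl dot_delta oppr_le0.
Qed.

Let ineq y1 y2 z1 z2 :
  (forall v, nonneg v -> pos (dot y1 v) `^ p + pos (dot y2 v) `^ p <=
                         pos (dot z1 v) `^ p + pos (dot z2 v) `^ p) ->
  h y1 `^ p + h y2 `^ p <= h z1 `^ p + h z2 `^ p.
Proof.
by have [vs vs0 vsh] := zonoidal_nonneg zh h_axis; exact: (limit_le4 vs0 vsh).
Qed.

Let pos0 : pos (0 : R) `^ p = 0.
Proof. by rewrite pos_id// powR0. Qed.

(** Changing signs in x can only decrease |<x,v>| when x and v are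
    nonnegative. *)
Lemma zonoid_flip_le s x : nonneg x ->
  h (flip s x) `^ p + h (- flip s x) `^ p <= h x `^ p.
Proof.
move=> x0; rewrite -[leRHS]addr0 (_ : 0 = h 0 `^ p); last by rewrite attained0 ?powR0.
apply: ineq => v v0; rewrite dotNl dot0l pos0 addr0.
rewrite (pos_id (dot_nonneg x0 v0)); apply: pos_pow_sym.
apply: (le_trans (ler_norm_sum _ _ _)); apply: ler_sum => i _.
by rewrite flipE !normrM normr_sign mul1r !ger0_norm.
Qed.

(** The p-th power is superadditive on the nonnegative reals. *)
Lemma zonoid_split_le i x : nonneg x ->
  h (axis_part i x) `^ p + h (x - axis_part i x) `^ p <= h x `^ p.
Proof.
move=> x0; rewrite -[leRHS]addr0 (_ : 0 = h 0 `^ p); last by rewrite attained0 ?powR0.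
apply: ineq => v v0; rewrite dot0l pos0 addr0.
have a0 : 0 <= dot (axis_part i x) v by rewrite dot_axis_part mulr_ge0.
have b0 : 0 <= dot (x - axis_part i x) v.
  by rewrite dot_off_axis sumr_ge0// => j _; rewrite mulr_ge0.
rewrite !pos_id ?(dot_nonneg x0)//.
apply: (le_trans (powR_superadd (ltW p1) a0 b0)).
by rewrite -dotDl addrC subrK.
Qed.

(** If a is the i-th term of <x,v> and b the sum of the others, then <flip1
    i x,v> = b - a, and |b - a|^p is at most max(a,b)^p, hence at most a^p
    + b^p. *)
Lemma zonoid_flip1_le i x : nonneg x ->
  h (flip1 i x) `^ p + h (- flip1 i x) `^ p <=
  h (axis_part i x) `^ p + h (x - axis_part i x) `^ p.
Proof.
move=> x0; apply: ineq => v v0; rewrite dotNl.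
have a0 : 0 <= dot (axis_part i x) v by rewrite dot_axis_part mulr_ge0.
have b0 : 0 <= dot (x - axis_part i x) v.
  by rewrite dot_off_axis sumr_ge0// => j _; rewrite mulr_ge0.
rewrite (pos_id a0) (pos_id b0) dot_flip1.
set a := dot (axis_part i x) v in a0 *; set b := dot (x - axis_part i x) v in b0 *.
have [ab|ba] := leP a b.
  apply: (@le_trans _ _ (b `^ p)); last by rewrite lerDr powR_ge0.
  by apply: pos_pow_sym; rewrite ger0_norm ?subr_ge0// gerBl.
apply: (@le_trans _ _ (a `^ p)); last by rewrite lerDl powR_ge0.
by apply: pos_pow_sym; rewrite ltr0_norm ?subr_lt0// opprB gerBl.
Qed.

Lemma wulff_pos_part x : h x <= h (pos_part x).
Proof.
have [l hl <-] := ah x; apply: le_trans (hl (pos_part x)).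
rewrite [x in leLHS]pos_part_sub dotDl dotNl gerDl oppr_le0.
by apply: dot_nonneg; [exact: pos_part_nonneg|exact: wulff_nonneg].
Qed.

Lemma additive_on_orthant :
  (forall i x, nonneg x ->
     h x `^ p = h (axis_part i x) `^ p + h (x - axis_part i x) `^ p) ->
  forall x, nonneg x -> h x `^ p = \sum_i (h (delta_mx 0 i) * x 0 i) `^ p.
Proof.
move=> hadd x x0.
pose T k : 'rV[R]_n := \row_i (if (i < k)%N then 0 else x 0 i).
have T0 k : nonneg (T k) by move=> i; rewrite mxE; case: ifP.
have step k : (k <= n)%N ->
    h x `^ p = \sum_(i < n | (i < k)%N) (h (delta_mx 0 i) * x 0 i) `^ p + h (T k) `^ p.
  elim: k => [|k IHk] kn.
    rewrite big_pred0 ?add0r => [|i]; last by rewrite ltn0.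
    by congr (h _ `^ p); apply/rowP => i; rewrite mxE ltn0.
  rewrite IHk; last exact: ltnW.
  pose i := Ordinal kn.
  rewrite [RHS](_ : _ = \sum_(i < n | (i < k)%N) (h (delta_mx 0 i) * x 0 i) `^ p +
      ((h (delta_mx 0 i) * x 0 i) `^ p + h (T k.+1) `^ p)); last first.
    rewrite (bigD1 i) /=; last exact: ltnSn.
    rewrite (eq_bigl (fun j : 'I_n => (j < k)%N)); first by ring.
    by move=> j; rewrite ltnS [RHS]ltn_neqAle andbC.
  congr (_ + _); rewrite (hadd i)//; congr (_ `^ p + h _ `^ p).
    by rewrite /axis_part attainedZ ?T0// mxE ltnn mulrC.
  apply/rowP => j; rewrite !mxE eqxx /= ltnn.
  have [->|ji] := eqVneq j i; first by rewrite /= ltnn ltnSn mulr1 subrr.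
  rewrite mulr0 subr0 [in RHS]ltnS [in RHS]leq_eqVlt (_ : (j == k :> nat) = false)//.
  by apply/negbTE; apply: contra ji => /eqP jk; apply/eqP/val_inj.
rewrite (step n)// (_ : T n = 0); last by apply/rowP => i; rewrite !mxE ltn_ord.
by rewrite attained0// powR0// addr0; apply: eq_bigl => i; rewrite ltn_ord.
Qed.

(** The body lies in the positive orthant, so that h x is at most h x+, where
    x+ and x- are the positive and negative parts of x. Conversely a support
    point l in the direction x+ is orthogonal to x-, which gives
    h x >= <x,l> = h x+: if <x-,l> were positive, h would grow linearly in t
    at x+ + t x-, whereas h^p grows only by a multiple of t^p. *)
Lemma additive_everywhere :
  (forall x, nonneg x -> h x `^ p = \sum_i (h (delta_mx 0 i) * x 0 i) `^ p) ->
  forall x, h x `^ p = \sum_i pos (h (delta_mx 0 i) * x 0 i) `^ p.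
Proof.
move=> hadd x; pose a i := h (delta_mx 0 i); have a0 i : 0 <= a i by exact: h_ge0.
have posM i (c : R) : pos (a i * c) = a i * pos c.
  have [c0|/ltW c0] := leP 0 c; first by rewrite !pos_id// mulr_ge0.
  by rewrite !pos_eq0 ?mulr0// mulr_ge0_le0.
suff -> : h x = h (pos_part x).
  rewrite hadd; last exact: pos_part_nonneg.
  by apply: eq_bigr => i _; rewrite mxE posM.
apply/le_anti/andP; split; first exact: wulff_pos_part.
set y := pos_part x; pose z := pos_part (- x).
have y0 : nonneg y by exact: pos_part_nonneg.
have z0 : nonneg z by exact: pos_part_nonneg.
have [l hl lE] := ah y.
have [hy0|hy0] := eqVneq (h y) 0; first by rewrite hy0.
have hy_gt0 : 0 < h y by rewrite lt_neqAle eq_sym hy0 h_ge0.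
have w0 : 0 <= dot z l by apply: dot_nonneg => //; exact: wulff_nonneg.
have [w_eq0|w_neq0] := eqVneq (dot z l) 0.
  rewrite -lE; apply: le_trans (hl x).
  by rewrite [x in leRHS]pos_part_sub dotDl dotNl -/z w_eq0 subr0.
exfalso.
have w_gt0 : 0 < dot z l by rewrite lt_neqAle eq_sym w_neq0.
have split_yz t : 0 <= t -> h (y + t *: z) `^ p = h y `^ p + t `^ p * h z `^ p.
  move=> t0; have tz : nonneg (t *: z) by move=> i; rewrite mxE mulr_ge0.
  rewrite !hadd//; last by move=> i; rewrite mxE addr_ge0.
  rewrite mulr_sumr -big_split; apply: eq_bigr => i _ /=.
  rewrite !mxE; have [xi|/ltW xi] := leP 0 (x 0 i).
    by rewrite [pos (- _)]pos_eq0 ?oppr_le0// !mulr0 addr0 powR0// mulr0 addr0.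
  rewrite [pos (x 0 i)]pos_eq0// mulr0 add0r powR0// add0r.
  by rewrite mulrCA [LHS]powRM// mulr_ge0 ?pos_ge0.
pose b := p * h y `^ (p - 1) * dot z l.
have b0 : 0 < b by rewrite !mulr_gt0// powR_gt0.
have pm1 : 0 < p - 1 by rewrite subr_gt0.
pose hz := h z `^ p; have hz0 : 0 <= hz by exact: powR_ge0.
pose kap := b / (hz + 1).
have kap0 : 0 < kap by rewrite divr_gt0// ltr_wpDl.
(* For this t the second-order term t^p hz is less than the linear gain t
   b. *)
pose t := kap `^ (p - 1)^-1.
have t0 : 0 < t by exact: powR_gt0.
have tk : t `^ (p - 1) = kap by rewrite powRVK ?gt_eqF// ltW.
have lt : h y + t * dot z l <= h (y + t *: z).
  by rewrite -lE -dotZl -dotDl; exact: hl.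
have lt0 : 0 <= h y + t * dot z l by rewrite addr_ge0// mulr_ge0// ltW.
have := le_powR p_ge0 lt0 lt; rewrite (split_yz t (ltW t0)) => {}lt.
have := powR_tangent p1 lt0 (h_ge0 y) => tan.
have : t * b <= t `^ p * hz.
  move: lt tan; rewrite /b -/hz addrAC subrr add0r (mulrCA _ t); lra.
rewrite -(mulr_powRB1 (ltW t0) p0) tk -mulrA ler_pM2l// => bk.
have : b < b; last by rewrite ltxx.
apply: (le_lt_trans bk); rewrite /kap -mulrA gtr_pMr// ltr_pdivrMl ?mulr1 ?ltrDl//.
by rewrite ltr_wpDl.
Qed.

(** If no change of one sign makes the sum of the two powers less than the
    power of h x, then zonoid_split_le and zonoid_flip1_le are equalities,
    so that h^p is additive over the coordinates. *)
Lemma zonoid_dichotomy :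
  (forall x, h x `^ p = \sum_i pos (h (delta_mx 0 i) * x 0 i) `^ p) \/
  (exists i, exists2 x, nonneg x &
     h (flip1 i x) `^ p + h (- flip1 i x) `^ p < h x `^ p).
Proof.
have [?|noflip] := pselect (exists i, exists2 x, nonneg x &
     h (flip1 i x) `^ p + h (- flip1 i x) `^ p < h x `^ p); first by right.
left; apply: additive_everywhere; apply: additive_on_orthant => i x x0.
apply/le_anti; rewrite zonoid_split_le// andbT.
apply: le_trans (zonoid_flip1_le i x0).
by rewrite leNgt; apply/negP => hlt; apply: noflip; exists i, x.
Qed.

End ZonoidInOrthant.
End PositiveZonoids.

(** * The conjugate norm *)

(** Sealed, because only the algebraic identities of these real powers matter. *)
HB.lock Definition conj_exp (R : realType) (p : R) : R := p / (p - 1).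

HB.lock Definition qnorm (R : realType) (n : nat) (q : R) (y : 'rV[R]_n) : R :=
  (\sum_i `|y 0 i| `^ q) `^ q^-1.

Section ConjugateNorms.
Context {R : realType} {n : nat}.
Variable p : R.
Hypothesis p1 : 1 < p.
Implicit Types (x y v l k : 'rV[R]_n) (h : 'rV[R]_n -> R).

Let p0 : 0 < p. Proof. exact: lt_trans p1. Qed.
Let p_ge0 : 0 <= p. Proof. exact: ltW. Qed.
Let pneq0 : p != 0. Proof. by rewrite gt_eqF. Qed.
Let pm1 : 0 < p - 1. Proof. by rewrite subr_gt0. Qed.

Local Notation q := (conj_exp p).
Local Notation qnorm := (qnorm q).

Lemma conj_exp_gt1 : 1 < q.
Proof. by rewrite conj_exp.unlock ltr_pdivlMr// mul1r ltrBlDr ltrDl. Qed.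

Let q1 := conj_exp_gt1.
Let q0 : 0 < q. Proof. exact: lt_trans q1. Qed.
Let q_ge0 : 0 <= q. Proof. exact: ltW. Qed.
Let qneq0 : q != 0. Proof. by rewrite gt_eqF. Qed.

Lemma conj_expV : p^-1 + q^-1 = 1.
Proof. by rewrite conj_exp.unlock; have [] := conjugate_exp p1. Qed.

Lemma conj_expM : (q - 1) * p = q.
Proof. by rewrite conj_exp.unlock; field; rewrite subr_eq0 gt_eqF. Qed.

Lemma conj_expM1 : (p - 1) * (q - 1) = 1.
Proof. by rewrite conj_exp.unlock; field; rewrite subr_eq0 gt_eqF. Qed.

Lemma conj_expP : (p - 1) * q = p.
Proof. by rewrite conj_exp.unlock; field; rewrite subr_eq0 gt_eqF. Qed.

Let qsum_ge0 y : 0 <= \sum_i `|y 0 i| `^ q.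
Proof. by apply: sumr_ge0 => i _; exact: powR_ge0. Qed.

Lemma qnorm_ge0 y : 0 <= qnorm y.
Proof. by rewrite qnorm.unlock powR_ge0. Qed.

Lemma qnormX y : qnorm y `^ q = \sum_i `|y 0 i| `^ q.
Proof. by rewrite qnorm.unlock powRVK. Qed.

Lemma qnormZ c y : 0 <= c -> qnorm (c *: y) = c * qnorm y.
Proof.
move=> c0; apply: (powR_inj q0); rewrite ?mulr_ge0 ?qnorm_ge0//.
rewrite (powRM _ c0 (qnorm_ge0 y)).
rewrite (qnormX (c *: y)) (qnormX y) mulr_sumr; apply: eq_bigr => i _.
by rewrite mxE normrM (ger0_norm c0) powRM.
Qed.

Lemma le_qnorm x y : (forall i, `|x 0 i| <= `|y 0 i|) -> qnorm x <= qnorm y.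
Proof.
move=> xy; rewrite -(powRK qneq0 (qnorm_ge0 x)) -(powRK qneq0 (qnorm_ge0 y)).
rewrite (qnormX x) (qnormX y).
apply: le_powR; rewrite ?invr_ge0//.
by apply: ler_sum => i _; rewrite le_powR.
Qed.

Lemma coord_le_qnorm y i : `|y 0 i| <= qnorm y.
Proof.
rewrite -(powRK qneq0 (normr_ge0 _)) -(powRK qneq0 (qnorm_ge0 y)) qnormX.
apply: le_powR; rewrite ?invr_ge0 ?powR_ge0//.
by rewrite (bigD1 i)//= lerDl sumr_ge0// => j _; exact: powR_ge0.
Qed.

(** The outer normal at y of a sphere of qnorm, of norm 1 for the exponent p. *)
Definition dual y : 'rV[R]_n := \row_i ((y 0 i / qnorm y) `^ (q - 1)).

Lemma dual_nonneg y : nonneg (dual y).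
Proof. by move=> i; rewrite mxE powR_ge0. Qed.

Lemma dual_pow y : nonneg y -> 0 < qnorm y -> \sum_i dual y 0 i `^ p = 1.
Proof.
move=> y0 N0; have Nq : qnorm y `^ q != 0 by rewrite gt_eqF// powR_gt0.
rewrite -[RHS](mulfV Nq).
rewrite {1}qnormX mulr_suml; apply: eq_bigr => i _.
rewrite mxE -powRrM conj_expM (powRM _ (y0 i)) ?invr_ge0 ?qnorm_ge0// powRV//.
by rewrite ger0_norm.
Qed.

Lemma dot_dual y : nonneg y -> 0 < qnorm y -> dot (dual y) y = qnorm y.
Proof.
move=> y0 N0; rewrite -[RHS]mulr1 -(dual_pow y0 N0) mulr_sumr; apply: eq_bigr => i _.
rewrite !mxE -powRrM conj_expM.
have yN : 0 <= y 0 i / qnorm y by rewrite divr_ge0 ?qnorm_ge0.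
rewrite -[in RHS](mulr_powRB1 yN q0) mulrA [qnorm y * _]mulrC divfK ?gt_eqF//.
by rewrite mulrC.
Qed.

Let hoelder_normalized x y A B : 0 < A -> 0 < B ->
  A `^ p = \sum_i `|x 0 i| `^ p -> B `^ q = \sum_i `|y 0 i| `^ q ->
  \sum_i `|x 0 i| * `|y 0 i| <= A * B.
Proof.
move=> A0 B0 Ap Bq; have AB : 0 < A * B by exact: (mulr_gt0 A0 B0).
have iA : 0 <= A^-1 by rewrite invr_ge0 ltW.
have iB : 0 <= B^-1 by rewrite invr_ge0 ltW.
rewrite -[leRHS]mulr1 -(ler_pdivrMl _ _ AB) mulr_sumr.
apply: (@le_trans _ _ (\sum_i (`|x 0 i| `^ p / A `^ p / p + `|y 0 i| `^ q / B `^ q / q))).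
  apply: ler_sum => i _.
  have := conjugate_powR (mulr_ge0 (normr_ge0 (x 0 i)) iA)
    (mulr_ge0 (normr_ge0 (y 0 i)) iB) p0 q0 conj_expV.
  rewrite (powRM _ (normr_ge0 (x 0 i)) iA) (powRM _ (normr_ge0 (y 0 i)) iB).
  rewrite (powRV _ A0) (powRV _ B0).
  by apply: le_trans; rewrite invfM mulrACA [A^-1 * _]mulrC [B^-1 * _]mulrC.
rewrite big_split /= -!mulr_suml -Ap -Bq.
have Ap0 : A `^ p != 0 by rewrite gt_eqF// powR_gt0.
have Bq0 : B `^ q != 0 by rewrite gt_eqF// powR_gt0.
by rewrite (mulfV Ap0) (mulfV Bq0) !mul1r conj_expV.
Qed.

Lemma hoelder_sum x y :
  \sum_i `|x 0 i| * `|y 0 i| <= (\sum_i `|x 0 i| `^ p) `^ p^-1 * qnorm y.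
Proof.
have S0 : 0 <= \sum_i `|x 0 i| `^ p by apply: sumr_ge0 => i _; exact: powR_ge0.
have := powRVK pneq0 S0; have := powR_ge0 (\sum_i `|x 0 i| `^ p) p^-1.
move: (_ `^ p^-1) => A A0 Ap.
have coordA i : `|x 0 i| <= A.
  rewrite -(powRK pneq0 (normr_ge0 (x 0 i))) -(powRK pneq0 A0) Ap.
  apply: le_powR; rewrite ?invr_ge0 ?powR_ge0//.
  by rewrite (bigD1 i)//= lerDl sumr_ge0// => j _; exact: powR_ge0.
have [A_eq0|A_neq0] := eqVneq A 0.
  rewrite A_eq0 mul0r big1// => i _.
  by have := coordA i; rewrite A_eq0 normr_le0 => /eqP ->; rewrite normr0 mul0r.
have [N_eq0|N_neq0] := eqVneq (qnorm y) 0.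
  rewrite N_eq0 mulr0 big1// => i _.
  by have := coord_le_qnorm y i; rewrite N_eq0 normr_le0 => /eqP ->; rewrite normr0 mulr0.
apply: hoelder_normalized => //; last exact: qnormX.
  by rewrite lt_neqAle eq_sym A_neq0.
by rewrite lt_neqAle eq_sym N_neq0 qnorm_ge0.
Qed.

Definition quarter_ball : set 'rV[R]_n := [set y | nonneg y /\ qnorm y <= 1].

Lemma pos_norm (t : R) : pos t <= `|t|.
Proof. by rewrite ge_max ler_norm normr_ge0. Qed.

Lemma dot_quarter_ball x k : quarter_ball k ->
  dot x k <= (\sum_i pos (x 0 i) `^ p) `^ p^-1.
Proof.
move=> [k0 k1]; apply: (@le_trans _ _ (\sum_i `|pos_part x 0 i| * `|k 0 i|)).
  apply: ler_sum => i _; rewrite mxE (ger0_norm (pos_ge0 _)) (ger0_norm (k0 i)).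
  by rewrite ler_wpM2r// le_pos.
apply: (le_trans (hoelder_sum _ _)).
rewrite (eq_bigr (fun i => pos (x 0 i) `^ p)); last first.
  by move=> i _; rewrite mxE (ger0_norm (pos_ge0 _)).
by rewrite ler_piMr// powR_ge0.
Qed.

End ConjugateNorms.

(** * The perturbed body and its symmetrization *)

Section Perturbation.
Context {R : realType} {n : nat}.
Variable p : R.
Hypothesis p1 : 1 < p.
Variable h : 'rV[R]_n -> R.
Hypothesis ah : attained h.
Hypothesis h_ge0 : forall x, 0 <= h x.
Implicit Types (x y v l k : 'rV[R]_n) (eps : R).

Local Notation q := (conj_exp p).
Local Notation qnorm := (qnorm q).

Let p0 : 0 < p. Proof. exact: lt_trans p1. Qed.
Let p_ge0 : 0 <= p. Proof. exact: ltW. Qed.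
Let pneq0 : p != 0. Proof. by rewrite gt_eqF. Qed.
Let q1 : 1 < q. Proof. exact: conj_exp_gt1. Qed.
Let q0 : 0 < q. Proof. exact: lt_trans q1. Qed.
Let q_ge0 : 0 <= q. Proof. exact: ltW. Qed.
Let qneq0 : q != 0. Proof. by rewrite gt_eqF. Qed.
Let qm1 : 0 < q - 1. Proof. by rewrite subr_gt0. Qed.

Definition gpow x : R := h x `^ p.
Definition gsym x : R := gpow x + gpow (- x).

Definition pos_sum x : R := \sum_i pos (x 0 i) `^ p.
Definition abs_sum x : R := \sum_i `|x 0 i| `^ p.

(** The support functions of the perturbed body and of its symmetrization, when
    the vectors u_i are the canonical basis. *)
Definition pert_support eps x : R := (pos_sum x + eps * gpow x) `^ p^-1.
Definition sym_support eps x : R := (abs_sum x + eps * gsym x) `^ p^-1.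

Definition pert_body eps := wulff (pert_support eps).
Definition sym_body eps := wulff (sym_support eps).

Lemma gpow_ge0 x : 0 <= gpow x.
Proof. exact: powR_ge0. Qed.

Lemma gsym_ge0 x : 0 <= gsym x.
Proof. by rewrite addr_ge0 ?gpow_ge0. Qed.

Lemma pos_sum_ge0 x : 0 <= pos_sum x.
Proof. by apply: sumr_ge0 => i _; exact: powR_ge0. Qed.

Lemma abs_sum_ge0 x : 0 <= abs_sum x.
Proof. by apply: sumr_ge0 => i _; exact: powR_ge0. Qed.

Lemma pert_supportX eps x : 0 <= eps ->
  pert_support eps x `^ p = pos_sum x + eps * gpow x.
Proof. by move=> e0; rewrite powRVK// addr_ge0 ?pos_sum_ge0// mulr_ge0 ?gpow_ge0. Qed.

Lemma pos_powN (t : R) : pos t `^ p + pos (- t) `^ p = `|t| `^ p.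
Proof.
have [t0|/ltW t0] := leP 0 t.
  by rewrite pos_id// ger0_norm// pos_eq0 ?oppr_le0// powR0// addr0.
by rewrite pos_eq0// powR0// add0r pos_id ?oppr_ge0// ler0_norm.
Qed.

Lemma sym_supportX eps x : 0 <= eps ->
  sym_support eps x `^ p = pert_support eps x `^ p + pert_support eps (- x) `^ p.
Proof.
move=> e0; rewrite [LHS]powRVK//; last first.
  by rewrite addr_ge0 ?abs_sum_ge0// mulr_ge0 ?gsym_ge0.
apply: etrans _ (esym (congr2 +%R (pert_supportX x e0) (pert_supportX (- x) e0))).
rewrite addrACA -mulrDr; congr (_ + _).
by rewrite -big_split; apply: eq_bigr => i _ /=; rewrite mxE pos_powN.
Qed.

Lemma pert_support_ge0 eps x : 0 <= pert_support eps x.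
Proof. exact: powR_ge0. Qed.

(** The L_p-sum is the union of the Minkowski sums with such weights; this
    inclusion is Hoelder's inequality. *)
Lemma pert_body_comb eps alpha beta k l :
  0 <= eps -> 0 <= alpha -> 0 <= beta -> alpha `^ q + beta `^ q <= 1 ->
  quarter_ball p k -> wulff h l ->
  pert_body eps (alpha *: k + (beta * eps `^ p^-1) *: l).
Proof.
move=> e0 a0 b0 ab1 kB hl x.
rewrite dotDr !dotZr.
pose A := pos_sum x `^ p^-1; have A0 : 0 <= A by exact: powR_ge0.
pose E := eps `^ p^-1 * h x; have E0 : 0 <= E by rewrite mulr_ge0 ?powR_ge0.
have e1 : alpha * dot x k <= alpha * A.
  by rewrite ler_wpM2l//; exact: dot_quarter_ball.
have e2 : beta * eps `^ p^-1 * dot x l <= beta * E.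
  by rewrite -mulrA ler_wpM2l// ler_wpM2l ?powR_ge0.
have qp : q^-1 + p^-1 = 1 by rewrite addrC conj_expV.
have e3 := hoelder2 a0 b0 A0 E0 q0 p0 qp.
apply: (le_trans (lerD e1 e2)); apply: (le_trans e3).
rewrite /A powRVK ?pos_sum_ge0// /E powRM ?powR_ge0// powRVK//.
rewrite ler_piMl ?powR_ge0//.
have := le_powR (p := q^-1) _ _ ab1; rewrite powR1; apply.
  by rewrite invr_ge0.
by rewrite addr_ge0 ?powR_ge0.
Qed.

Lemma quarter_ball_pert eps k : 0 <= eps -> quarter_ball p k -> pert_body eps k.
Proof.
move=> e0 kB; have [l hl _] := ah 0.
have := @pert_body_comb eps 1 0 k l e0 ler01 (lexx _).
rewrite powR1 powR0// addr0 mul0r scale0r scale1r addr0; exact.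
Qed.

Lemma flip_dot (s : 'I_n -> bool) x y : dot (flip s x) (flip s y) = dot x y.
Proof.
by apply: eq_bigr => i _; rewrite !flipE mulrACA -signr_addb addbb mul1r.
Qed.

Lemma abs_sum_flip (s : 'I_n -> bool) x : nonneg x -> abs_sum (flip s x) = pos_sum x.
Proof.
move=> x0; apply: eq_bigr => i _.
by rewrite flipE normrM normr_sign mul1r pos_id// ger0_norm.
Qed.

Lemma pos_sum_nonneg x : nonneg x -> pos_sum x = \sum_i x 0 i `^ p.
Proof. by move=> x0; apply: eq_bigr => i _; rewrite pos_id. Qed.

(** The constraint of the symmetrized body in the direction dual p y, with
    the p-th root bounded by its tangent at 1. *)
Lemma dual_le (s : 'I_n -> bool) eps y z c : 0 <= eps -> nonneg y -> 0 < qnorm y ->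
  sym_body eps (flip s z) -> gsym (flip s (dual p y)) <= c ->
  dot (dual p y) z <= 1 + eps * c / p.
Proof.
move=> e0 y0 N0 Wz Gc; rewrite -(flip_dot s); apply: (le_trans (Wz _)).
have X0 := @dual_nonneg _ _ p y.
rewrite /sym_support abs_sum_flip// pos_sum_nonneg// dual_pow//.
set t := eps * _; have t0 : 0 <= t by rewrite mulr_ge0 ?gsym_ge0.
have S0 : 0 <= 1 + t by rewrite addr_ge0.
have := powR_tangent p1 (powR_ge0 (1 + t) p^-1) ler01.
rewrite powRVK// !powR1 mulr1 => tan.
rewrite -(ler_pM2l p0) mulrDr mulr1 [p * (_ / p)]mulrCA mulfV// mulr1.
have : t <= eps * c by rewrite ler_wpM2l.
by lra.
Qed.

Definition gbound : R := 2 * (slope h * n%:R) `^ p.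

Lemma gbound_ge0 : 0 <= gbound.
Proof. by rewrite mulr_ge0 ?powR_ge0. Qed.

Lemma gsym_dual_le (s : 'I_n -> bool) y : nonneg y -> 0 < qnorm y ->
  gsym (flip s (dual p y)) <= gbound.
Proof.
move=> y0 N0.
have c1 i : `|dual p y 0 i| <= 1.
  rewrite ger0_norm ?dual_nonneg// mxE.
  have one : (1 : R) = 1 `^ (q - 1) by rewrite powR1.
  rewrite [leRHS]one.
  apply: le_powR; [exact: ltW|by rewrite divr_ge0// ltW|].
  by rewrite ler_pdivrMr// mul1r -[leLHS]ger0_norm// coord_le_qnorm.
have n1 : norm1 (flip s (dual p y)) <= n%:R.
  rewrite -[X in X%:R]card_ord -sumr_const; apply: ler_sum => i _.
  by rewrite flipE normrM normr_sign mul1r.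
have n1N : norm1 (- flip s (dual p y)) <= n%:R.
  by apply: le_trans n1; apply: ler_sum => i _; rewrite mxE normrN.
rewrite /gsym /gbound mulrDl mul1r lerD//; apply: le_powR => //.
  by apply: (le_trans (le_slope ah _)); rewrite ler_wpM2l ?slope_ge0.
by apply: (le_trans (le_slope ah _)); rewrite ler_wpM2l ?slope_ge0.
Qed.

Lemma sym_body_qnorm (s : 'I_n -> bool) eps y : 0 <= eps -> nonneg y ->
  sym_body eps (flip s y) -> qnorm y <= 1 + eps * gbound.
Proof.
move=> e0 y0 Wy; have g0 := gbound_ge0.
have [N0|N0] := leP (qnorm y) 0.
  by apply: (le_trans N0); rewrite addr_ge0// mulr_ge0.
have := dual_le e0 y0 N0 Wy (gsym_dual_le s y0 N0).
rewrite dot_dual// => h1; apply: (le_trans h1).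
rewrite lerD2l ler_pdivrMr// ler_peMr//; [exact: mulr_ge0|exact: ltW].
Qed.

End Perturbation.

(** * Measurability and volume of cones *)

Section WulffMeasurable.
Context {R : realType} {n : nat}.
Implicit Types (x y : 'rV[R]_n) (f : 'rV[R]_n -> R).

Lemma rational_near x e : 0 < e ->
  exists r : 'rV[rat]_n, forall i, `|x 0 i - ratr (r 0 i)| <= e.
Proof.
move=> e0.
have near_i i : {a : rat | `|x 0 i - ratr a| <= e}.
  apply: cid; have [a] := @rat_in_itvoo R (x 0 i) (x 0 i + e) ltac:(by rewrite ltrDl).
  by rewrite in_itv /= => /andP[a1 a2]; exists a; rewrite ler_norml; apply/andP; split; lra.
by exists (\row_i sval (near_i i)) => i; rewrite mxE; exact: (svalP (near_i i)).
Qed.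

Lemma borel_halfspace x c : borel [set y : 'rV[R]_n | dot x y <= c].
Proof.
rewrite (_ : [set y | _] = (fun y : @borel_rV R n => dot x y) @^-1` `]-oo, c]%classic).
  rewrite /borel -[X in measurable X]setTI.
  exact: (measurable_dot x measurableT (measurable_itv `]-oo, c])).
by apply/seteqP; split=> y /=; rewrite in_itv.
Qed.

(** The support function is continuous, so that the rational directions are
    enough to cut out the body. *)
Lemma borel_wulff f : attained f -> borel (wulff f).
Proof.
move=> af.
pose row (r : 'rV[rat]_n) : 'rV[R]_n := \row_i ratr (r 0 i).
pose A k : set 'rV[R]_n :=
  if @unpickle 'rV[rat]_n k is Some r then [set y | dot (row r) y <= f (row r)] else setT.
rewrite (_ : wulff f = \bigcap_k A k).
  apply: bigcapT_measurable => k; rewrite /A; case: unpickle => [r|]; last exact: measurableT.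
  exact: borel_halfspace.
apply/seteqP; split=> y fy; first by move=> k _; rewrite /A; case: unpickle => [r|]//; exact: fy.
have fr r : dot (row r) y <= f (row r).
  by have := fy (pickle r) I; rewrite /A pickleK.
move=> x; apply/ler_addgt0Pr => e e0.
have s0 := slope_ge0 f.
pose C := slope f + norm1 y; have C0 : 0 <= C by rewrite addr_ge0 ?norm1_ge0.
have n0 : 0 <= n%:R :> R by [].
pose d := e / (C * n%:R + 1).
have D0 : 0 < C * n%:R + 1 by rewrite ltr_wpDl// mulr_ge0.
have d0 : 0 < d by rewrite divr_gt0.
have [r rx] := rational_near x d0.
have nr : norm1 (x - row r) <= d * n%:R.
  rewrite mulr_natr -[X in _ *+ X]card_ord -sumr_const; apply: ler_sum => i _.
  by rewrite !mxE.
have nr' : norm1 (row r - x) <= d * n%:R.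
  by apply: le_trans nr; apply: ler_sum => i _; rewrite !mxE distrC.
have h1 := slope_lipschitz af (row r) x.
have h2 : dot x y <= dot (row r) y + d * norm1 y.
  rewrite -[x in dot x y](subrK (row r)) addrC dotDl lerD2l dotC.
  by apply: dot_le_norm1 => i; rewrite !mxE.
have h3 : slope f * norm1 (row r - x) <= slope f * (d * n%:R) by rewrite ler_wpM2l.
have [n_eq0|n_gt0] := posnP n.
  have no_i (i : 'I_n) : False by have := leq_ltn_trans (leq0n i) (ltn_ord i); rewrite n_eq0.
  have y0 : norm1 y = 0 by rewrite /norm1 big1// => i; case: (no_i i).
  have x0 : norm1 (row r - x) = 0 by rewrite /norm1 big1// => i; case: (no_i i).
  by have := fr r; move: h1 h2; rewrite y0 x0 !mulr0; clear no_i; lra.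
have n1 : 1 <= n%:R :> R by rewrite ler1n.
have h4 : d * norm1 y <= norm1 y * (d * n%:R).
  by rewrite mulrC ler_wpM2l ?norm1_ge0// ler_peMr// ltW.
have h5 : slope f * (d * n%:R) + norm1 y * (d * n%:R) <= e.
  have dE : d * (C * n%:R + 1) = e by rewrite /d divfK// gt_eqF.
  by rewrite -mulrDl -/C -[leRHS]dE mulrCA ler_wpM2l ?lerDl// ltW.
by have := fr r; lra.
Qed.

Lemma wulff_cube f : wulff f `<=` cube (slope f).
Proof. by move=> y fy i; rewrite -ler_norml; exact: wulff_coord. Qed.

Lemma lebesgue_rV_fin (A : set 'rV[R]_n) r : borel A -> 0 <= r -> A `<=` cube r ->
  exists2 a, 0 <= a & lebesgue_rV A = a%:E.
Proof.
move=> mA r0 Ar.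
have := le_lebesgue_rV mA (borel_box _ _) Ar; rewrite lebesgue_cube//.
have := lebesgue_rV_ge0 A.
by case: (lebesgue_rV A) => [a| |]//; rewrite ?lee_fin => a0 _; exists a.
Qed.

Lemma lebesgue_wulff_fin f : attained f -> exists2 a, 0 <= a & lebesgue_rV (wulff f) = a%:E.
Proof.
move=> af; apply: (lebesgue_rV_fin _ (slope_ge0 f)); first exact: borel_wulff.
exact: wulff_cube.
Qed.

End WulffMeasurable.

Section Cones.
Context {R : realType} {n : nat}.
Variable p : R.
Hypothesis p1 : 1 < p.
Implicit Types (x y : 'rV[R]_n) (C : set 'rV[R]_n) (r : R).

Local Notation q := (conj_exp p).
Local Notation qnorm := (qnorm q).

Lemma measurable_qnorm :
  measurable_fun setT (fun y : @borel_rV R n => qnorm y : measurableTypeR R).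
Proof.
rewrite (_ : (fun y => _) = (fun y : 'rV[R]_n => (\sum_i `|y 0 i| `^ q) `^ q^-1)); last first.
  by apply/funext => y; rewrite qnorm.unlock.
apply: (measurableT_comp (measurable_powR q^-1)).
apply: (@measurable_sum _ _ _ _ _ _ (fun i (y : @borel_rV R n) => `|y 0 i| `^ q)) => i.
apply: (measurableT_comp (measurable_powR q)).
exact: (measurableT_comp (@normr_measurable R setT) (measurable_coord i)).
Qed.

Definition conic C := forall c y, 0 < c -> C y -> C (c *: y).

Definition qsector C r : set 'rV[R]_n := [set y | [/\ nonneg y, C y & qnorm y <= r]].

Lemma borel_qsector C r : borel C -> borel (qsector C r).
Proof.
move=> mC; rewrite (_ : qsector C r = @nonneg R n `&` (C `&`
    (fun y : @borel_rV R n => qnorm y) @^-1` `]-oo, r]%classic)); last first.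
  by apply/seteqP; split=> y; [case=> *; do ?split => //=; rewrite in_itv|
    case=> ? [? /=]; rewrite in_itv].
apply: borel_setI; first exact: borel_nonneg.
apply: borel_setI => //.
rewrite /borel -[X in measurable X]setTI.
exact: (measurable_qnorm measurableT (measurable_itv `]-oo, r])).
Qed.

Lemma qsector_cube C r : qsector C r `<=` cube r.
Proof.
move=> y [_ _ yr] i; rewrite -ler_norml; apply: le_trans yr.
exact: coord_le_qnorm.
Qed.

Lemma lebesgue_qsector C r : borel C -> conic C -> 0 < r ->
  lebesgue_rV (qsector C r) = ((r ^+ n)%:E * lebesgue_rV (qsector C 1))%E.
Proof.
move=> mC cC r0; have rV0 : 0 < r^-1 by rewrite invr_gt0.
rewrite (_ : qsector C r = [set y | qsector C 1 (r^-1 *: y)]).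
  by rewrite lebesgue_dilate ?invr_gt0//; [rewrite exprVn invrK|exact: borel_qsector].
apply/seteqP; split=> y [y0 Cy yr] /=.
  split; [by move=> i; rewrite mxE mulr_ge0// ltW|exact: cC|].
  by rewrite (qnormZ p1 _ (ltW rV0)) mulrC ler_pdivrMr// mul1r.
have yE : y = r *: (r^-1 *: y) by rewrite scalerA mulfV ?gt_eqF// scale1r.
split.
- by move=> i; have := y0 i; rewrite mxE pmulr_rge0.
- by rewrite yE; exact: cC.
by move: yr; rewrite (qnormZ p1 _ (ltW rV0)) mulrC ler_pdivrMr// mul1r.
Qed.

Definition qshell C r1 r2 : set 'rV[R]_n := qsector C r2 `\` qsector C r1.

Lemma lebesgue_qshell C r1 r2 a : borel C -> conic C -> 0 < r1 -> r1 <= r2 ->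
  lebesgue_rV (qsector C 1) = a%:E ->
  lebesgue_rV (qshell C r1 r2) = ((r2 ^+ n - r1 ^+ n) * a)%:E.
Proof.
move=> mC cC r10 r12 aE; have r20 : 0 < r2 by exact: lt_le_trans r12.
have m1 := borel_qsector r1 mC; have m2 := borel_qsector r2 mC.
have sub : qsector C r1 `<=` qsector C r2.
  by move=> y [? ? yr]; split=> //; exact: le_trans r12.
have mS : borel (qshell C r1 r2) by exact: borel_setD.
have := lebesgue_rV_disjoint m1 mS (setDIK _ _).
rewrite (setDUK sub) (lebesgue_qsector mC cC r10) (lebesgue_qsector mC cC r20) aE -!EFinM.
case: (lebesgue_rV (qshell C r1 r2)) => [s||]//.
by rewrite -EFinD => -[] h; congr EFin; lra.
Qed.

End Cones.

(** * Zonoids that leave the positive orthant *)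

Lemma near_powR_lt (R : realType) (r c : R) : 0 < r -> 0 < c ->
  \forall e \near 0^'+, e `^ r < c.
Proof. by move=> r0 c0; exact: (cvgr_lt _ (powR_cvg0 r0)). Qed.

(** The left-hand side is convex in e, so that it lies below its chord over
    [0, 1]. *)
Lemma bernoulli_chord (R : realType) (n : nat) (c e : R) : 0 <= c -> 0 <= e <= 1 ->
  (1 + e * c) ^+ n <= 1 + e * ((1 + c) ^+ n - 1).
Proof.
move=> c0 /andP[e0 e1]; elim: n => [|n IHn]; first by rewrite !expr0 subrr mulr0 addr0.
have c1 : 1 <= (1 + c) ^+ n by rewrite exprn_ege1// lerDl.
have ec0 : 0 <= e * c by rewrite mulr_ge0.
have ec : 0 <= 1 + e * c by rewrite addr_ge0.
rewrite !exprS; apply: (le_trans (ler_wpM2l ec IHn)).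
move: ((1 + c) ^+ n) c1 => X X1.
have X0 : 0 <= X - 1 by rewrite subr_ge0.
have h1 : e * c * (e * (X - 1)) <= e * c * (X - 1) by rewrite ler_wpM2l// ler_piMl.
rewrite -subr_ge0 (_ : _ - _ = e * c * (X - 1) - e * c * (e * (X - 1))) ?subr_ge0//.
by ring.
Qed.

Section OutsideOrthant.
Context {R : realType} {n : nat}.
Variable p : R.
Hypothesis p1 : 1 < p.
Variable h : 'rV[R]_n -> R.
Hypothesis ah : attained h.
Hypothesis h_ge0 : forall x, 0 <= h x.
Hypothesis apert : forall eps, 0 < eps -> attained (pert_support p h eps).
Hypothesis asym : forall eps, 0 < eps -> attained (sym_support p h eps).
Implicit Types (x y v l k : 'rV[R]_n) (eps : R).

Local Notation q := (conj_exp p).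
Local Notation qnorm := (qnorm q).

Let p0 : 0 < p. Proof. exact: lt_trans p1. Qed.
Let q1 : 1 < q. Proof. exact: conj_exp_gt1. Qed.
Let q0 : 0 < q. Proof. exact: lt_trans q1. Qed.
Let qneq0 : q != 0. Proof. by rewrite gt_eqF. Qed.

Lemma quarter_ballE : quarter_ball p = qsector p setT 1 :> set 'rV[R]_n.
Proof. by apply/seteqP; split=> y; [case=> *; split|case=> *; split]. Qed.

Lemma borel_quarter_ball : borel (quarter_ball p : set 'rV[R]_n).
Proof. by rewrite quarter_ballE; apply: borel_qsector => //; exact: measurableT. Qed.

Lemma quarter_ball_cube : (quarter_ball p : set 'rV[R]_n) `<=` cube 1.
Proof. by rewrite quarter_ballE; exact: qsector_cube. Qed.

(** One of the 2^n pieces of the symmetrized body, reflected into the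
    positive orthant. *)
Definition sym_cell eps (s : 'I_n -> bool) : set 'rV[R]_n :=
  [set x | nonneg x /\ sym_body p h eps (flip s x)].

Lemma borel_sym_cell eps s : 0 < eps -> borel (sym_cell eps s).
Proof.
move=> e0; apply: borel_setI; first exact: borel_nonneg.
by apply: (borel_preimage (measurable_flip s)); apply: borel_wulff; exact: asym.
Qed.

Lemma small_coord_quarter_ball k : (forall j, 0 <= k 0 j <= n%:R^-1) -> quarter_ball p k.
Proof.
move=> kn; split; first by move=> j; have /andP[] := kn j.
rewrite -(powRK qneq0 (qnorm_ge0 p k)) -(powRK qneq0 ler01).
apply: le_powR; rewrite ?invr_ge0 ?powR_ge0// ?(ltW q0)// qnormX// powR1.
apply: (@le_trans _ _ (\sum_(i < n) n%:R^-1)); last first.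
  rewrite sumr_const card_ord -[leLHS]mulr_natr.
  by have [->|n0] := eqVneq (n%:R : R) 0; rewrite ?mulr0// mulVf.
apply: ler_sum => j _; have /andP[k0 k1] := kn j; rewrite ger0_norm//.
have [kj0|kj0] := eqVneq (k 0 j) 0; first by rewrite kj0 powR0// invr_ge0.
apply: le_trans k1; apply: ge1r_powR; last exact: ltW.
rewrite lt_neqAle eq_sym kj0 k0 /=; have /andP[_ k1] := kn j; apply: (le_trans k1).
have n0 : (0 < n)%N by exact: leq_ltn_trans (leq0n j) (ltn_ord j).
by rewrite invf_le1 ?ler1n// ltr0n.
Qed.

Let e_of eps := eps `^ p^-1.
Let c0 : R := n%:R^-1.

(** The i-th coordinate is negative, of the order of the width of the body
    in the direction - e_i; the others range well inside the cube of edge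
    1/n, which is contained in the positive unit ball. *)
Definition side_box (i : 'I_n) (e eta : R) : set 'rV[R]_n :=
  box (fun j => if j == i then - (e * eta / 2) else c0 / 8)
      (fun j => if j == i then - (e * eta / 4) else 3 * c0 / 8).

(** Let l be the support point of the zonoid in the direction - e_i and e =
    eps^(1/p). A point y of the box is (1 - t) k + t e l for some k in the
    positive unit ball: its i-th coordinate determines t, which lies
    between 1/4 and 1/2, and k remains in the ball because e l is small. *)
Lemma side_box_pert (i : 'I_n) eps : 0 < eps -> 0 < h (- delta_mx 0 i) ->
  e_of eps * slope h <= c0 / 8 ->
  side_box i (e_of eps) (h (- delta_mx 0 i)) `<=` pert_body p h eps.
Proof.
move=> eps0 eta0 small y yB.
have [l hl lE] := ah (- delta_mx 0 i).
move: yB small; rewrite /side_box; set e := e_of eps; set eta := h _ in eta0 lE *.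
move=> yB small; have e0 : 0 < e by exact: powR_gt0.
have li : l 0 i = - eta by rewrite -lE dotNl dot_delta opprK.
have n0 : (0 < n)%N by exact: leq_ltn_trans (leq0n i) (ltn_ord i).
have c0_gt0 : 0 < c0 by rewrite invr_gt0 ltr0n.
(* The i-th coordinate of t e l is - t e eta, which has to be that of y. *)
pose t := - y 0 i / (e * eta).
have eeta : 0 < e * eta by exact: mulr_gt0.
have yi := yB i; rewrite eqxx in yi; case/andP: yi => yi1 yi2.
have t1 : 1 / 4 <= t by rewrite ler_pdivlMr//; lra.
have t2 : t <= 1 / 2 by rewrite ler_pdivrMr//; lra.
have ti : t * e * l 0 i = y 0 i.
  by rewrite li mulrN -mulrA /t divfK ?opprK// gt_eqF.
have el j : `|e * l 0 j| <= c0 / 8.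
  rewrite normrM gtr0_norm//; apply: le_trans small.
  by apply: ler_wpM2l; [exact: ltW|exact: wulff_coord].
pose k : 'rV[R]_n := \row_j if j == i then 0 else (y 0 j - t * (e * l 0 j)) / (1 - t).
have t10 : 0 < 1 - t by lra.
have -> : y = (1 - t) *: k + (t * e) *: l.
  apply/rowP => j; rewrite !mxE; case: eqP => [->|_]; first by rewrite mulr0 add0r ti.
  by rewrite mulrCA mulfV ?gt_eqF// mulr1 -mulrA subrK.
apply: pert_body_comb => //; try lra.
  have : (1 - t) `^ q + t `^ q <= (1 - t + t) `^ q.
    by apply: powR_superadd; [exact: ltW|exact: ltW|lra].
  by rewrite subrK powR1.
apply: small_coord_quarter_ball => j; rewrite mxE -/c0.
case: ifP => [_|ji]; first by rewrite lexx ltW.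
have := yB j; rewrite ji => /andP[y1 y2].
have := el j; rewrite ler_norml => /andP[z1 z2].
move: (e * l 0 j) z1 z2 => z z1 z2.
have tz1 : t * z <= t * (c0 / 8) by rewrite ler_wpM2l//; lra.
have tz2 : t * - (c0 / 8) <= t * z by rewrite ler_wpM2l//; lra.
have tc : t * c0 <= 1 / 2 * c0 by rewrite ler_wpM2r// ltW.
apply/andP; split.
  by apply: divr_ge0; [lra|exact: ltW].
by rewrite ler_pdivrMr//; lra.
Qed.

Lemma lebesgue_side_box (i : 'I_n) (e eta : R) : 0 < e -> 0 < eta ->
  lebesgue_rV (side_box i e eta) = (e * (eta / 4 * (c0 / 4) ^+ n.-1))%:E.
Proof.
move=> e0 eta0; have n0 : (0 < n)%N by exact: leq_ltn_trans (leq0n i) (ltn_ord i).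
have c0_gt0 : 0 < c0 by rewrite invr_gt0 ltr0n.
have eeta : 0 < e * eta by exact: mulr_gt0.
rewrite lebesgue_rV_box; last by move=> j; case: ifP => _; lra.
congr EFin; rewrite (bigD1 i)//= eqxx.
rewrite (eq_bigr (fun=> c0 / 4)); last by move=> j /negbTE ->; lra.
rewrite prodr_const (_ : #|_| = n.-1); last by rewrite cardC1 card_ord.
by rewrite mulrA; congr (_ * _); lra.
Qed.

(** The box adds a volume of order eps^(1/p) to that of the positive unit
    ball, whereas the pieces of the symmetrized body lie in its dilate by 1
    + O(eps). *)
Lemma strict_outside_orthant (i : 'I_n) : 0 < h (- delta_mx 0 i) ->
  \forall eps \near 0^'+,
    (lebesgue_rV (sym_body p h eps) < (2 ^+ n)%:E * lebesgue_rV (pert_body p h eps))%E.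
Proof.
move=> eta0; set eta := h _ in eta0 *.
have n0 : (0 < n)%N by exact: leq_ltn_trans (leq0n i) (ltn_ord i).
have c0_gt0 : 0 < c0 by rewrite invr_gt0 ltr0n.
have [b b0 bE] := lebesgue_rV_fin borel_quarter_ball ler01 quarter_ball_cube.
have gb0 := gbound_ge0 p h; set gb := gbound p h in gb0.
pose C1 := (1 + gb) ^+ n.
pose kap := eta / 4 * (c0 / 4) ^+ n.-1.
have kap0 : 0 < kap by rewrite mulr_gt0 ?divr_gt0// exprn_gt0// divr_gt0.
have C10 : 0 <= C1 by rewrite exprn_ge0// addr_ge0.
have s0 := slope_ge0 h.
have iq0 : 0 < q^-1 by rewrite invr_gt0.
have ip0 : 0 < p^-1 by rewrite invr_gt0.
have near1 := near_powR_lt ip0 (divr_gt0 (divr_gt0 c0_gt0 (ltr0n R 8)) (ltr_wpDl s0 ltr01)).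
(* eps is eps^(1/p) eps^(1/q), so that the smallness of eps^(1/q) is what
   makes O(eps) negligible with respect to eps^(1/p). *)
have near2 := near_powR_lt iq0 (divr_gt0 kap0 (ltr_wpDl (mulr_ge0 C10 b0) ltr01)).
near=> eps.
have eps0 : 0 < eps by near: eps; exact: nbhs_right_gt.
have eps1 : eps <= 1 by near: eps; exact: nbhs_right_le.
have small1 : eps `^ p^-1 < c0 / 8 / (slope h + 1) by near: eps; exact: near1.
have small2 : eps `^ q^-1 < kap / (C1 * b + 1) by near: eps; exact: near2.
have eps_ge0 := ltW eps0.
have e0 : 0 < e_of eps by exact: powR_gt0.
have small : e_of eps * slope h <= c0 / 8.
  move: small1; rewrite ltr_pdivlMr ?ltr_wpDl// mulrDr mulr1 -/(e_of eps); lra.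
have mW : borel (sym_body p h eps) by apply: borel_wulff; exact: asym.
have mZ : borel (pert_body p h eps) by apply: borel_wulff; exact: apert.
have mB := borel_quarter_ball.
have mX : borel (side_box i (e_of eps) eta) by exact: borel_box.
have cell_le s : (lebesgue_rV (sym_cell eps s) <= ((1 + eps * gb) ^+ n * b)%:E)%E.
  have r0 : 0 < 1 + eps * gb by rewrite ltr_wpDr// mulr_ge0.
  rewrite EFinM -bE quarter_ballE -lebesgue_qsector//; last exact: measurableT.
  apply: le_lebesgue_rV; [exact: borel_sym_cell|apply: borel_qsector => //; exact: measurableT|].
  by move=> y [y0 Wy]; split=> //; exact: sym_body_qnorm Wy.
have lower : ((b + e_of eps * kap)%:E <= lebesgue_rV (pert_body p h eps))%E.
  rewrite EFinD -bE -(lebesgue_side_box i e0 eta0) -lebesgue_rV_disjoint//.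
    apply: le_lebesgue_rV => //; first exact: borel_setU.
    by move=> y [|]; [exact: quarter_ball_pert|exact: side_box_pert].
  apply/seteqP; split=> // y [[y0 _] yX].
  have := yX i; rewrite eqxx; have := y0 i; have : 0 < e_of eps * eta by exact: mulr_gt0.
  lra.
apply: (@le_lt_trans _ _ (2 ^+ n * ((1 + eps * gb) ^+ n * b))%:E).
  apply: (le_trans (lebesgue_rV_orthants_le mW)).
  apply: (@le_trans _ _ (\sum_(s : {ffun 'I_n -> bool}) ((1 + eps * gb) ^+ n * b)%:E)%E).
    by apply: lee_sum => s _; exact: cell_le.
  by rewrite sumEFin sumr_const card_ffun card_bool card_ord lee_fin -[leLHS]mulr_natl natrX.
have p2 : 0 < 2 ^+ n :> R by rewrite exprn_gt0.
apply: (@lt_le_trans _ _ ((2 ^+ n)%:E * (b + e_of eps * kap)%:E)%E); last first.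
  by rewrite lee_pmul2l// ?lte_fin.
rewrite -EFinM lte_fin ltr_pM2l//.
apply: (@le_lt_trans _ _ ((1 + eps * C1) * b)).
  rewrite ler_wpM2r//; apply: (le_trans (bernoulli_chord _ gb0 _)); first by rewrite eps_ge0.
  by rewrite lerD2l ler_wpM2l// gerBl.
rewrite mulrDl mul1r ltrD2l.
have -> : eps * C1 * b = e_of eps * (eps `^ q^-1 * (C1 * b)).
  rewrite mulrA /e_of -powRD ?conj_expV// ?powRr1 ?mulrA//.
  by rewrite oner_eq0.
have D0 : 0 < C1 * b + 1 by rewrite ltr_wpDl// mulr_ge0.
have E0 : 0 < eps `^ q^-1 by exact: powR_gt0.
rewrite ltr_pM2l//; move: small2; rewrite ltr_pdivlMr// mulrDr mulr1; lra.
Unshelve. all: by end_near.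
Qed.

End OutsideOrthant.

(** * Points far from the coordinate hyperplanes *)

Section InsideOrthant.
Context {R : realType} {n : nat}.
Variable p : R.
Hypothesis p1 : 1 < p.
Variable h : 'rV[R]_n -> R.
Hypothesis ah : attained h.
Hypothesis h_ge0 : forall x, 0 <= h x.
Hypothesis zh : zonoidal p h.
Hypothesis h_axis : forall i, h (- delta_mx 0 i) = 0.
Implicit Types (x y v l k : 'rV[R]_n) (eps : R).

Local Notation q := (conj_exp p).
Local Notation qnorm := (qnorm q).
Local Notation gpow := (gpow p h).
Local Notation gsym := (gsym p h).

Let p0 : 0 < p. Proof. exact: lt_trans p1. Qed.
Let p_ge0 : 0 <= p. Proof. exact: ltW. Qed.
Let pneq0 : p != 0. Proof. by rewrite gt_eqF. Qed.
Let pm1 : 0 < p - 1. Proof. by rewrite subr_gt0. Qed.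
Let q1 : 1 < q. Proof. exact: conj_exp_gt1. Qed.
Let q0 : 0 < q. Proof. exact: lt_trans q1. Qed.

(** The distance to the coordinate hyperplanes, in units of eps, from which
    inner_point applies. *)
Definition margin : R := (slope h * n%:R) `^ (p - 1) * slope h.

Lemma margin_ge0 : 0 <= margin.
Proof. by rewrite mulr_ge0 ?powR_ge0 ?slope_ge0. Qed.

Lemma sym_support_flip_le (s : 'I_n -> bool) eps x : 0 <= eps -> nonneg x ->
  sym_support p h eps (flip s x) <= pert_support p h eps x.
Proof.
move=> e0 x0; apply: le_powR; first by rewrite invr_ge0.
  by rewrite addr_ge0 ?abs_sum_ge0// mulr_ge0// gsym_ge0.
by rewrite abs_sum_flip// lerD2l ler_wpM2l//; exact: zonoid_flip_le.
Qed.

(** By zonoid_flip_le the point y satisfies the constraints of the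
    perturbed body in the nonnegative directions. For another direction x
    let x+ and x- be its positive and negative parts. Passing from x+ to x
    decreases <x,y> by at least delta |x-|_1, and the support function by
    at most eps * margin * |x-|_1, because h is Lipschitz; hence the
    constraint at x follows from that at x+. *)
Lemma inner_point (s : 'I_n -> bool) eps delta y : 0 <= eps -> nonneg y ->
  (forall i, delta <= y 0 i) -> eps * margin <= delta ->
  sym_body p h eps (flip s y) -> pert_body p h eps y.
Proof.
move=> e0 y0 yd emd Wy x.
set xp := pos_part x; pose xm := pos_part (- x).
have xE : x = xp - xm by exact: pos_part_sub.
have xp0 : nonneg xp by exact: pos_part_nonneg.
have xm0 : nonneg xm by exact: pos_part_nonneg.
have posE : pos_sum p xp = pos_sum p x.
  by apply: eq_bigr => i _; rewrite mxE [pos (pos _)]pos_id ?pos_ge0.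
have bX := pert_supportX p1 h xp e0; have aX := pert_supportX p1 h x e0.
have xpb : dot xp y <= pert_support p h eps xp.
  rewrite -(flip_dot s); apply: (le_trans (Wy _)).
  exact: sym_support_flip_le.
have b0 := pert_support_ge0 p h eps xp; have a0 := pert_support_ge0 p h eps x.
move: bX aX xpb b0 a0.
move: (pert_support p h eps xp) (pert_support p h eps x) => b a bX aX xpb b0 a0.
have xmd : delta * norm1 xm <= dot xm y.
  rewrite /norm1 mulr_sumr; apply: ler_sum => i _.
  by rewrite (ger0_norm (xm0 i)) mulrC ler_wpM2l.
have xmy0 : 0 <= dot xm y by exact: dot_nonneg.
have -> : dot x y = dot xp y - dot xm y by rewrite {1}xE dotDl dotNl.
have [ba|ab] := leP b a; first by lra.
suff : b - a <= eps * margin * norm1 xm.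
  have := ler_wpM2r (norm1_ge0 xm) emd; lra.
have xpa i : xp 0 i <= a.
  rewrite -(powRK pneq0 (xp0 i)) -(powRK pneq0 a0) aX.
  apply: le_powR; rewrite ?invr_ge0 ?powR_ge0//.
  rewrite -posE; apply: ler_wpDr; first by rewrite mulr_ge0 ?gpow_ge0.
  by rewrite /pos_sum (bigD1 i)//= (pos_id (xp0 i)) lerDl sumr_ge0// => j _; exact: powR_ge0.
have nxp : norm1 xp <= n%:R * a.
  rewrite mulr_natl -[X in _ *+ X]card_ord -sumr_const; apply: ler_sum => i _.
  by rewrite (ger0_norm (xp0 i)).
have s0 := slope_ge0 h.
have hxp : h xp <= slope h * n%:R * a.
  by apply: (le_trans (le_slope ah _)); rewrite -mulrA ler_wpM2l.
have sn0 : 0 <= slope h * n%:R by rewrite mulr_ge0.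
have hpow : h xp `^ (p - 1) <= (slope h * n%:R) `^ (p - 1) * a `^ (p - 1).
  by rewrite -powRM//; apply: le_powR => //; exact: ltW.
have hdiff : h xp - h x <= slope h * norm1 xm.
  have xpx : xp - x = xm by rewrite [X in _ - X]xE opprB addrC subrK.
  have := slope_lipschitz ah xp x; rewrite xpx; lra.
have gdiff : gpow xp - gpow x <= p * h xp `^ (p - 1) * (h xp - h x).
  exact: le_powR_sub.
have tan := powR_tangent p1 b0 a0.
rewrite bX aX posE in tan.
have hp0 : 0 <= p * h xp `^ (p - 1) by rewrite mulr_ge0 ?powR_ge0.
have g2 : gpow xp - gpow x <= p * a `^ (p - 1) * (margin * norm1 xm).
  apply: (le_trans gdiff); apply: (le_trans (ler_wpM2l hp0 hdiff)).
  have sN : 0 <= p * (slope h * norm1 xm) by rewrite !mulr_ge0 ?norm1_ge0.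
  have := ler_wpM2l sN hpow; rewrite /margin.
  by congr (_ <= _); ring.
have a_gt0 : 0 < a.
  rewrite lt_neqAle a0 andbT; apply/eqP => a_eq0; move: aX bX ab hxp.
  rewrite -a_eq0 mulr0 powR0// posE => aX bX b_gt0 hxp0.
  have hxp_eq0 : h xp = 0 by apply/le_anti; rewrite hxp0 h_ge0.
  have : 0 < b `^ p by exact: powR_gt0.
  rewrite bX (_ : gpow xp = h xp `^ p)// hxp_eq0 powR0// mulr0 addr0.
  have := mulr_ge0 e0 (gpow_ge0 p h x); lra.
have pa : 0 < p * a `^ (p - 1) by rewrite mulr_gt0// powR_gt0.
rewrite -(ler_pM2l pa).
have := ler_wpM2l e0 g2; lra.
Qed.

End InsideOrthant.

(** * The second-order loss, and a direction of strict inequality *)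

Section Loss.
Context {R : realType} {n : nat}.
Variable p : R.
Hypothesis p1 : 1 < p.
Variable h : 'rV[R]_n -> R.
Hypothesis ah : attained h.
Hypothesis h_ge0 : forall x, 0 <= h x.
Hypothesis zh : zonoidal p h.
Hypothesis h_axis : forall i, h (- delta_mx 0 i) = 0.
Implicit Types (x y v l k : 'rV[R]_n) (eps : R).

Local Notation q := (conj_exp p).
Local Notation qnorm := (qnorm q).

Definition thin_cone (delta : R) : set 'rV[R]_n :=
  [set y : 'rV[R]_n | exists i, y 0 i <= delta * qnorm y].

Lemma conic_thin_cone delta : conic (thin_cone delta).
Proof.
move=> c y c0 [i yi]; exists i.
by rewrite mxE (qnormZ p1 _ (ltW c0)) mulrCA ler_pM2l.
Qed.

Lemma borel_thin_cone delta : borel (thin_cone delta).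
Proof.
suff mA (i : 'I_n) : borel [set y : 'rV[R]_n | y 0 i <= delta * qnorm y].
  exact: borel_exists mA.
pose f (y : @borel_rV R n) : measurableTypeR R := y 0 i - delta * qnorm y.
have mf : measurable_fun setT f.
  apply: measurable_funB; first exact: measurable_coord.
  exact: (measurable_funM (measurable_cst delta) (measurable_qnorm p)).
rewrite (_ : [set y | _] = f @^-1` `]-oo, 0]%classic); last first.
  by apply/seteqP; split=> y /=; rewrite in_itv /= subr_le0.
rewrite /borel -[X in measurable X]setTI.
exact: (mf measurableT _ (measurable_itv `]-oo, 0])).
Qed.

Lemma lebesgue_thin_cone delta : 0 <= delta ->
  exists2 a, 0 <= a <= n%:R * delta & lebesgue_rV (qsector p (thin_cone delta) 1) = a%:E.
Proof.
move=> d0; have mC := borel_qsector p 1 (borel_thin_cone delta).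
have [a a0 aE] := lebesgue_rV_fin mC ler01 (@qsector_cube _ _ p p1 _ _).
exists a => //; rewrite a0 /= -lee_fin -aE.
pose A (i : 'I_n) : set 'rV[R]_n := box (fun=> 0) (fun j => if j == i then delta else 1).
have mA i : borel (A i) by exact: borel_box.
have Ad (i : 'I_n) : (lebesgue_rV (A i) <= delta%:E)%E.
  rewrite lebesgue_rV_box; last by move=> j; case: ifP.
  rewrite (bigD1 i)//= eqxx subr0 big1 ?mulr1// => j /negbTE ->.
  by rewrite subr0.
apply: (@le_trans _ _ (lebesgue_rV [set x | exists i, A i x])).
  apply: le_lebesgue_rV => //; first exact: borel_exists.
  move=> y [y0 [i yi] y1]; exists i => j; rewrite y0 /=.
  case: eqP => [->|_].
    by apply: (le_trans yi); rewrite ler_piMr.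
  by apply: le_trans y1; apply: le_trans (coord_le_qnorm p1 y j); exact: ler_norm.
by apply: (le_trans (lebesgue_rV_exists mA Ad)); rewrite mulr_natl.
Qed.

(** In each orthant the symmetrized body exceeds the perturbed one only in a
    shell of width O(eps) around the sphere, and there only at distance O(eps)
    from the coordinate hyperplanes. *)
Lemma sym_cell_loss (s : 'I_n -> bool) eps : 0 <= eps ->
  sym_cell p h eps s `<=` pert_body p h eps `|`
    qshell p (thin_cone (eps * margin p h)) 1 (1 + eps * gbound p h).
Proof.
move=> e0 y [y0 Wy]; have m0 := margin_ge0 p h.
have d0 : 0 <= eps * margin p h by exact: mulr_ge0.
have yR := sym_body_qnorm p1 ah h_ge0 e0 y0 Wy.
have [y1|y1] := leP (qnorm y) 1; first by left; exact: quarter_ball_pert.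
have [[i yi]|yd] := pselect (exists i, y 0 i < eps * margin p h); last first.
  left; apply: (inner_point p1 ah h_ge0 zh h_axis e0 y0 _ (lexx _) Wy) => i.
  by rewrite leNgt; apply/negP => yi; apply: yd; exists i.
right; split.
  split=> //; exists i; apply: (le_trans (ltW yi)).
  by rewrite ler_peMr// ltW.
by case=> _ _; rewrite leNgt y1.
Qed.

(** One factor eps is the width of the shell, the other the opening of the
    cone. *)
Lemma lebesgue_loss eps : 0 <= eps -> eps <= 1 ->
  exists2 a, a <= eps * (eps * ((1 + gbound p h) ^+ n * n%:R * margin p h)) &
    lebesgue_rV (qshell p (thin_cone (eps * margin p h)) 1 (1 + eps * gbound p h)) = a%:E.
Proof.
move=> e0 e1; have m0 := margin_ge0 p h; have gb0 := gbound_ge0 p h.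
have d0 : 0 <= eps * margin p h by exact: mulr_ge0.
have [a /andP[a0 ad] aE] := lebesgue_thin_cone d0.
have r12 : 1 <= 1 + eps * gbound p h by rewrite lerDl mulr_ge0.
have -> := lebesgue_qshell p1 (borel_thin_cone _) (@conic_thin_cone _) ltr01 r12 aE.
eexists; last by reflexivity.
have b1 : (1 + eps * gbound p h) ^+ n - 1 ^+ n <= eps * (1 + gbound p h) ^+ n.
  rewrite expr1n lerBlDl; apply: (le_trans (bernoulli_chord _ gb0 _)); first by rewrite e0.
  by rewrite lerD2l ler_wpM2l// gerBl.
have b0 : 0 <= eps * (1 + gbound p h) ^+ n by rewrite mulr_ge0// exprn_ge0// addr_ge0.
apply: (le_trans (ler_wpM2r a0 b1)); apply: (le_trans (ler_wpM2l b0 ad)).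
by rewrite le_eqVlt; apply/orP; left; apply/eqP; ring.
Qed.

End Loss.

Section Gain.
Context {R : realType} {n : nat}.
Variable p : R.
Hypothesis p1 : 1 < p.
Variable h : 'rV[R]_n -> R.
Hypothesis ah : attained h.
Hypothesis h_ge0 : forall x, 0 <= h x.
Hypothesis h_axis : forall i, h (- delta_mx 0 i) = 0.
Implicit Types (x y v l k : 'rV[R]_n) (eps : R).

Local Notation q := (conj_exp p).
Local Notation qnorm := (qnorm q).
Local Notation gpow := (gpow p h).
Local Notation gsym := (gsym p h).

Let p0 : 0 < p. Proof. exact: lt_trans p1. Qed.
Let pneq0 : p != 0. Proof. by rewrite gt_eqF. Qed.
Let q1 : 1 < q. Proof. exact: conj_exp_gt1. Qed.
Let q0 : 0 < q. Proof. exact: lt_trans q1. Qed.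

Lemma gpowE x : gpow x = h x `^ p.
Proof. by []. Qed.

Lemma gpowZ c x : 0 <= c -> gpow (c *: x) = c `^ p * gpow x.
Proof. by move=> c0; rewrite !gpowE attainedZ// powRM. Qed.

Lemma flip1Z i c x : flip1 i (c *: x) = c *: flip1 i x.
Proof. by apply/rowP => j; rewrite !mxE mulrCA. Qed.

Lemma gsymZ c x : 0 <= c -> gsym (c *: x) = c `^ p * gsym x.
Proof. by move=> c0; rewrite /gsym -scalerN !gpowZ// mulrDr. Qed.

(** An upper bound of gsym at the points whose distance to x is controlled
    by t; it is continuous in t, with value gsym x at t = 0. *)
Let envelope (a : R) x (t : R) : R := (h x + a * `|t|) `^ p + (h (- x) + a * `|t|) `^ p.

Let envelope_cvg (a : R) x : 0 <= a -> envelope a x t @[t --> 0^'+] --> gsym x.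
Proof.
move=> a0; have cvg1 z : (h z + a * `|t|) `^ p @[t --> 0^'+] --> gpow z.
  apply: powR_cvg => //; first by move=> t; rewrite addr_ge0// mulr_ge0.
  rewrite -[X in _ --> X]addr0 -[X in _ --> _ + X](mulr0 a).
  apply: cvgD; first exact: cvg_cst.
  apply: cvgM; first exact: cvg_cst.
  have id0 : (t : R) @[t --> 0^'+] --> (0 : R) by apply: cvg_at_right_filter; exact: cvg_id.
  by have := cvg_norm id0; rewrite normr0; exact.
exact: cvgD (cvg1 x) (cvg1 (- x)).
Qed.

Let gsym_envelope (a : R) x y t : 0 <= t -> slope h * norm1 (y - x) <= a * t ->
  gsym y <= envelope a x t.
Proof.
move=> t0 yx; rewrite /envelope (ger0_norm t0); apply: lerD; apply: le_powR => //.
- exact: ltW.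
- by apply: (le_trans (slope_lipschitz ah y x)); rewrite lerD2l.
- exact: ltW.
apply: (le_trans (slope_lipschitz ah (- y) (- x))); rewrite lerD2l.
rewrite (_ : norm1 (- y - - x) = norm1 (y - x))//.
by apply: eq_bigr => j _; rewrite !mxE -opprD normrN.
Qed.

Let norm1_flip1 i x : norm1 (flip1 i x) = norm1 x.
Proof. by apply: eq_bigr => j _; rewrite flipE normrM normr_sign mul1r. Qed.

Let flip1B i x y : flip1 i (x - y) = flip1 i x - flip1 i y.
Proof. by apply/rowP => j; rewrite !mxE mulrBr. Qed.

Lemma gpow_monotone x y : (forall j, x 0 j <= y 0 j) -> gpow x <= gpow y.
Proof.
move=> xy; have [l hl lE] := ah x.
apply: le_powR; rewrite ?(ltW p0)//; apply: le_trans (hl y); rewrite -lE.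
by apply: ler_sum => j _; rewrite ler_wpM2r//; exact: (wulff_nonneg h_axis hl).
Qed.

(** Adding a small multiple of (1,...,1) makes all coordinates positive. It
    does not decrease gpow and increases gsym by as little as wanted, so
    that the strict inequality survives; both sides are homogeneous, which
    allows for the normalization. *)
Lemma strict_positive_direction i x1 : nonneg x1 ->
  gsym (flip1 i x1) < gpow x1 ->
  exists x0, [/\ forall j, 0 < x0 0 j, \sum_j x0 0 j `^ p = 1 &
    gsym (flip1 i x0) < gpow x0].
Proof.
move=> x10 gx1; pose one : 'rV[R]_n := \row_j 1.
pose a := slope h * norm1 one.
have a0 : 0 <= a by rewrite mulr_ge0 ?slope_ge0 ?norm1_ge0.
have near_lt := cvgr_lt _ (@envelope_cvg a (flip1 i x1) a0) _ gx1.
have [t [t0 ut]] : exists t : R, 0 < t /\ envelope a (flip1 i x1) t < gpow x1.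
  near (0 : R)^'+ => t; exists t; split; first by near: t; exact: nbhs_right_gt.
  by near: t; exact: near_lt.
pose z := x1 + t *: one.
have zpos j : 0 < z 0 j by rewrite !mxE mulr1 ltr_wpDl.
have gz : gsym (flip1 i z) < gpow z.
  apply: (@lt_le_trans _ _ (gpow x1)); last first.
    by apply: gpow_monotone => j; rewrite !mxE lerDl mulr1 ltW.
  apply: le_lt_trans ut; apply: gsym_envelope; first exact: ltW.
  rewrite -flip1B norm1_flip1 -mulrA ler_wpM2l ?slope_ge0//.
  rewrite mulrC /norm1 mulr_sumr; apply: ler_sum => j _.
  by rewrite !mxE addrC addKr mulr1 normr1 mulr1 gtr0_norm.
have S0 : 0 < \sum_j z 0 j `^ p.
  by rewrite (bigD1 i)//= ltr_pwDl ?powR_gt0// sumr_ge0// => j _; exact: powR_ge0.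
pose c := (\sum_j z 0 j `^ p) `^ (- p^-1).
have c0 : 0 < c by exact: powR_gt0.
have cp : c `^ p = (\sum_j z 0 j `^ p)^-1.
  by rewrite -powRrM mulNr mulVf// powRN powRr1// ltW.
exists (c *: z); split.
- by move=> j; rewrite mxE mulr_gt0.
- under eq_bigr => j _ do rewrite mxE powRM ?(ltW c0) ?(ltW (zpos j))//.
  by rewrite -mulr_sumr cp mulVf// gt_eqF.
by rewrite flip1Z gsymZ ?(ltW c0)// gpowZ ?(ltW c0)// ltr_pM2l// powR_gt0.
Unshelve. all: by end_near.
Qed.

(** When lam tends to 1 the window shrinks to x0, so that G' can be taken
    close to gsym (flip1 i x0), which is less than gpow x0; and 1/p + 1/q =
    1. *)
Lemma strict_window i x0 : (forall j, 0 < x0 0 j) -> gsym (flip1 i x0) < gpow x0 ->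
  exists lam G', [/\ 0 < lam, lam < 1, gpow x0 / q + G' / p < lam ^+ 2 * gpow x0 &
    forall X : 'rV[R]_n, (forall j, lam * x0 0 j <= X 0 j /\ lam * X 0 j <= x0 0 j) ->
      gsym (flip1 i X) <= G'].
Proof.
move=> x00 gx0; pose a := slope h * norm1 x0.
have a0 : 0 <= a by rewrite mulr_ge0 ?slope_ge0 ?norm1_ge0.
set g := gpow x0 in gx0 *; set G := gsym (flip1 i x0) in gx0 *.
have g0 : 0 <= g by exact: gpow_ge0.
pose D := (g - G) / p; have D0 : 0 < D by rewrite divr_gt0// subr_gt0.
have gx0' : G < G + (g - G) / 2 by rewrite ltrDl divr_gt0// subr_gt0.
have near_lt := cvgr_lt _ (@envelope_cvg a (flip1 i x0) a0) _ gx0'.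
have g41 : 0 < 4 * g + 1 by rewrite ltr_wpDl// mulr_ge0.
have [t [t0 ut tD]] : exists t : R, [/\ 0 < t,
    envelope a (flip1 i x0) t < G + (g - G) / 2 & t < D / (4 * g + 1)].
  near (0 : R)^'+ => t; exists t; split; first by near: t; exact: nbhs_right_gt.
    by near: t; exact: near_lt.
  by near: t; apply: nbhs_right_lt; rewrite divr_gt0.
have t1 : 0 < 1 + t by rewrite addr_gt0.
exists (1 + t)^-1, (envelope a (flip1 i x0) t); split.
- by rewrite invr_gt0.
- by rewrite invf_lt1// ltrDl.
- have lam1 : 1 - t <= (1 + t)^-1.
    by rewrite -[leRHS]mul1r ler_pdivlMr//; have := mulr_ge0 (ltW t0) (ltW t0); lra.
  have lam2 : 1 - 2 * t <= (1 + t)^-1 ^+ 2.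
    have i0 : 0 <= (1 + t)^-1 by rewrite invr_ge0 ltW.
    have i1 : (1 + t)^-1 * (1 + t) = 1 by rewrite mulVf// gt_eqF.
    move: ((1 + t)^-1) lam1 i0 i1 => lam lam1 i0 i1.
    have lam_le1 : lam <= 1 by have := mulr_ge0 i0 (ltW t0); lra.
    have : 0 <= (1 - lam) * (1 - lam) by rewrite mulr_ge0 ?subr_ge0.
    rewrite expr2; nra.
  have h1 : (1 - 2 * t) * g <= (1 + t)^-1 ^+ 2 * g by rewrite ler_wpM2r.
  have h2 : t * (4 * g + 1) < D by rewrite -ltr_pdivlMr.
  have h3 : envelope a (flip1 i x0) t / p < (G + (g - G) / 2) / p.
    by rewrite ltr_pM2r// invr_gt0.
  have h4 : (G + (g - G) / 2) / p = G / p + D / 2 by rewrite /D; field.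
  have h5 : g / q = g - g / p.
    have -> : q^-1 = 1 - p^-1 by rewrite -(conj_expV p1) addrC addKr.
    by rewrite mulrBr mulr1.
  have h6 : D = g / p - G / p by rewrite /D mulrBl.
  rewrite h4 in h3; rewrite h5; lra.
move=> X Xwin; apply: gsym_envelope; first exact: ltW.
rewrite -flip1B norm1_flip1 -mulrA ler_wpM2l ?slope_ge0//.
rewrite mulrC /norm1 mulr_sumr; apply: ler_sum => j _.
have [X1 X2] := Xwin j.
rewrite (gtr0_norm (x00 j)) !mxE.
move: X1 X2; rewrite ![_^-1 * _]mulrC ler_pdivrMr// ler_pdivrMr// => X1 X2.
have xj := x00 j.
by rewrite ler_norml; apply/andP; split; nra.
Unshelve. all: by end_near.
Qed.

End Gain.

(** * The cone of points with nearby normals *)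

Lemma le_expr_sub (R : realType) (r1 r2 : R) m : 0 <= r1 -> r1 <= r2 ->
  (r2 - r1) * r2 ^+ m <= r2 ^+ m.+1 - r1 ^+ m.+1.
Proof.
move=> r10 r12; have r20 : 0 <= r2 by exact: le_trans r12.
rewrite mulrBl !exprS lerD2l lerN2 ler_wpM2l//.
by rewrite lerXn2r// nnegrE.
Qed.

Section WindowCone.
Context {R : realType} {n : nat}.
Variable p : R.
Hypothesis p1 : 1 < p.
Implicit Types (x y v l k : 'rV[R]_n) (eps : R).

Local Notation q := (conj_exp p).
Local Notation qnorm := (qnorm q).

Let pm1 : 0 < p - 1. Proof. by rewrite subr_gt0. Qed.
Let q1 : 1 < q. Proof. exact: conj_exp_gt1. Qed.
Let q0 : 0 < q. Proof. exact: lt_trans q1. Qed.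
Let qm1 : 0 < q - 1. Proof. by rewrite subr_gt0. Qed.

Variables (x0 : 'rV[R]_n) (lam : R).
Hypothesis x0_gt0 : forall j, 0 < x0 0 j.
Hypothesis x0_unit : \sum_j x0 0 j `^ p = 1.
Hypothesis lam0 : 0 < lam.
Hypothesis lam1 : lam < 1.

(** The point of the unit sphere of qnorm with outer normal x0. *)
Definition normal_point : 'rV[R]_n := \row_j x0 0 j `^ (p - 1).

Let y0 := normal_point.

Let y0_gt0 j : 0 < y0 0 j.
Proof. by rewrite mxE powR_gt0. Qed.

Let qnorm_y0 : qnorm y0 = 1.
Proof.
apply: (powR_inj q0); rewrite ?qnorm_ge0// qnormX// powR1 -[RHS]x0_unit.
apply: eq_bigr => j _.
by rewrite gtr0_norm// mxE -powRrM conj_expP.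
Qed.

Let dl := lam `^ (p - 1).

Let dl0 : 0 < dl. Proof. exact: powR_gt0. Qed.

Let dl1 : dl < 1.
Proof.
have -> : 1 = 1 `^ (p - 1) :> R by rewrite powR1.
by apply: gt0_ltr_powR; rewrite ?nnegrE// ltW.
Qed.

(** In these cones the dual of y lies in the window around x0 of
    strict_window: window_cone_dual raises the inequalities to the power q
    - 1, which is the inverse of p - 1. *)
Definition window_cone : set 'rV[R]_n :=
  [set y | forall j, dl * (y0 0 j * qnorm y) <= y 0 j /\ dl * y 0 j <= y0 0 j * qnorm y].

Lemma conic_window_cone : conic window_cone.
Proof.
move=> c y c0 Cy j; rewrite (qnormZ p1 _ (ltW c0)) [(c *: y) 0 j]mxE; have [h1 h2] := Cy j.
by split; [have := ler_wpM2l (ltW c0) h1|have := ler_wpM2l (ltW c0) h2];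
  congr (_ <= _); ring.
Qed.

Lemma borel_window_cone : borel window_cone.
Proof.
have half (a b : R) (j : 'I_n) :
    borel [set y : 'rV[R]_n | a * qnorm y + b * y 0 j <= 0].
  pose f (y : @borel_rV R n) : measurableTypeR R := a * qnorm y + b * y 0 j.
  have mf : measurable_fun setT f.
    apply: measurable_funD.
      exact: (measurable_funM (measurable_cst a) (measurable_qnorm p)).
    exact: (measurable_funM (measurable_cst b) (measurable_coord j)).
  rewrite (_ : [set y | _] = f @^-1` `]-oo, 0]%classic); last first.
    by apply/seteqP; split=> y /=; rewrite in_itv.
  rewrite /borel -[X in measurable X]setTI.
  exact: (mf measurableT _ (measurable_itv `]-oo, 0])).
have mA j := borel_setI (half (dl * y0 0 j) (-1) j) (half (- y0 0 j) dl j).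
rewrite (_ : window_cone = [set y | forall j,
    ([set y | dl * y0 0 j * qnorm y + -1 * y 0 j <= 0] `&`
     [set y | - y0 0 j * qnorm y + dl * y 0 j <= 0]) y]); first exact: borel_forall.
by apply/seteqP; split=> y /= Cy j; have [h1 h2] := Cy j; split; move: h1 h2; lra.
Qed.

Lemma window_cone_dual y j : nonneg y -> window_cone y -> 0 < qnorm y ->
  lam * x0 0 j <= dual p y 0 j /\ lam * dual p y 0 j <= x0 0 j.
Proof.
move=> yn Cy N0; have [h1 h2] := Cy j; rewrite mxE.
have lamE : lam = dl `^ (q - 1) by rewrite -powRrM conj_expM1// powRr1// ltW.
have x0E : x0 0 j = y0 0 j `^ (q - 1).
  by rewrite mxE -powRrM conj_expM1// powRr1// ltW.
have t0 : 0 <= y 0 j / qnorm y by rewrite divr_ge0// ltW.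
have d_ge0 := ltW dl0; have y_ge0 := ltW (y0_gt0 j).
have A1 : dl * y0 0 j <= y 0 j / qnorm y by rewrite ler_pdivlMr// -mulrA.
have A2 : dl * (y 0 j / qnorm y) <= y0 0 j by rewrite mulrA ler_pdivrMr.
have qm1_ge0 := ltW qm1.
rewrite lamE x0E -(powRM _ d_ge0 y_ge0) -(powRM _ d_ge0 t0).
by split; apply: le_powR => //; exact: mulr_ge0.
Qed.

(** The part of the cone in the unit ball contains a box with normal_point
    as its greatest vertex. *)
Lemma lebesgue_window_cone :
  exists2 a, 0 < a & lebesgue_rV (qsector p window_cone 1) = a%:E.
Proof.
have mC := borel_qsector p 1 borel_window_cone.
have [a a_ge0 aE] := lebesgue_rV_fin mC ler01 (@qsector_cube _ _ p p1 _ _).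
exists a => //; rewrite -lte_fin -aE.
pose B := box (fun j => dl * y0 0 j) (fun j => y0 0 j).
have d1 j : dl * y0 0 j < y0 0 j by rewrite gtr_pMl.
apply: (@lt_le_trans _ _ (lebesgue_rV B)).
  rewrite lebesgue_rV_box; last by move=> j; rewrite ltW.
  by rewrite lte_fin prodr_gt0// => j _; rewrite subr_gt0.
apply: le_lebesgue_rV => //; first exact: borel_box.
move=> y yB.
have yn : nonneg y.
  by move=> j; have /andP[+ _] := yB j; apply: le_trans; rewrite mulr_ge0// ltW.
have N1 : qnorm y <= 1.
  rewrite -qnorm_y0; apply: le_qnorm => // j; rewrite !ger0_norm//; last exact: ltW.
  by have /andP[] := yB j.
have Nd : dl <= qnorm y.
  rewrite -[leLHS]mulr1 -qnorm_y0 -(qnormZ p1 _ (ltW dl0)); apply: le_qnorm => // j.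
  have /andP[yj _] := yB j.
  by rewrite mxE !ger0_norm// mulr_ge0// ltW.
split=> // j; have /andP[h1 h2] := yB j; split.
  apply: le_trans h1; apply: ler_wpM2l; first exact: ltW.
  by rewrite ler_piMr// ltW.
apply: (@le_trans _ _ (dl * y0 0 j)); first by rewrite ler_wpM2l// ltW.
by rewrite mulrC ler_wpM2l// ltW.
Qed.

End WindowCone.

(** * The gain is of first order *)

Section StrictInside.
Context {R : realType} {n : nat}.
Variable p : R.
Hypothesis p1 : 1 < p.
Variable h : 'rV[R]_n -> R.
Hypothesis ah : attained h.
Hypothesis h_ge0 : forall x, 0 <= h x.
Hypothesis zh : zonoidal p h.
Hypothesis h_axis : forall i, h (- delta_mx 0 i) = 0.
Hypothesis apert : forall eps, 0 < eps -> attained (pert_support p h eps).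
Hypothesis asym : forall eps, 0 < eps -> attained (sym_support p h eps).
Implicit Types (x y v l k : 'rV[R]_n) (eps : R).

Local Notation q := (conj_exp p).
Local Notation qnorm := (qnorm q).
Local Notation gpow := (gpow p h).
Local Notation gsym := (gsym p h).

Let p0 : 0 < p. Proof. exact: lt_trans p1. Qed.
Let q1 : 1 < q. Proof. exact: conj_exp_gt1. Qed.
Let q0 : 0 < q. Proof. exact: lt_trans q1. Qed.
Let qneq0 : q != 0. Proof. by rewrite gt_eqF. Qed.

(** By Bernoulli's inequality 1 + e is at most (1 + e/q)^q, and (1 - e/q)(1
    + e/q) is at most 1; hence (1 - e/q)^q is at most 1/(1 + e). *)
Lemma tangent_budget (e w : R) : 0 <= e -> e / q <= 1 -> w * (1 + e) <= 1 ->
  (1 - e / q) `^ q + w * e <= 1.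
Proof.
move=> e0 eq1 we; pose d := e / q.
have d0 : 0 <= d by rewrite divr_ge0// ltW.
have e1 : 0 < 1 + e by rewrite ltr_pwDl.
have d1 : 0 <= 1 + d by rewrite addr_ge0.
have d1' : 0 <= 1 - d by rewrite subr_ge0.
have X0 : 0 <= (1 - d) `^ q by exact: powR_ge0.
have tan : 1 + e <= (1 + d) `^ q.
  have := powR_tangent q1 d1 ler01; rewrite !powR1 mulr1 (addrC 1 d) addrK.
  by rewrite /d mulrCA mulfV// mulr1.
have prod : (1 - d) `^ q * (1 + d) `^ q <= 1.
  have dd : (1 - d) * (1 + d) <= 1 by have := mulr_ge0 d0 d0; lra.
  rewrite -powRM//; have := le_powR (ltW q0) (mulr_ge0 d1' d1) dd.
  by rewrite powR1.
have h1 := ler_wpM2l X0 tan.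
have h2 := ler_wpM2r e0 we.
rewrite -(ler_pM2r e1) mul1r -/d; lra.
Qed.

Definition gain_set (C : set 'rV[R]_n) r1 r2 v : set 'rV[R]_n :=
  [set z | qshell p C r1 r2 (z + v)].

(** Let l0 be the support point of the zonoid in the direction x0. Moved by
    eps mu l0, a conical shell of radii r1 < r2 and of width r2 - r1 = eps
    c1 remains in the perturbed body by pert_body_comb, because r2 = 1 -
    eps g/q leaves room for the summand l0. For a point y of the shell,
    <dual y, y + eps mu l0> is at least |y| + eps lam^2 g, which exceeds
    the bound 1 + eps G'/p of dual_le when |y| is greater than r1: the
    moved shell is disjoint from the piece of the symmetrized body given by
    the change of the i-th sign. Its volume is of order eps, and the losses
    are of order eps^2. *)
Lemma strict_inside_orthant i x1 : nonneg x1 -> gsym (flip1 i x1) < gpow x1 ->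
  \forall eps \near 0^'+,
    (lebesgue_rV (sym_body p h eps) < (2 ^+ n)%:E * lebesgue_rV (pert_body p h eps))%E.
Proof.
move=> x1_ge0 gx1.
have [x0 [x0_gt0 x0_unit gx0]] := strict_positive_direction p1 ah h_ge0 h_axis x1_ge0 gx1.
have [lam [G' [lam0 lam1 window Gwin]]] := strict_window p1 ah h_ge0 x0_gt0 gx0.
pose C := window_cone p x0 lam.
have mC : borel C by exact: borel_window_cone.
have cC : conic C by exact: conic_window_cone.
have [aC aC0 aCE] := lebesgue_window_cone p1 x0_gt0 x0_unit lam0 lam1.
have [l0 hl0 l0E] := ah x0.
have l0_ge0 := wulff_nonneg h_axis hl0.
set g := gpow x0 in gx0 window.
have g0 : 0 < g by apply: le_lt_trans gx0; exact: gsym_ge0.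
have H0 : 0 < h x0 by apply: (gt0_powR p0 (h_ge0 x0)).
(* The weight of l0 in Hoelder's inequality for the direction x0, lowered
   by lam to absorb the variation of the normals in the cone. *)
pose mu := lam * h x0 `^ (p - 1).
have mu0 : 0 < mu by rewrite mulr_gt0// powR_gt0.
have muH : mu * (lam * h x0) = lam ^+ 2 * g.
  by rewrite /g gpowE -(mulr_powRB1 (ltW H0) p0) /mu; ring.
have G'0 : 0 <= G'.
  apply: le_trans (Gwin x0 _); first exact: gsym_ge0.
  by move=> j; rewrite ler_piMl// ltW.
pose c1 := lam ^+ 2 * g - g / q - G' / p.
have c10 : 0 < c1 by rewrite /c1; lra.
have gb0 := gbound_ge0 p h; have m0 := margin_ge0 p h.
pose kap := c1 * (1 / 2) ^+ n.-1 * aC.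
have kap0 : 0 < kap by rewrite !mulr_gt0// exprn_gt0// divr_gt0.
pose L := (1 + gbound p h) ^+ n * n%:R * margin p h.
have L0 : 0 <= L.
  by apply: mulr_ge0 => //; apply: mulr_ge0 => //; apply: exprn_ge0; exact: addr_ge0.
have n0 : (0 < n)%N by exact: leq_ltn_trans (leq0n i) (ltn_ord i).
have p2 : 0 < 2 ^+ n :> R by rewrite exprn_gt0.
have lamq0 : 0 < lam `^ q by exact: powR_gt0.
have lamq1 : lam `^ q < 1.
  have -> : 1 = 1 `^ q :> R by rewrite powR1.
  by apply: gt0_ltr_powR; rewrite ?nnegrE// ltW.
have gq0 : 0 <= g / q by rewrite divr_ge0 ?(ltW g0) ?(ltW q0).
have D1 : 0 < g / q + 1 by rewrite ltr_wpDl.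
have D2 : 0 < lam ^+ 2 * g + 1 by rewrite ltr_wpDl// mulr_ge0 ?exprn_ge0 ?(ltW lam0) ?(ltW g0).
have D3 : 0 < lam `^ q * g + 1 by rewrite ltr_wpDl// mulr_ge0 ?(ltW lamq0) ?(ltW g0).
have D4 : 0 < 2 ^+ n * L + 1 by rewrite ltr_wpDl// mulr_ge0// ltW.
near=> eps.
have eps0 : 0 < eps by near: eps; exact: nbhs_right_gt.
have eps1 : eps <= 1 by near: eps; exact: nbhs_right_le.
have s1 : eps < 1 / 2 / (g / q + 1) by near: eps; apply: nbhs_right_lt; rewrite divr_gt0// divr_gt0.
have s2 : eps < 1 / (lam ^+ 2 * g + 1) by near: eps; apply: nbhs_right_lt; rewrite divr_gt0.
have s3 : eps < (1 - lam `^ q) / (lam `^ q * g + 1).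
  by near: eps; apply: nbhs_right_lt; rewrite divr_gt0// subr_gt0.
have s4 : eps < kap / (2 ^+ n * L + 1) by near: eps; apply: nbhs_right_lt; rewrite divr_gt0.
have eps_ge0 := ltW eps0.
move: s1 s2 s3 s4; rewrite !ltr_pdivlMr// !mulrDr !mulr1 => s1 s2 s3 s4.
pose r2 := 1 - eps * g / q; pose r1 := 1 + eps * (G' / p - lam ^+ 2 * g).
have r2_half : 1 / 2 <= r2 by rewrite /r2 -mulrA; move: s1 eps0; lra.
have r20 : 0 < r2 by apply: lt_le_trans r2_half; rewrite divr_gt0.
have eG : 0 <= eps * (G' / p) by rewrite mulr_ge0// divr_ge0// ltW.
have r10 : 0 < r1 by rewrite /r1 mulrBr; move: s2 eG eps0; lra.
have r21 : r2 - r1 = eps * c1 by rewrite /r2 /r1 /c1; ring.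
have r12 : r1 <= r2 by rewrite -subr_ge0 r21 mulr_ge0// ltW.
pose v := - (eps * mu) *: l0.
pose Gam := gain_set C r1 r2 v.
have mS : borel (qshell p C r1 r2) by apply: borel_setD; exact: borel_qsector.
have mG : borel Gam by exact: borel_translate.
have GamE : lebesgue_rV Gam = ((r2 ^+ n - r1 ^+ n) * aC)%:E.
  by rewrite /Gam lebesgue_rV_translate// (lebesgue_qshell p1 mC cC r10 r12 aCE).
set gam := (r2 ^+ n - r1 ^+ n) * aC in GamE.
have gam_ge : eps * kap <= gam.
  rewrite /gam /kap !mulrA; apply: ler_wpM2r; first exact: ltW.
  have := le_expr_sub n.-1 (ltW r10) r12; rewrite prednK// r21.
  apply: le_trans; rewrite ler_wpM2l ?mulr_ge0 ?(ltW c10)//.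
  by rewrite lerXn2r// nnegrE ltW// divr_gt0.
have GamZ : Gam `<=` pert_body p h eps.
  move=> z [[y0 _ yr2] _]; set y := z + v in y0 yr2.
  pose beta := mu * eps `^ q^-1.
  have beps : beta * eps `^ p^-1 = eps * mu.
    rewrite /beta -mulrA -powRD; last by rewrite addrC conj_expV// oner_eq0.
    by rewrite addrC conj_expV// powRr1// mulrC.
  have -> : z = r2 *: (r2^-1 *: y) + (beta * eps `^ p^-1) *: l0.
    by rewrite scalerA mulfV ?gt_eqF// scale1r beps /y /v scaleNr subrK.
  have betaq : beta `^ q = lam `^ q * (eps * g).
    rewrite /beta /mu !powRM ?powR_ge0 ?mulr_ge0 ?powR_ge0 ?(ltW lam0)//.
    by rewrite powRVK// -powRrM conj_expP// /g gpowE; ring.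
  apply: pert_body_comb => //.
  - exact: ltW.
  - by rewrite mulr_ge0 ?powR_ge0// ltW.
  - rewrite betaq; apply: tangent_budget.
    + by rewrite mulr_ge0// ltW.
    + by rewrite -mulrA; move: s1 eps0; lra.
    + by rewrite mulrDr mulr1 mulrCA; move: s3 eps0; lra.
  split; first by move=> j; rewrite mxE mulr_ge0// invr_ge0 ltW.
  have r2V : 0 <= r2^-1 by rewrite invr_ge0 ltW.
  by rewrite (qnormZ p1 _ r2V) mulrC ler_pdivrMr// mul1r.
pose s0 : {ffun 'I_n -> bool} := [ffun j => pred1 i j].
have s0E : flip s0 = flip1 i :> ('rV[R]_n -> 'rV[R]_n).
  by apply/funext => x; apply/rowP => j; rewrite !flipE ffunE.
have GamW : Gam `&` sym_cell p h eps s0 = set0.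
  apply/seteqP; split=> // z [[[y0 Cy yr2] yr1] [z0 Wz]]; set y := z + v in y0 Cy yr2 yr1.
  have N1 : r1 < qnorm y.
    by rewrite ltNge; apply/negP => yr; apply: yr1; split.
  have N0 : 0 < qnorm y by exact: lt_trans N1.
  have win j := window_cone_dual p1 x0_gt0 lam0 j y0 Cy N0.
  have GX : gsym (flip s0 (dual p y)) <= G' by rewrite s0E; exact: Gwin.
  have := dual_le p1 eps_ge0 y0 N0 Wz GX.
  have zE : z = y + (eps * mu) *: l0 by rewrite /y /v scaleNr subrK.
  rewrite zE dotDr dotZr dot_dual//.
  have Xl0 : lam * h x0 <= dot (dual p y) l0.
    rewrite -l0E -dotZl; apply: ler_sum => j _.
    by rewrite mxE ler_wpM2r//; have [] := win j.
  have := ler_wpM2l (ltW mu0) Xl0; rewrite muH => /(ler_wpM2l eps_ge0).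
  move: N1; rewrite /r1 mulrBr; lra.
have [S SL SE] := lebesgue_loss p1 h eps_ge0 eps1.
have mW : borel (sym_body p h eps) by exact: (borel_wulff (asym eps0)).
have mZ : borel (pert_body p h eps) by exact: (borel_wulff (apert eps0)).
pose Sh : set 'rV[R]_n :=
  qshell p (thin_cone p (eps * margin p h)) 1 (1 + eps * gbound p h).
have mSh : borel Sh.
  have mT := @borel_thin_cone R n p (eps * margin p h).
  exact: (borel_setD (borel_qsector p _ mT) (borel_qsector p _ mT)).
have [z z0 zE] := lebesgue_wulff_fin (apert eps0).
have ZSE : (lebesgue_rV (pert_body p h eps `|` Sh) <= (z + S)%:E)%E.
  by apply: (le_trans (lebesgue_rV_setU mZ mSh)); rewrite EFinD SE -zE.
have mZS := borel_setU mZ mSh.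
have mcell s : borel (sym_cell p h eps s) by exact: borel_sym_cell.
have loss s := sym_cell_loss p1 ah h_ge0 zh h_axis (s := s) eps_ge0.
pose f (s : {ffun 'I_n -> bool}) : R := (z + S) - (if s == s0 then gam else 0).
have cell_le (s : {ffun 'I_n -> bool}) : (lebesgue_rV (sym_cell p h eps s) <= (f s)%:E)%E.
  rewrite /f; case: eqP => [->|_].
    rewrite EFinB leeBrDr// -GamE -lebesgue_rV_disjoint//; last by rewrite setIC.
    apply: le_trans ZSE; apply: le_lebesgue_rV => //; first exact: borel_setU.
    by move=> y [Wy|/GamZ]; [exact: (loss s0)|left].
  by rewrite subr0; apply: le_trans ZSE; apply: le_lebesgue_rV => //; exact: (loss s).
apply: (le_lt_trans (lebesgue_rV_orthants_le mW)).
apply: (@le_lt_trans _ _ (\sum_(s : {ffun 'I_n -> bool}) (f s)%:E)%E).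
  by apply: lee_sum => s _; exact: cell_le.
rewrite sumEFin zE -EFinM lte_fin /f big_split /= sumr_const card_ffun card_bool card_ord.
rewrite sumrN -big_mkcond big_pred1_eq -[X in X - _]mulr_natl natrX mulrDr -addrA gtrDl subr_lt0.
apply: lt_le_trans gam_ge.
apply: (@le_lt_trans _ _ (2 ^+ n * (eps * (eps * L)))); first by rewrite ler_wpM2l// ltW.
rewrite mulrCA ltr_pM2l// mulrCA; lra.
Unshelve. all: by end_near.
Qed.

End StrictInside.

(** * The case of equality, and changes of basis *)

Section Unconditional.
Context {R : realType} {n : nat}.
Variable p : R.
Hypothesis p1 : 1 < p.
Variable h : 'rV[R]_n -> R.
Variable a : 'I_n -> R.
Hypothesis a_ge0 : forall i, 0 <= a i.
Hypothesis hE : forall x, h x `^ p = \sum_i pos (a i * x 0 i) `^ p.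
Variable eps : R.
Hypothesis eps0 : 0 <= eps.
Hypothesis asym : attained (sym_support p h eps).
Implicit Types (x y : 'rV[R]_n).

Let p0 : 0 < p. Proof. exact: lt_trans p1. Qed.
Let pneq0 : p != 0. Proof. by rewrite gt_eqF. Qed.

Let gsymE x : gsym p h x = \sum_i `|a i * x 0 i| `^ p.
Proof.
rewrite /gsym !gpowE !hE -big_split; apply: eq_bigr => i _ /=.
by rewrite mxE mulrN (pos_powN p1).
Qed.

Let gpow_nonpos x : nonneg x -> gpow p h (- x) = 0.
Proof.
move=> x0; rewrite gpowE hE big1// => i _.
by rewrite mxE mulrN pos_eq0 ?powR0// oppr_le0 mulr_ge0.
Qed.

Let sym_support_flip (s : 'I_n -> bool) x :
  sym_support p h eps (flip s x) = sym_support p h eps x.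
Proof.
rewrite /sym_support; congr (_ `^ _); congr (_ + eps * _).
  by apply: eq_bigr => i _; rewrite !flipE !normrM !normr_sign !mul1r.
rewrite !gsymE; apply: eq_bigr => i _.
by rewrite !flipE !normrM !normr_sign !mul1r.
Qed.

Let sym_body_flip (s : 'I_n -> bool) x : sym_body p h eps x -> sym_body p h eps (flip s x).
Proof. by move=> Wx y; rewrite -[y](flipK s) flip_dot sym_support_flip; exact: Wx. Qed.

Let sym_support_pos_part x : sym_support p h eps (pos_part x) = pert_support p h eps x.
Proof.
rewrite /sym_support /pert_support; congr (_ `^ _); congr (_ + eps * _).
  by apply: eq_bigr => i _; rewrite mxE ger0_norm// pos_ge0.
rewrite /gsym gpow_nonpos; last exact: pos_part_nonneg.
rewrite addr0 !gpowE !hE; apply: eq_bigr => i _; congr (_ `^ _).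
rewrite mxE; have [x0|/ltW x0] := leP 0 (x 0 i); first by rewrite (pos_id x0).
by rewrite (pos_eq0 x0) mulr0 (pos_eq0 (mulr_ge0_le0 (a_ge0 i) x0)) pos_id.
Qed.

(** For nonnegative y only the positive part of a direction matters, and
    the two support functions agree there. *)
Lemma unconditional_quarter : sym_body p h eps `&` @nonneg R n = pert_body p h eps.
Proof.
apply/seteqP; split=> y.
  move=> [Wy y0] x; apply: (@le_trans _ _ (dot (pos_part x) y)).
    rewrite [x in leLHS]pos_part_sub dotDl dotNl gerBl.
    by apply: dot_nonneg => //; exact: pos_part_nonneg.
  by rewrite -sym_support_pos_part; exact: Wy.
move=> Zy; split.
  move=> x; apply: (le_trans (Zy x)); apply: le_powR; rewrite ?invr_ge0 ?(ltW p0)//.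
    by rewrite addr_ge0 ?pos_sum_ge0// mulr_ge0// gpow_ge0.
  rewrite lerD//; last by rewrite ler_wpM2l// lerDl gpow_ge0.
  by apply: ler_sum => i _; apply: le_powR; rewrite ?(ltW p0) ?pos_ge0 ?pos_norm.
have e0 i : nonneg (delta_mx 0 i : 'rV[R]_n) by move=> j; rewrite mxE; case: eqP.
move=> i; have := Zy (- delta_mx 0 i).
rewrite dotNl dot_delta /pert_support gpow_nonpos; last exact: e0.
rewrite mulr0 addr0 /pos_sum big1; last first.
  by move=> j _; rewrite mxE pos_eq0 ?powR0// oppr_le0; exact: e0.
by rewrite powR0 ?invr_neq0// oppr_le0.
Qed.

Lemma unconditional_volume :
  lebesgue_rV (sym_body p h eps) = ((2 ^+ n)%:E * lebesgue_rV (pert_body p h eps))%E.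
Proof.
rewrite -unconditional_quarter; apply: (lebesgue_rV_symmetric (r := slope (sym_support p h eps))).
- exact: borel_wulff.
- exact: wulff_cube.
- by move=> s x; exact: sym_body_flip.
Qed.

End Unconditional.

Lemma near_right_exists (R : realType) (P : R -> Prop) :
  (\forall e \near 0^'+, P e) -> exists2 e0 : R, 0 < e0 & forall e, 0 < e -> e <= e0 -> P e.
Proof.
move=> /nbhs_ballP[d /= d0 dP]; exists (d / 2); first by rewrite divr_gt0.
move=> e e0 ed; apply: dP => //=.
rewrite /ball /= sub0r normrN gtr0_norm//; lra.
Qed.

Section ChangeOfBasis.
Context {R : realType} {n : nat}.
Variable U : 'M[R]_n.
Hypothesis uU : U \in unitmx.
Implicit Types (x y : 'rV[R]_n) (K L : set 'rV[R]_n) (f : 'rV[R]_n -> R).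

Let V := (invmx U)^T.

Lemma mulmx_dualK x : x *m U^T *m V = x.
Proof. by rewrite /V -mulmxA -trmx_mul mulVmx// trmx1 mulmx1. Qed.

Lemma mulmx_dualVK x : x *m V *m U^T = x.
Proof. by rewrite /V -mulmxA -trmx_mul mulmxV// trmx1 mulmx1. Qed.

Lemma wulff_basis f : [set y | wulff f (y *m U)] = wulff (fun x => f (x *m V)).
Proof.
apply/seteqP; split=> y fy x /=.
  by have := fy (x *m V); rewrite dot_mulmx mulmx_dualVK.
by rewrite dot_mulmx; have := fy (x *m U^T); rewrite mulmx_dualK.
Qed.

Lemma attained_basis f : attained f -> attained (fun x => f (x *m V)).
Proof.
move=> af x0; have [l fl lE] := af (x0 *m V).
have lV x : dot x (l *m invmx U) = dot (x *m V) l by rewrite dot_mulmx.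
by exists (l *m invmx U); [move=> x; rewrite lV; exact: fl|rewrite lV].
Qed.

End ChangeOfBasis.

(** * The theorem *)

Lemma muleCI (R : realType) (c : R) (t w z : \bar R) : 0 < c ->
  (c%:E * w = t * (c%:E * z))%E -> w = (t * z)%E.
Proof.
move=> c0; rewrite muleCA => /(congr1 (fun v => (c^-1)%:E * v)%E).
by rewrite !muleA -EFinM mulVf ?gt_eqF// !mul1e.
Qed.

Section Main.
Context {R : realType} {n : nat}.
Variable p : R.
Hypothesis p1 : 1 < p.
Variable zeta : set 'rV[R]_n.
Variable u : 'I_n -> 'rV[R]_n.
Hypothesis zzeta : asym_Lp_zonoid p zeta.
Hypothesis ufree : free [tuple u i | i < n].
Implicit Types (x y : 'rV[R]_n) (eps : R).

Let p0 : 0 < p. Proof. exact: lt_trans p1. Qed.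
Let pneq0 : p != 0. Proof. by rewrite gt_eqF. Qed.

Let U : 'M[R]_n := \matrix_i u i.
Let V : 'M[R]_n := (invmx U)^T.

Let uU : U \in unitmx.
Proof.
rewrite -row_free_unit; apply: inj_row_free => k kU; apply/rowP => i; rewrite mxE.
apply: (freeP ufree (fun i => k 0 i)); rewrite -[RHS]kU mulmx_sum_row.
by apply: eq_bigr => j _; rewrite -tnth_nth tnth_mktuple rowK.
Qed.

Let segment0 (v : 'rV[R]_n) : segment 0 v 0.
Proof. by exists 0; rewrite ?scaler0 ?scale0r ?addr0//= in_itv /= lexx ler01. Qed.

Let support_basis_sum (a : 'I_n -> R) :
  let S := \big[lpsum p / [set 0]]_(i < n) segment 0 (a i *: u i) in
  lp_body S /\
  forall x, support S (x *m V) `^ p = \sum_i pos (a i * x 0 i) `^ p.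
Proof.
have [bS sS] := big_lpsumP p1 (index_enum 'I_n) (P := xpredT)
  (fun i _ => lp_body_segment (segment0 (a i *: u i))).
split=> // x; rewrite sS; apply: eq_bigr => i _.
rewrite (support_segment_powR p1)// dot0r maxxx powR0// add0r dotZr.
rewrite (_ : u i = delta_mx 0 i *m U); last by rewrite -rowE rowK.
by rewrite dot_mulmx mulmx_dualVK// dotC dot_delta.
Qed.

Let h x : R := support zeta (x *m V).

Let bzeta : lp_body zeta.
Proof. by have [] := zonoidP p1 zzeta. Qed.

Let zh : zonoidal p h.
Proof. by have [_] := zonoidP p1 zzeta; exact: zonoidal_linear. Qed.

Let ah : attained h.
Proof. by apply: attained_basis; apply: attained_support; have [] := bzeta. Qed.

Let h_ge0 x : 0 <= h x.
Proof. by have [_] := bzeta; exact. Qed.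

Let zetaE (a : 'I_n -> R) :
  zeta = \big[lpsum p / [set 0]]_(i < n) segment 0 (a i *: u i) <->
  forall x, h x `^ p = \sum_i pos (a i * x 0 i) `^ p.
Proof.
have [[bS S0] sS] := support_basis_sum a; have [bz z0] := bzeta.
split=> [zE x|hE]; first by rewrite /h zE sS.
apply: convex_body_inj => //; apply/funext => x.
by apply: (powR_inj p0) => //; rewrite -(mulmx_dualK uU x) sS -hE.
Qed.

Section Epsilon.
Variable eps : R.
Hypothesis eps0 : 0 < eps.

Let Z := lp_perturbation p u zeta eps.
Let W := lpsum p Z (reflect0 Z).

Let bZ : lp_body Z /\ forall x, support Z (x *m V) = pert_support p h eps x.
Proof.
have [bS sS] := support_basis_sum (fun=> 1).
have SE : \big[lpsum p / [set 0]]_(i < n) segment 0 (1 *: u i) =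
    \big[lpsum p / [set 0]]_(i < n) segment 0 (u i).
  by apply: eq_bigr => i _; rewrite scale1r.
rewrite /= SE in bS sS.
have e0 : 0 <= eps `^ p^-1 by exact: powR_ge0.
have [bz sz] := lpsumP p1 bS (lp_body_scale bzeta e0).
split=> // x; have [bzeta1 _] := bzeta; have [_ Z0] := bz.
apply: (powR_inj p0) => //; first exact: powR_ge0.
rewrite pert_supportX// ?(ltW eps0)// sz sS support_scale//.
rewrite powRM//; last exact: h_ge0.
rewrite powRVK// ?(ltW eps0)//; congr (_ + _).
by apply: eq_bigr => i _; rewrite mul1r.
Qed.

Let bW : lp_body W /\ forall x, support W (x *m V) = sym_support p h eps x.
Proof.
have [bz sz] := bZ; have [bw sw] := lpsumP p1 bz (lp_body_reflect0 bz).
split; [exact: bw|move=> x]; have [bz1 _] := bz; have [_ W0] := bw.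
have eps_ge0 := ltW eps0.
apply: (powR_inj p0) => //; first exact: powR_ge0.
rewrite sw (support_reflect0 _ bz1) -mulNmx (sz x) (sz (- x)).
by apply/esym; exact: sym_supportX.
Qed.

Let body_basis K f : lp_body K -> (forall x, support K (x *m V) = f x) ->
  [/\ attained f, borel K & [set y | K (y *m U)] = wulff f].
Proof.
move=> [bK _] /funext sK; have aK := attained_support bK.
have KE := convex_bodyE bK.
split.
- by rewrite -sK; exact: attained_basis.
- by rewrite KE; exact: borel_wulff.
by rewrite {1}KE wulff_basis// -/V sK.
Qed.

Lemma pert_attained : attained (pert_support p h eps).
Proof. by have [bz sz] := bZ; have [] := body_basis bz sz. Qed.

Lemma sym_attained : attained (sym_support p h eps).
Proof. by have [bw sw] := bW; have [] := body_basis bw sw. Qed.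

Lemma lebesgue_basis : exists2 c : R, 0 < c &
  lebesgue_rV (pert_body p h eps) = (c%:E * lebesgue_rV Z)%E /\
  lebesgue_rV (sym_body p h eps) = (c%:E * lebesgue_rV W)%E.
Proof.
have [c c0 cE] := lebesgue_linear uU; exists c => //.
have [bz sz] := bZ; have [_ mZ ZE] := body_basis bz sz.
have [bw sw] := bW; have [_ mW WE] := body_basis bw sw.
by split; [rewrite -(cE _ mZ) ZE|rewrite -(cE _ mW) WE].
Qed.

Lemma strict_basis :
  (lebesgue_rV (sym_body p h eps) < (2 ^+ n)%:E * lebesgue_rV (pert_body p h eps))%E ->
  (lebesgue_rV W < (2 ^+ n)%:E * lebesgue_rV Z)%E.
Proof.
have [c c0 [-> ->]] := lebesgue_basis.
by rewrite muleCA lte_pmul2l.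
Qed.

Lemma equality_basis :
  lebesgue_rV (sym_body p h eps) = ((2 ^+ n)%:E * lebesgue_rV (pert_body p h eps))%E ->
  lebesgue_rV W = ((2 ^+ n)%:E * lebesgue_rV Z)%E.
Proof.
have [c c0 [-> ->]] := lebesgue_basis.
exact: muleCI.
Qed.

End Epsilon.

Lemma perturbed_volumes :
  (exists2 a : 'I_n -> R, (forall i, 0 <= a i) &
     (zeta = \big[lpsum p / [set 0]]_(i < n) segment 0 (a i *: u i) /\
      forall eps, 0 < eps ->
       let Z := lp_perturbation p u zeta eps in
       lebesgue_rV (lpsum p Z (reflect0 Z)) = ((2 ^+ n)%:E * lebesgue_rV Z)%E)) \/
  (~ (exists2 a : 'I_n -> R, (forall i, 0 <= a i) &
     zeta = \big[lpsum p / [set 0]]_(i < n) segment 0 (a i *: u i)) /\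
   \forall eps \near 0^'+,
       let Z := lp_perturbation p u zeta eps in
       (lebesgue_rV (lpsum p Z (reflect0 Z)) < (2 ^+ n)%:E * lebesgue_rV Z)%E).
Proof.
have [[a a0 zE]|nform] := pselect (exists2 a : 'I_n -> R, (forall i, 0 <= a i) &
    zeta = \big[lpsum p / [set 0]]_(i < n) segment 0 (a i *: u i)).
  left; exists a => //; split=> // eps eps0 Z; apply: equality_basis => //.
  apply: (unconditional_volume p1 a0) => //; first by apply/zetaE.
    exact: ltW.
  exact: sym_attained.
right; split=> //.
suff strict : \forall eps \near 0^'+,
    (lebesgue_rV (sym_body p h eps) < (2 ^+ n)%:E * lebesgue_rV (pert_body p h eps))%E.
  near=> eps; apply: strict_basis; first by near: eps; exact: nbhs_right_gt.
  by near: eps.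
have [[i hi]|haxis] := pselect (exists i, 0 < h (- delta_mx 0 i)).
  exact: (strict_outside_orthant p1 ah h_ge0 pert_attained sym_attained hi).
have h_axis i : h (- delta_mx 0 i) = 0.
  apply/le_anti; rewrite h_ge0 andbT leNgt; apply/negP => hi.
  by apply: haxis; exists i.
have [hE|[i [x x0 hx]]] := zonoid_dichotomy p1 ah h_ge0 zh h_axis.
  exfalso; apply: nform; exists (fun i => h (delta_mx 0 i)) => //.
  exact/zetaE.
exact: (strict_inside_orthant p1 ah h_ge0 zh h_axis pert_attained sym_attained x0 hx).
Unshelve. all: by end_near.
Qed.

End Main.

Theorem theorem5 (R : realType) (n : nat) (p : R) (zeta : set 'rV[R]_n)
    (u : 'I_n -> 'rV[R]_n) :
  1 < p ->
  asym_Lp_zonoid p zeta ->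
  free [tuple u i | i < n] ->
  exists2 eps0 : R, 0 < eps0 &
    forall eps : R, 0 < eps -> eps <= eps0 ->
      let Z := lp_perturbation p u zeta eps in
      (lebesgue_rV (lpsum p Z (reflect0 Z))
         <= (2 ^+ n)%:E * lebesgue_rV Z)%E
      /\
      (lebesgue_rV (lpsum p Z (reflect0 Z))
         = ((2 ^+ n)%:E * lebesgue_rV Z)%E
       <->
       exists2 a : 'I_n -> R, (forall i, 0 <= a i) &
         zeta = \big[lpsum p / [set 0]]_(i < n) segment 0 (a i *: u i)).
Proof.
move=> p1 zzeta ufree.
have eq_case (x y : \bar R) (P : Prop) : x = y -> P -> (x <= y)%E /\ (x = y <-> P).
  by move=> ->; split.
have lt_case (x y : \bar R) (P : Prop) : (x < y)%E -> ~ P -> (x <= y)%E /\ (x = y <-> P).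
  by move=> xy nP; split; [exact: ltW|split=> // xyE; move: xy; rewrite xyE ltxx].
have [[a a0 [zE volE]]|[nform strict]] := perturbed_volumes p1 zzeta ufree.
  exists 1 => // eps eps0 _; apply: eq_case; first exact: volE.
  by exists a.
have [e0 e0_gt0 he0] := near_right_exists strict.
by exists e0 => // eps eps0 epse; apply: lt_case; first exact: he0.
Qed.
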